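(* Let $\alpha>0$, $\beta>0$, $L>0$. Let the data $X^{(n)}$ be generated according to the Gaussian white noise model $$dX^{(n)}(t)=f(t)\,dt+\tfrac{1}{\sqrt n}\,dW(t),\qquad t\in[0,1],$$ with true function $f=f_0\in\mathcal F_{\beta,L}$, and let the prior $\Pi$ on $f$ be the law on $L^2[0,1]$ of $$X_\alpha=\sum_{k\ge1}k^{-1/2-\alpha}\alpha_k\,\varepsilon_k,$$ where $(\alpha_k)_{k\ge1}$ are independent standard normal variables and $(\varepsilon_k)_{k\geq 1}$ is the trigonometric basis. Let $\varphi_{f_0}$ be the concentration function of $X_\alpha$ at $f_0$ in $(L^2[0,1],\|\cdot\|_2)$, and set $r_n^{\alpha,\beta}=n^{-\frac{\alpha\wedge\beta}{2\alpha+1}}$. (i) Let $f_0\in\mathcal F_{\beta,L}$ and let $(\varepsilon_n)$, $(\zeta_n)$ be sequences of positive reals with $\varepsilon_n\to0$ such that $$\varphi_{f_0}(\varepsilon_n)\le n\varepsilon_n^2\quad\text{and}\quad \zeta_n\le\varphi_{f_0}^{-1}(9n\varepsilon_n^2).$$ Then for $M$ large enough, as $n\to+\infty$, $$\mathbf E_0\,\Pi\big(\zeta_n\le\|f-f_0\|_2\le M\varepsilon_n\,\big|\,X^{(n)}\big)\to1.$$ (ii) For any $f_0\in\mathcal F_{\beta,L}$, one can choose $\varepsilon_n$ as in (i) such that $\varepsilon_n\lesssim r_n^{\alpha,\beta}$ and, if $\alpha\le\beta$, one can choose (together with such an $\varepsilon_n$) $\zeta_n$ as in (i) such that $\zeta_n\gtrsim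 r_n^{\alpha,\beta}$. (iii) If $\beta<\alpha$, there exists $f_0\in\mathcal F_{\beta,L}$ such that for every $p>1+\beta/2$ and for $M$ large enough, as $n\to+\infty$, $$\mathbf E_0\,\Pi\big(r_n^{\alpha,\beta}\log^{-p}n\le\|f-f_0\|_2\le M r_n^{\alpha,\beta}\,\big|\,X^{(n)}\big)\to1.$$
   Context: $W$ is standard Brownian motion on $[0,1]$; $\|\cdot\|_2$ is the norm of $L^2[0,1]$; $a\wedge b=\min(a,b)$. The trigonometric orthonormal basis of $L^2[0,1]$ is $\varepsilon_1=1$ and, for $k\ge1$, $\varepsilon_{2k}(t)=\sqrt2\cos(2\pi kt)$, $\varepsilon_{2k+1}(t)=\sqrt2\sin(2\pi kt)$ (not to be confused with the rate sequence $\varepsilon_n$). The Sobolev ball is $$\mathcal F_{\beta,L}=\Big\{f\in L^2[0,1]:\ f=\sum_{k\ge1}f_k\varepsilon_k,\ \sum_{k\ge1}k^{2\beta}f_k^2\le L^2\Big\}.$$ $\mathbf E_0$ is expectation under the law of $X^{(n)}$ when $f=f_0$, and $\Pi(\cdot\mid X^{(n)})$ is the posterior distribution given by Bayes' formula. The Reproducing Kernel Hilbert Space of $X_\alpha$ is $\mathbb H^\alpha=\{\sum_{k\ge1}h_kk^{-1/2-\alpha}\varepsilon_k:\ (h_k)\in\ell^2\}$ with $\|\sum_kh_kk^{-1/2-\alpha}\varepsilon_k\|_{\mathbb H^\alpha}^2=\sum_kh_k^2$. The concentration function is, for $\varepsilon>0$, $$\varphi_{f_0}(\varepsilon)=\inf_{h\in\mathbb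 H^\alpha:\ \|h-f_0\|_2<\varepsilon}\|h\|_{\mathbb H^\alpha}^2-\log\mathbf P(\|X_\alpha\|_2<\varepsilon).$$ It is continuous and strictly decreasing on $(0,\infty)$, and $\varphi_{f_0}^{-1}$ denotes its inverse function. $a_n\lesssim b_n$ means $a_n\le Cb_n$ for all $n$ with a constant $C>0$ depending only on the fixed parameters $\alpha,\beta,L$ (not on $n$ or $f_0$); $a_n\gtrsim b_n$ means $b_n\lesssim a_n$. ''For $M$ large enough'' means: there is $M_0$ (not depending on $n$) such that the statement holds for every $M\ge M_0$. *)

(* Defs.v *)
From HB Require Import structures.
From mathcomp Require Import all_boot all_order all_algebra finmap.
From mathcomp Require Import all_classical all_reals all_analysis.
From mathcomp Require Import measurable_realfun.

Set Implicit Arguments.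
Unset Strict Implicit.
Unset Printing Implicit Defensive.
Import Order.TTheory GRing.Theory Num.Theory.
Import numFieldNormedType.Exports.

Local Open Scope classical_set_scope.
Local Open Scope ring_scope.

Section L2_unit_interval.
Variable R : realType.

Definition leb01 : {measure set (measurableTypeR R) -> \bar R} :=
  mrestr lebesgue_measure (measurable_itv `[0%R, 1%R]).

(* The elements are classes of functions on the whole line modulo equality
   almost everywhere on [0, 1], so that values off [0, 1] are irrelevant. *)
Definition L2 : Type := LspaceType2 leb01.

(* A representative of the class. *)
Definition L2_fun (f : L2) : R -> R := f.
Coercion L2_fun : L2 >-> Funclass.

(* [fine] loses nothing on square-integrable functions, the only ones this is
   applied to. *)
Definition l2norm (g : R -> R) : R := fine 'N[leb01]_2%:E[EFin \o g].

Definition L2_zero_class : {mfun_ leb01, measurableTypeR R >-> measurableTypeR R} :=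
  \pi_({mfun_ leb01, measurableTypeR R >-> measurableTypeR R})%qT
    (cst 0 : {mfun measurableTypeR R >-> measurableTypeR R}).

Lemma L2_zero_class_finite_norm : finite_norm leb01 2%:E L2_zero_class.
Proof.
have h : (repr L2_zero_class : R -> R) = cst 0 %[ae leb01].
  have /eqmodP/asboolP : repr L2_zero_class = cst 0 %[mod {mfun_ leb01,
      measurableTypeR R >-> measurableTypeR R}]%qT by rewrite reprK.
  exact.
rewrite /finite_norm unlock /=.
rewrite (@ae_eq_integral _ _ _ leb01 setT (cst 0%E)) //=.
- by rewrite integral0 poweR0r// invr_neq0.
- apply/measurable_EFinP; apply: (measurableT_comp (measurable_powR _)) => //.
  apply: measurableT_comp => //.
- apply: (@filterS _ _ (ae_filter_ringOfSetsType leb01) _ _ _ h) => x hx _ /=.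
  by rewrite /aqEqMfun_to_fun hx //= normr0 powR0// pnatr_eq0.
Qed.

HB.instance Definition _ := isFinLebesgue.Build _ _ _ leb01 2%:E (lee1n 2)
  L2_zero_class L2_zero_class_finite_norm.

HB.instance Definition _ := gen_eqMixin L2.
HB.instance Definition _ := gen_choiceMixin L2.
HB.instance Definition _ := isPointed.Build L2 (L2_zero_class : LspaceType2 leb01).

Definition L2_open (U : set L2) : Prop :=
  forall f, U f -> exists2 e : R, 0 < e & forall g : L2, l2norm (g \- f) < e -> U g.

HB.instance Definition _ := @isMeasurable.Build (sigma_display L2_open) L2
  <<s L2_open >> (@sigma_algebra0 _ setT L2_open)
  (@sigma_algebraC _ L2_open) (@sigma_algebra_bigcup _ setT L2_open).

End L2_unit_interval.

Section trigonometric_series.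
Variable R : realType.

(* Indexed from 1; the value at 0 is never used. *)
Definition trig (j : nat) (t : R) : R :=
  if j == 1%N then 1
  else if odd j then Num.sqrt 2 * sin (2 * pi * j./2%:R * t)
  else Num.sqrt 2 * cos (2 * pi * j./2%:R * t).

(* f = \sum_(k >= 1) c k * trig k, with convergence in L^2[0, 1] *)
Definition trig_expansion (f : L2 R) (c : nat -> R) : Prop :=
  l2norm (fun t => f t - \sum_(1 <= k < n.+1) c k * trig k t) @[n --> \oo] --> 0.

Definition sobolev_ball (beta L : R) : set (L2 R) :=
  [set f | exists2 c : nat -> R, trig_expansion f c &
    (\sum_(1 <= k <oo) (k%:R `^ (2 * beta) * c k ^+ 2)%:E <= (L ^+ 2)%:E)%E].

Definition prior_weight (alpha : R) (k : nat) : R := k%:R `^ (- 2^-1 - alpha).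

Definition rkhs_coord (alpha : R) (f : L2 R) (h : nat -> R) : Prop :=
  (\sum_(1 <= k <oo) (h k ^+ 2)%:E < +oo)%E /\
  trig_expansion f (fun k => h k * prior_weight alpha k).

Definition rkhs (alpha : R) : set (L2 R) :=
  [set f | exists h, rkhs_coord alpha f h].

(* The coordinates of index k >= 1 are unique since [trig] is orthonormal, so
   the choice made by [get] is immaterial. *)
Definition rkhs_sqnorm (alpha : R) (f : L2 R) : R :=
  fine (\sum_(1 <= k <oo) (get (rkhs_coord alpha f) k ^+ 2)%:E)%E.

End trigonometric_series.

Section random_elements.
Context d (Omega : measurableType d) (R : realType) (P : probability Omega R).

Definition mutually_independent (X : nat -> Omega -> R) : Prop :=
  forall (K : {fset nat}) (B : nat -> set (measurableTypeR R)),
    (forall k, measurable (B k)) ->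
    P (\bigcap_(k in [set` K]) X k @^-1` B k) =
      (\prod_(k <- K) P (X k @^-1` B k))%E.

(* centered normal with standard deviation s *)
Definition centered_normal (X : Omega -> R) (s : R) : Prop :=
  forall B : set (measurableTypeR R), measurable B ->
    P (X @^-1` B) = normal_prob 0 s B.

(* Only the times in [0, 1] matter. *)
Definition brownian_motion (W : R -> {RV P >-> R}) : Prop :=
  [/\ {ae P, forall w, W 0 w = 0},
      forall t : nat -> R, (forall i, 0 <= t i <= 1) ->
        (forall i, t i <= t i.+1) ->
        mutually_independent (fun i w => W (t i.+1) w - W (t i) w),
      forall s t : R, 0 <= s -> s < t -> t <= 1 ->
        centered_normal (fun w => W t w - W s w) (Num.sqrt (t - s)) &
      {ae P, forall w, {within `[0, 1], continuous (fun t => W t w)}}].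

Definition random_trig_series (alpha : R) (a : nat -> {RV P >-> R})
    (X : {RV P >-> L2 R}) : Prop :=
  [/\ mutually_independent (fun k => a k.+1),
      forall k, (0 < k)%N -> centered_normal (a k) 1 &
      {ae P, forall w,
        trig_expansion (X w) (fun k => prior_weight alpha k * a k w)}].

End random_elements.

Section prior.
Variable R : realType.

Definition series_prior (alpha : R) (Pi : probability (L2 R) R) : Prop :=
  exists d (Omega : measurableType d) (P : probability Omega R)
    (a : nat -> {RV P >-> R}) (X : {RV P >-> L2 R}),
    random_trig_series alpha a X /\
    (forall A, measurable A -> Pi A = distribution P X A).

Definition concentration (alpha : R) (Pi : probability (L2 R) R) (f0 : L2 R)
    (e : R) : R :=
  inf [set rkhs_sqnorm alpha h | h in
        [set h | rkhs alpha h /\ l2norm (h \- f0) < e]]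
  - ln (fine (Pi [set f : L2 R | l2norm f < e])).

Definition concentration_inv (alpha : R) (Pi : probability (L2 R) R)
    (f0 : L2 R) : R -> R :=
  'pinv_(fun=> 0) `]0, +oo[%classic (concentration alpha Pi f0).

Definition upper_rate (alpha : R) (Pi : probability (L2 R) R) (f0 : L2 R)
    (eps : nat -> R) : Prop :=
  [/\ forall n, (0 < n)%N -> 0 < eps n,
      eps n @[n --> \oo] --> 0 &
      forall n, (0 < n)%N ->
        concentration alpha Pi f0 (eps n) <= n%:R * eps n ^+ 2].

Definition lower_rate (alpha : R) (Pi : probability (L2 R) R) (f0 : L2 R)
    (eps zeta : nat -> R) : Prop :=
  forall n, (0 < n)%N ->
    0 < zeta n <= concentration_inv alpha Pi f0 (9 * n%:R * eps n ^+ 2).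

End prior.

Section white_noise_model.
Variable R : realType.

Definition cylinder : set (set (R -> R)) :=
  [set A | exists t : R, exists B : set (measurableTypeR R),
     [/\ 0 <= t <= 1, measurable B & A = [set x | B (x t)]]].

(* The product sigma-algebra of R^[0, 1]: only coordinates in [0, 1] count. *)
Definition trajectory : measurableType (sigma_display cylinder) :=
  g_sigma_algebraType cylinder.

Context d (Omega : measurableType d) (P : probability Omega R).
Implicit Types (W : R -> {RV P >-> R}) (p : L2 R * trajectory -> R).

(* X(t) = \int_0^t f(s) ds + W(t) / sqrt n *)
Definition white_noise W (n : nat) (f : R -> R) (w : Omega) : trajectory :=
  fun t => \int[lebesgue_measure]_(s in `[0, t]) f s + W t w / Num.sqrt n%:R.

(* [p (f, -)] is a density of the law of the data with signal f with respect
   to the law of the data with signal 0, i.e. of W / sqrt n; joint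
   measurability makes the integrals over f in Bayes' formula meaningful. *)
Definition likelihood W (n : nat) p : Prop :=
  [/\ measurable_fun setT p,
      forall z, 0 <= p z &
      forall (f : L2 R) (A : set trajectory), measurable A ->
        P (white_noise W n f @^-1` A) =
        (\int[P]_(w in white_noise W n (cst 0%R) @^-1` A)
            (p (f, white_noise W n (cst 0%R) w))%:E)%E].

Definition posterior (Pi : probability (L2 R) R) p (B : set (L2 R))
    (x : trajectory) : R :=
  fine (\int[Pi]_(f in B) (p (f, x))%:E)%E / fine (\int[Pi]_f (p (f, x))%:E)%E.

(* E_0 Pi(B n | X^(n)) --> 1 as n --> oo *)
Definition posterior_concentrates (Pi : probability (L2 R) R) W
    (p : nat -> L2 R * trajectory -> R) (f0 : L2 R)
    (B : nat -> set (L2 R)) : Prop :=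
  ('E_P[fun w => posterior Pi (p n) (B n) (white_noise W n f0 w)]
     @[n --> \oo] --> 1)%E.

End white_noise_model.

Definition annulus (R : realType) (f0 : L2 R) (a b : R) : set (L2 R) :=
  [set f | a <= l2norm (f \- f0) <= b].

Definition rate (R : realType) (alpha beta : R) (n : nat) : R :=
  n%:R `^ (- (Num.min alpha beta / (2 * alpha + 1))).

(* Main.v *)
(** The evidence [\int dP_f/dP_{f0} dPi(f)] is at least of order
    [exp(- 4 n eps^2)] with probability close to 1: the laws of two white
    noise experiments satisfy [P_{f0}(A)^4 <= exp(2/3 n ||f - f0||^2) P_f(A)],
    obtained by Cameron-Martin and Young's inequality for the increments on a
    finite time grid and then for all events by a monotone class argument,
    while the prior mass of the ball of radius 2 eps is at least [exp(- phi)], by a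
    shift of the Gaussian prior along its reproducing kernel Hilbert space.
    The ball of radius zeta has exponentially smaller prior mass, again by a
    shift together with a symmetry argument, so its posterior mass vanishes.
    Far away functions either have large energy beyond a cutoff frequency,
    which is unlikely under the prior by a Chernoff bound, or are separated
    from [f0] in finitely many trigonometric coefficients, which Riemann sums
    of the data test with exponentially small errors.

    The small ball cost of the prior is comparable with
    [\sum_k log(1 + t k^(-1 - 2 alpha))], of order [t^(1/(2 alpha + 1))], and
    truncating [f0] controls the approximation cost; this gives (ii).  For
    (iii) take the lacunary [f0] with coefficients [L 2^(- j beta) / (j + 7)]
    at the frequencies [2^j], up to constants: its approximation cost forces
    the lower bound on the posterior radius up to a power of [log n]. *)
Require Import Defs.
From HB Require Import structures.
From mathcomp Require Import all_boot all_order all_algebra finmap.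
From mathcomp Require Import all_classical all_reals all_analysis.
From mathcomp Require Import measurable_realfun.
From mathcomp Require Import ring lra.
Set Implicit Arguments.
Unset Strict Implicit.
Unset Printing Implicit Defensive.
Import Order.TTheory GRing.Theory Num.Theory.
Import numFieldNormedType.Exports.
Local Open Scope classical_set_scope.
Local Open Scope ring_scope.

(** The likelihood is given only as a jointly measurable density of the law of the data, without a
    formula, so the evidence cannot be bounded pointwise. Instead the change of signal inequality is
    applied to the event [A] that the evidence is below [k] times the density at the truth.
    Averaging over the ball [B] of radius 2 eps and Tonelli give P_{f0}(A)^3 Pi(B) <= exp(8v/3) k
    with v = n eps^2; for k = exp(-4v) and Pi(B) >= exp(-v) this leaves P_{f0}(A) <= exp(-v/9). All
    other terms must beat 1/k = exp(4v): the constant 9 of the statement makes the mass of the inner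
    ball at most exp(-9v/2), and cutoff and tests are tuned to exp(-5v). That v tends to infinity
    has to be derived: phi(eps) <= v and the Laplace transform of the squared norm of the prior
    force v >= log(1 + n)/3. The same comparison yields the cutoff frequency. *)

Section density.
Context d (T : measurableType d) (R : realType).
Variables (mu nu : {measure set T -> \bar R}) (g : T -> R).
Hypotheses (mg : measurable_fun setT g) (g0 : forall x, 0 <= g x).
Hypothesis nuE : forall A, measurable A -> nu A = (\int[mu]_(x in A) (g x)%:E)%E.
Local Open Scope ereal_scope.
Import HBNNSimple.

(** Approximation by simple functions from below. Three densities pass through here: the normal one,
    the indicator of [0, 1] behind [leb01], and the likelihood. *)
Lemma ge0_integral_density (f : T -> \bar R) :
  measurable_fun setT f -> (forall x, 0 <= f x) ->
  \int[nu]_x f x = \int[mu]_x (f x * (g x)%:E).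
Proof.
move=> mf f0.
pose h := nnsfun_approx measurableT mf.
have mh n : measurable_fun setT (h n) by exact: measurable_funP.
have hf x : (EFin \o h n) x @[n --> \oo] --> f x.
  by apply: cvg_nnsfun_approx.
have hnd x : {homo (fun n => (h n x)%:E) : a b / (a <= b)%N >-> a <= b}.
  by move=> a b ab; rewrite lee_fin; exact/lefP/nd_nnsfun_approx.
have -> : \int[nu]_x f x = limn (fun n => \int[nu]_x (h n x)%:E).
  rewrite -monotone_convergence//.
  - by apply: eq_integral => x _; apply/esym/cvg_lim => //; exact: hf.
  - by move=> n; exact/measurable_EFinP.
  - by move=> n x _; rewrite lee_fin.
have -> : \int[mu]_x (f x * (g x)%:E) =
    limn (fun n => \int[mu]_x ((h n x)%:E * (g x)%:E)).
  rewrite -monotone_convergence//.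
  - apply: eq_integral => x _; apply/esym/cvg_lim => //.
    by apply: cvgeZr => //; exact: hf.
  - by move=> n; apply: emeasurable_funM; exact/measurable_EFinP.
  - by move=> n x _; rewrite mule_ge0// lee_fin.
  - by move=> x _ a b ab; rewrite lee_wpmul2r ?lee_fin ?g0//; exact: hnd.
congr (limn _); apply/funext => n.
transitivity (\int[nu]_x
   (\sum_(y \in range (h n)) (y * \1_(h n @^-1` [set y]) x)%:E)).
  by apply: eq_integral => t _; rewrite fimfunE -fsumEFin.
have indich r : measurable_fun setT (fun x => (r * \1_(h n @^-1` [set r]) x)%:E).
  by apply: (measurable_comp measurableT) => //; exact: measurable_funM.
rewrite ge0_integral_fsum//; last by move=> m y Ey; exact: nnfun_muleindic_ge0.
transitivity (\int[mu]_x (\sum_(y \in range (h n))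
    (y * \1_(h n @^-1` [set y]) x)%:E * (g x)%:E)); last first.
  apply: eq_integral => x _; rewrite fimfunE -fsumEFin//.
  by rewrite ge0_mule_fsuml// => y; exact: nnfun_muleindic_ge0.
rewrite ge0_integral_fsum//; last 2 first.
  - by move=> y; apply: emeasurable_funM => //; exact/measurable_EFinP.
  - by move=> m y Ey; rewrite mule_ge0 ?lee_fin ?g0//; exact: nnfun_muleindic_ge0.
apply: eq_fsbigr => r rhn.
under eq_integral do rewrite EFinM.
rewrite integralZl_indic_nnsfun => //.
under [RHS]eq_integral do rewrite EFinM -muleA.
rewrite ge0_integralZl//.
- under [in RHS]eq_integral do rewrite muleC.
  rewrite [in RHS](eq_integral ((EFin \o g) \_ (h n @^-1` [set r]))); last first.
    by move=> x xE; rewrite epatch_indic.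
  by rewrite -integral_mkcond -nuE// integral_indic// setIT.
- by apply: emeasurable_funM; exact/measurable_EFinP.
- by move=> t Et; rewrite mule_ge0 ?lee_fin ?g0.
- by move: rhn; rewrite inE => -[t _ <-]; rewrite lee_fin.
Qed.

End density.

(** * Gaussian integrals on the line *)

Section gaussian.
Context (R : realType).
Local Notation mu := (@lebesgue_measure R).
Implicit Types (f : R -> \bar R) (x h s c g r : R).

Lemma lebesgue_measure_shift h (A : set (measurableTypeR R)) : measurable A ->
  pushforward mu ((fun x => x + h) : R -> measurableTypeR R) A = mu A.
Proof.
move=> mA; apply/esym/lebesgue_measure_unique => //=.
  exact: measurable_funD.
move=> ? _ [[a b]] _ <-.
rewrite /pushforward.
have -> : ((fun x => x + h) @^-1` `]a, b]) = `](a - h), (b - h)]%classic.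
  apply/seteqP; split => x /=; rewrite !in_itv/=; lra.
rewrite !lebesgue_measure_itv/= !lte_fin.
have -> : (a - h < b - h)%R = (a < b)%R by apply/idP/idP; lra.
by case: ifP => // _; rewrite -!EFinB; congr EFin; lra.
Qed.

Lemma ge0_integral_shift f h : measurable_fun setT f -> (forall x, 0 <= f x)%E ->
  (\int[mu]_x f (x + h)%R = \int[mu]_x f x)%E.
Proof.
move=> mf f0; transitivity
    (\int[pushforward mu ((fun x => x + h)%R : R -> measurableTypeR R)]_x f x)%E.
  by rewrite ge0_integral_pushforward//=; exact: measurable_funD.
apply: eq_measure_integral => //=; first exact: measurable_funD.
by move=> ? A mA _; exact: lebesgue_measure_shift.
Qed.

Lemma ge0_integral_reflect f h : measurable_fun setT f -> (forall x, 0 <= f x)%E ->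
  (\int[mu]_x f (h - x)%R = \int[mu]_x f x)%E.
Proof.
move=> mf f0; rewrite -[RHS](ge0_integral_shift h)//.
have mfh : measurable_fun setT (fun x : R => f (x + h)).
  by apply: (measurableT_comp mf); exact: measurable_funD.
transitivity (\int[pushforward mu (-%R : R -> measurableTypeR R)]_x f (x + h)%R)%E.
  rewrite ge0_integral_pushforward//=.
  by apply: eq_integral => x _ /=; rewrite addrC.
by apply: eq_measure_integral => //= A mA _; exact: lebesgue_measureN.
Qed.

Lemma ge0_integral_normal f s : measurable_fun setT f -> (forall x, 0 <= f x)%E ->
  (\int[normal_prob 0 s]_x f x = \int[mu]_x (f x * (normal_pdf 0 s x)%:E))%E.
Proof.
move=> mf f0; apply: ge0_integral_density => //.
- exact: measurable_normal_pdf.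
- by move=> x; exact: normal_pdf_ge0.
Qed.

(** Cameron-Martin formula on the line: translate the Lebesgue integral by [h] and complete the
    square in the exponent. *)
Lemma normal_shift f s h : s != 0 ->
  measurable_fun setT f -> (forall x, 0 <= f x)%E ->
  (\int[normal_prob 0 s]_x f (x + h)%R =
   \int[normal_prob 0 s]_x
     (f x * (expR (h / s ^+ 2 * x - h ^+ 2 / (2 * s ^+ 2)))%:E))%E.
Proof.
move=> s0 mf f0.
have mE : measurable_fun setT
    (fun x : R => (expR (h / s ^+ 2 * x - h ^+ 2 / (2 * s ^+ 2)))%:E).
  apply/measurable_EFinP; apply: measurableT_comp => //.
  by apply: measurable_funB => //; exact: measurable_funM.
rewrite !ge0_integral_normal//; last 3 first.
- exact: emeasurable_funM.
- by move=> x; rewrite mule_ge0// lee_fin expR_ge0.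
- by apply: (measurableT_comp mf); exact: measurable_funD.
rewrite -[RHS](ge0_integral_shift h); last 2 first.
- apply: emeasurable_funM; first exact: emeasurable_funM.
  by apply/measurable_EFinP; exact: measurable_normal_pdf.
- by move=> x; rewrite !mule_ge0// lee_fin ?expR_ge0// normal_pdf_ge0.
apply: eq_integral => x _; rewrite -muleA; congr (_ * _)%E.
rewrite -EFinM; congr EFin.
rewrite !(normal_pdfE _ s0) /normal_fun mulrCA -expRD; congr (_ * expR _).
rewrite !subr0 -mulr_natl; field.
by rewrite s0.
Qed.

Lemma normal_expR s h : s != 0 ->
  (\int[normal_prob 0 s]_x (expR (h * x))%:E = (expR (h ^+ 2 * s ^+ 2 / 2))%:E)%E.
Proof.
(* Shifting the constant 1 by h s^2 says that the normalized exponential tilt of slope [h] has total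
   mass 1, which is the formula up to its normalization. *)
move=> s0; have := @normal_shift (cst 1%E) s (h * s ^+ 2) s0.
move=> /(_ (measurable_cst _) (fun=> lee01)).
rewrite [X in X = _ -> _](_ : _ = 1%E); last first.
  rewrite /= integral_cst// mul1e; exact: (@probability_setT _ _ _ (normal_prob 0 s)).
have -> : (\int[normal_prob 0 s]_x
    (1 * (expR (h * s ^+ 2 / s ^+ 2 * x - (h * s ^+ 2) ^+ 2 / (2 * s ^+ 2)))%:E) =
  \int[normal_prob 0 s]_x ((expR (- (h ^+ 2 * s ^+ 2 / 2)))%:E * (expR (h * x))%:E))%E.
  apply: eq_integral => x _; rewrite mul1e -EFinM -expRD; congr (expR _)%:E.
  by field; rewrite s0.
rewrite ge0_integralZl//; last first.
  by apply/measurable_EFinP; apply: measurableT_comp => //; exact: measurable_funM.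
move=> e; rewrite expRN in e.
have k0 : expR (h ^+ 2 * s ^+ 2 / 2) != 0 by rewrite gt_eqF// expR_gt0.
by rewrite -[RHS]mule1 [X in (_ * X)%E]e muleA -EFinM divff// mul1e.
Qed.

(** The integrand times the standard normal density is a multiple of the normal density of variance
    1 / (1 + c). *)
Lemma normal_expR_sqr c : -1 < c ->
  (\int[normal_prob 0 1]_x (expR (- (c / 2 * x ^+ 2)))%:E =
   ((Num.sqrt (1 + c))^-1)%:E)%E.
Proof.
move=> c1; rewrite ge0_integral_normal//; last first.
  apply/measurable_EFinP; apply: measurableT_comp => //.
  by apply: measurableT_comp => //; apply: measurable_funM => //; exact: measurable_funX.
have k0 : 0 < Num.sqrt (1 + c) by rewrite sqrtr_gt0; lra.
pose s := (Num.sqrt (1 + c))^-1.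
have s0 : s != 0 by rewrite invr_eq0 gt_eqF.
have key (y : R) : - (c / 2 * y ^+ 2) + - y ^+ 2 / (1 ^+ 2 *+ 2) =
    - y ^+ 2 / ((1 + c)^-1 *+ 2).
  rewrite expr1n -[1 *+ 2]mulr_natr -[_^-1 *+ 2]mulr_natr mul1r invfM invrK.
  by lra.
have s2 : s ^+ 2 = (1 + c)^-1 by rewrite exprVn sqr_sqrtr//; lra.
transitivity (\int[mu]_x (s%:E * (normal_pdf 0 s x)%:E))%E; last first.
  rewrite ge0_integralZl//=; last 3 first.
  - by apply/measurable_EFinP; exact: measurable_normal_pdf.
  - by move=> x _; rewrite lee_fin normal_pdf_ge0.
  - by rewrite lee_fin invr_ge0 ltW.
  by rewrite integral_normal_pdf mule1.
apply: eq_integral => x _; rewrite -!EFinM; congr EFin.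
rewrite !normal_pdfE//= ?oner_neq0// /normal_peak /normal_fun mulrCA -expRD [RHS]mulrA.
congr (_ * expR _).
  rewrite expr1n mul1r s2 -[in RHS]mulrnAr sqrtrM ?invr_ge0; last lra.
  rewrite invfM sqrtrV; last lra.
  by rewrite invrK mulrA mulVf ?mul1r// gt_eqF.
rewrite s2 !subr0; exact: key.
Qed.

(* Reflecting x to g - x exchanges the two intervals; off their intersection
   the density is larger on the interval centered at 0. *)
Lemma normal_anderson g r :
  (normal_prob 0 1 [set x : R | `|x - g| < r]%R <=
   normal_prob 0 1 [set x : R | `|x| < r]%R)%E.
Proof.
pose p := normal_pdf 0 (1 : R).
have pE x : p x = normal_peak 1 * expR (- x ^+ 2 / 2).
  by rewrite /p normal_pdfE ?oner_neq0// /normal_fun subr0 expr1n.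
have mp : measurable_fun setT p by exact: measurable_normal_pdf.
have p0 x : 0 <= p x by exact: normal_pdf_ge0.
have mI (u v : R) : measurable [set x : R | `|x - u| < v].
  have -> : [set x : R | `|x - u| < v] = `](u - v), (u + v)[%classic.
    by apply/seteqP; split => x /=; rewrite in_itv/= ltr_distl.
  exact: measurable_itv.
pose A := [set x : R | `|x - g| < r]; pose B := [set x : R | `|x| < r].
have mA : measurable A by exact: mI.
have mB : measurable B by have := mI 0 r; under eq_set do rewrite subr0.
have iE (C : set R) : measurable C ->
    normal_prob 0 1 C = (\int[mu]_x (p x * \1_C x)%:E)%E.
  move=> mC; rewrite /normal_prob integral_mkcond.
  by apply: eq_integral => x _; rewrite epatch_indic.
have mpC (q : R -> R) (C : set R) : measurable_fun setT q -> measurable C ->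
    measurable_fun setT (fun x : R => (q x * \1_C x)%:E).
  by move=> mq mC; apply/measurable_EFinP; apply: measurable_funM.
pose q x := p (g - x).
have mq : measurable_fun setT q.
  by apply: (measurableT_comp mp); apply: measurable_funB.
have q0 x : 0 <= q x by exact: p0.
have refl (C D : set R) : measurable C -> measurable D ->
    (forall x, C (g - x) <-> D x) ->
    (\int[mu]_x (q x * \1_C x)%:E = \int[mu]_x (p x * \1_D x)%:E)%E.
  move=> mC mD CD.
  have CE (z : R) : (z \in C) = (g - z \in D).
    by have := CD (g - z); rewrite subKr => -[h1 h2]; apply/idP/idP; rewrite !inE.
  rewrite -[RHS](ge0_integral_reflect g)//; last 2 first.
  - exact: mpC.
  - by move=> x; rewrite lee_fin mulr_ge0.
  apply: eq_integral => x _; congr (_ * _)%:E; by rewrite !indicE CE.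
have qA : (\int[mu]_x (q x * \1_A x)%:E = normal_prob 0 1 B)%E.
  rewrite iE//; apply: refl => // x; rewrite /A /B/=.
  by rewrite addrAC subrr add0r normrN.
have qB : (\int[mu]_x (q x * \1_B x)%:E = normal_prob 0 1 A)%E.
  by rewrite iE//; apply: refl => // x; rewrite /A /B/= distrC.
have : (normal_prob 0 1 A + normal_prob 0 1 A <= normal_prob 0 1 B + normal_prob 0 1 B)%E.
  rewrite -{2}qB -{2}qA !iE// -!ge0_integralD//.
  all: try exact: mpC.
  all: try by move=> x _; rewrite lee_fin mulr_ge0.
  apply: ge0_le_integral => //.
  - by move=> x _; rewrite -EFinD lee_fin addr_ge0// mulr_ge0.
  - by apply: emeasurable_funD; exact: mpC.
  - by apply: emeasurable_funD; exact: mpC.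
  move=> x _; rewrite -!EFinD lee_fin !indicE.
  have mon (y z : R) : `|y| <= `|z| -> p z <= p y.
    move=> yz; rewrite !pE ler_wpM2l ?normal_peak_ge0// ler_expR.
    by rewrite ler_pM2r// lerN2 -(real_normK (num_real z)) -(real_normK (num_real y)) lerXn2r// nnegrE.
  case: (boolP (x \in A)) => xA; case: (boolP (x \in B)) => xB; rewrite ?mulr1 ?mulr0 ?addr0 ?add0r//.
  - rewrite /q; apply: mon; move: xA xB; rewrite ?notin_setE ?inE /A /B/= distrC.
    by move=> /ltW h1 /negP; rewrite -leNgt; exact: le_trans.
  - rewrite /q; apply: mon; move: xA xB; rewrite ?notin_setE ?inE /A /B/= distrC.
    by move=> /negP; rewrite -leNgt => h1 /ltW h2; exact: le_trans h1.
have fin C : measurable C -> normal_prob 0 (1 : R) C \is a fin_num.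
  by move=> mC; exact: (@fin_num_measure _ _ _ (normal_prob 0 1)).
rewrite -(fineK (fin _ mA)) -(fineK (fin _ mB)) -!EFinD !lee_fin; lra.
Qed.

End gaussian.

Section sublevel.
Context d (T : measurableType d) (R : realType) (f : T -> R).
Hypothesis mf : measurable_fun setT f.

Lemma measurable_lt_set r : measurable [set x | f x < r].
Proof.
have := mf measurableT (measurable_itv `]-oo, r[); rewrite setTI.
congr (measurable _); apply/seteqP; split => x /=; by rewrite in_itv.
Qed.

Lemma measurable_le_set r : measurable [set x | f x <= r].
Proof.
have := mf measurableT (measurable_itv `]-oo, r]); rewrite setTI.
congr (measurable _); apply/seteqP; split => x /=; by rewrite in_itv.
Qed.

Lemma measurable_gt_set r : measurable [set x | r < f x].
Proof.
have := measurableC (measurable_le_set r).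
congr (measurable _); apply/seteqP; split => x /=; rewrite ltNge; by move/negP.
Qed.

Lemma measurable_ge_set r : measurable [set x | r <= f x].
Proof.
have := measurableC (measurable_lt_set r).
congr (measurable _); apply/seteqP; split => x /=; rewrite leNgt; by move/negP.
Qed.

End sublevel.

Lemma measure_integral_indic d (T : measurableType d) (R : realType)
  (mu : {measure set T -> \bar R}) (A : set T) : measurable A ->
  mu A = (\int[mu]_x (\1_A x)%:E)%E.
Proof. by move=> mA; rewrite integral_indic// setIT. Qed.

(** * Sequences of independent variables and their laws *)

Section sequence_space.
Variable R : realType.

Definition coordinate_sets : set (set (nat -> R)) :=
  [set A | exists k : nat, exists2 B : set (measurableTypeR R),
     measurable B & A = [set x | B (x k)]].

Definition seqsp : measurableType (sigma_display coordinate_sets) :=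
  g_sigma_algebraType coordinate_sets.

Lemma measurable_coord (k : nat) :
  measurable_fun [set: seqsp] (fun x : seqsp => x k : measurableTypeR R).
Proof.
move=> _ B mB; rewrite setTI; apply: sub_sigma_algebra.
by exists k, B.
Qed.

Lemma measurable_fun_seqsp d (T : measurableType d) (F : T -> seqsp) :
  (forall k, measurable_fun setT (fun t => F t k : measurableTypeR R)) ->
  measurable_fun setT F.
Proof.
move=> mF; apply: (@measurability _ _ _ seqsp setT F coordinate_sets) => //.
move=> _ [A [k [B mB ->]] <-].
by have := mF k measurableT B mB; rewrite !setTI.
Qed.

Definition rectangle (N : nat) (B : nat -> set (measurableTypeR R)) : set seqsp :=
  [set x | forall k, (k < N)%N -> B k (x k)].

Definition rectangles : set (set seqsp) :=
  [set A | exists N, exists2 B : nat -> set (measurableTypeR R),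
     (forall k, measurable (B k)) & A = rectangle N B].

Lemma measurable_rectangle N B : (forall k, measurable (B k)) ->
  measurable (rectangle N B).
Proof.
move=> mB; have -> : rectangle N B = \bigcap_(k in `I_N) [set x | B k (x k)].
  by apply/seteqP; split => x xB k /=; exact: xB.
apply: fin_bigcap_measurable => // k _.
by rewrite -[X in measurable X]setTI; exact: measurable_coord.
Qed.

Lemma rectangles_sub : rectangles `<=` measurable.
Proof. by move=> _ [N [B mB ->]]; exact: measurable_rectangle. Qed.

Lemma rectangleI N1 N2 B1 B2 : rectangle N1 B1 `&` rectangle N2 B2 =
  rectangle (maxn N1 N2) (fun k => (if (k < N1)%N then B1 k else setT) `&`
                                   (if (k < N2)%N then B2 k else setT)).
Proof.
apply/seteqP; split => [x [h1 h2] k _|x h].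
  by split; case: ifPn => // kN; [exact: h1|exact: h2].
split=> k kN; have := h k; rewrite leq_max kN ?orbT => /(_ isT)[].
  by [].
by move=> _.
Qed.

Lemma seqsp_generated : measurable = <<s rectangles >> :> set (set seqsp).
Proof.
apply/seteqP; split; last first.
  apply: smallest_sub; first exact: sigma_algebra_measurable.
  exact: rectangles_sub.
apply: smallest_sub; first exact: smallest_sigma_algebra.
move=> _ [k [B mB ->]]; apply: sub_sigma_algebra.
exists k.+1; exists (fun i => if i == k then B else setT).
  by move=> i; case: ifP.
apply/seteqP; split => [x /= xB i _|x]; first by case: eqP => // ->.
by move=> /(_ k (ltnSn _)); rewrite eqxx.
Qed.

(** Rectangles on initial segments form a pi-system that contains the whole space and generates the
    sigma-algebra. *)
Lemma seqsp_measure_unique (m1 m2 : {measure set seqsp -> \bar R}) :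
  (m1 setT < +oo)%E ->
  (forall N B, (forall k, measurable (B k)) ->
    m1 (rectangle N B) = m2 (rectangle N B)) ->
  forall A, measurable A -> m1 A = m2 A.
Proof.
move=> fm E; apply: (measure_unique rectangles (fun=> setT)) => //.
- exact: seqsp_generated.
- move=> _ _ [N1 [B1 m1' ->]] [N2 [B2 m2' ->]]; rewrite rectangleI.
  exists (maxn N1 N2); eexists; last reflexivity.
  by move=> k; apply: measurableI; case: ifP.
- by move=> _; exists 0%N, (fun=> setT) => //; apply/seteqP; split.
- by rewrite bigcup_const//; exists 0%N.
- by move=> _ [N [B mB ->]]; exact: E.
Qed.

Definition set_coord (x : nat -> R) (j : nat) (y : R) : seqsp :=
  fun k => if k == j then y else x k.

End sequence_space.

Section eq_law.
Context d1 d2 d3 (T1 : measurableType d1) (T2 : measurableType d2)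
  (T : measurableType d3) (R : realType).
Variables (m1 : {measure set T1 -> \bar R}) (m2 : {measure set T2 -> \bar R}).
Variables (f1 : T1 -> T) (f2 : T2 -> T).
Hypotheses (mf1 : measurable_fun setT f1) (mf2 : measurable_fun setT f2).

Lemma eq_law_integral (g : T -> \bar R) :
  (forall A, measurable A -> m1 (f1 @^-1` A) = m2 (f2 @^-1` A)) ->
  measurable_fun setT g -> (forall x, 0 <= g x)%E ->
  (\int[m1]_x g (f1 x) = \int[m2]_x g (f2 x))%E.
Proof.
move=> E mg g0.
have e1 := @ge0_integral_pushforward _ _ _ _ _ _ mf1 m1 setT g measurableT.
have e2 := @ge0_integral_pushforward _ _ _ _ _ _ mf2 m2 setT g measurableT.
rewrite !preimage_setT in e1 e2.
rewrite -[LHS]e1 ?measurable_funTS// -[RHS]e2 ?measurable_funTS//.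
by apply: eq_measure_integral => A mA _; exact: E.
Qed.

End eq_law.

Local Notation image_measure :=
  measure_function_pushforward__canonical__measure_function_Measure.

Section independent_sequence.
Context d (Omega : measurableType d) (R : realType) (P : probability Omega R).
Implicit Types (b : nat -> Omega -> R) (nu : nat -> probability (measurableTypeR R) R).

(** Independence on initial segments: [setT] in the idle positions recovers every finite family.
    Carrying the marginal laws along turns rectangle probabilities into products at once. *)
Definition independent_with_laws b nu : Prop :=
  (forall k, measurable_fun setT (b k : Omega -> measurableTypeR R)) /\
  forall N (B : nat -> set (measurableTypeR R)), (forall k, measurable (B k)) ->
    P [set w | forall k, (k < N)%N -> B k (b k w)] = (\prod_(k < N) nu k (B k))%E.

Definition seq_of b (w : Omega) : seqsp R := fun k => b k w.

Variables (b : nat -> Omega -> R) (nu : nat -> probability (measurableTypeR R) R).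
Hypothesis ib : independent_with_laws b nu.

Lemma measurable_seq_of : measurable_fun setT (seq_of b).
Proof. by apply: measurable_fun_seqsp => k; exact: ib.1. Qed.

Lemma measurable_set_coord j : measurable_fun setT
  (fun z : Omega * measurableTypeR R => set_coord (seq_of b z.1) j z.2).
Proof.
apply: measurable_fun_seqsp => k; rewrite /set_coord.
case: eqP => _; first exact: measurable_snd.
by apply: (measurableT_comp (ib.1 k)); exact: measurable_fst.
Qed.

Local Open Scope ereal_scope.

(** Replacing one coordinate by an independent copy keeps the law of the sequence, because both laws
    give the same product on rectangles. *)
Lemma resample_measure j (A : set (seqsp R)) : measurable A ->
  P (seq_of b @^-1` A) =
  (P \x nu j) ((fun z : Omega * measurableTypeR R => set_coord (seq_of b z.1) j z.2) @^-1` A).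
Proof.
move=> mA.
have mj := measurable_set_coord j.
apply: (@seqsp_measure_unique _ (image_measure P measurable_seq_of)
  (image_measure (P \x nu j) mj)) => //.
  by rewrite /= /pushforward preimage_setT probability_setT ltry.
move=> N B mB; rewrite /= /pushforward.
(* Adding trivial sides makes [j] one of the indices of the rectangle, so that its factor can be
   split off. *)
pose M := maxn N j.+1; pose C k := if (k < N)%N then B k else setT.
have mC k : measurable (C k) by rewrite /C; case: ifP.
have -> : rectangle N B = rectangle M C.
  apply/seteqP; split => x h k; rewrite /C.
    by move=> _; case: ifPn => // kN; exact: h.
  by move=> kN; have := h k; rewrite /C kN leq_max kN; exact.
have jM : (j < M)%N by rewrite leq_max ltnSn orbT.
rewrite [LHS](ib.2 M C mC).
pose C' k := if k == j then setT else C k.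
have mC' k : measurable (C' k) by rewrite /C'; case: ifP.
have -> : (fun z : Omega * measurableTypeR R => set_coord (seq_of b z.1) j z.2) @^-1`
    rectangle M C = [set w | forall k, (k < M)%N -> C' k (b k w)] `*` C j.
  apply/seteqP; split => -[w y] /=.
    rewrite /rectangle /set_coord /= => h; split.
      by move=> k kM; rewrite /C'; case: eqP => // /eqP kj; have := h k kM; rewrite (negbTE kj).
    by have := h j jM; rewrite eqxx.
  move=> [h1 h2] k kM; rewrite /set_coord; have := h1 k kM; rewrite /C'.
  by case: eqP => // ->.
rewrite product_measure1E//; last first.
  rewrite (_ : [set w | _] = seq_of b @^-1` (rectangle M C'))//.
  by rewrite -[X in measurable X]setTI; apply: measurable_seq_of => //; exact: measurable_rectangle.
transitivity ((\prod_(k < M) nu k (C' k)) * nu j (C j)); last first.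
  by congr (_ * _); exact/esym/(ib.2 M C' mC').
rewrite (bigD1 (Ordinal jM))//= [in RHS](bigD1 (Ordinal jM))//= /C' eqxx.
rewrite probability_setT mul1e muleC; congr (_ * _).
apply: eq_bigr => k kj; suff -> : (nat_of_ord k == j) = false by [].
by apply/eqP => e; move: kj; rewrite -val_eqE/= e eqxx.
Qed.

(** Tonelli form of independence: coordinate [j] is integrated with all the others frozen. It
    reduces the Gaussian statements below to integrals on the line. *)
Lemma resample j (Phi : seqsp R -> \bar R) :
  measurable_fun setT Phi -> (forall x, 0 <= Phi x) ->
  \int[P]_w Phi (seq_of b w) =
  \int[P]_w \int[nu j]_y Phi (set_coord (seq_of b w) j y).
Proof.
move=> mPhi Phi0; have mj := measurable_set_coord j.
rewrite (@eq_law_integral _ _ _ _ _ _ _ P (P \x nu j) _ _ measurable_seq_of mj)//; last first.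
  exact: resample_measure.
apply: (fubini_tonelli1 (fun z : Omega * measurableTypeR R =>
  Phi (set_coord (seq_of b z.1) j z.2))) => //.
exact: (measurableT_comp mPhi).
Qed.

Lemma expectation_prod (u : nat -> R -> R) (N : nat) :
  (forall k, measurable_fun setT (u k)) -> (forall k x, (0 <= u k x)%R) ->
  \int[P]_w (\prod_(k < N) u k (b k w))%:E = \prod_(k < N) \int[nu k]_x (u k x)%:E.
Proof.
move=> mu u0; elim: N => [|N IH].
  rewrite big_ord0; under eq_integral do rewrite big_ord0.
  by rewrite integral_cst//= probability_setT mule1.
have mprod M : measurable_fun setT (fun x : seqsp R => \prod_(k < M) u k (x k))%R.
  elim: M => [|M IHM]; first by under eq_fun do rewrite big_ord0; exact: measurable_cst.
  under eq_fun do rewrite big_ord_recr/=.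
  apply: measurable_funM => //; apply: (measurableT_comp (mu _)).
  exact: measurable_coord.
have prod0 M (x : nat -> R) : (0 <= \prod_(k < M) u k (x k))%R.
  by apply: prodr_ge0 => k _; exact: u0.
rewrite (@resample N (fun x => (\prod_(k < N.+1) u k (x k))%:E))//; last 2 first.
- exact/measurable_EFinP.
- by move=> x; rewrite lee_fin.
rewrite big_ord_recr/= -IH.
rewrite -ge0_integralZr//; last 3 first.
- apply/measurable_EFinP; exact: (measurableT_comp (mprod N) measurable_seq_of).
- by move=> w _; rewrite lee_fin; exact: (prod0 N (seq_of b w)).
- by apply: integral_ge0 => x _; rewrite lee_fin.
apply: eq_integral => w _.
rewrite -ge0_integralZl//; last 3 first.
- by apply/measurable_EFinP; exact: mu.
- by move=> x _; rewrite lee_fin.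
- by rewrite lee_fin; exact: (prod0 N (seq_of b w)).
apply: eq_integral => y _; rewrite big_ord_recr/= /set_coord eqxx EFinM.
congr (_%:E * _); apply: eq_bigr => k _.
by rewrite ltn_eqF.
Qed.

End independent_sequence.

(** * Gaussian sequences: shifts, exponential moments, recentering *)

Section gaussian_sequence.
Context d (Omega : measurableType d) (R : realType) (P : probability Omega R).
Variables (b : nat -> Omega -> R) (nu : nat -> probability (measurableTypeR R) R).
Hypothesis ib : independent_with_laws P b nu.
Local Open Scope ereal_scope.

Definition shift_below (N : nat) (h : nat -> R) (x : nat -> R) : seqsp R :=
  fun k => if (k < N)%N then (x k + h k)%R else x k.

Lemma measurable_shift_below N h :
  measurable_fun setT (shift_below N h : seqsp R -> seqsp R).
Proof.
apply: measurable_fun_seqsp => k; rewrite /shift_below.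
case: (k < N)%N; last exact: measurable_coord.
by apply: measurable_funD => //; exact: measurable_coord.
Qed.

Lemma measurable_set_coord_snd (x : nat -> R) j :
  measurable_fun setT (fun y : measurableTypeR R => set_coord x j y).
Proof.
apply: measurable_fun_seqsp => k; rewrite /set_coord.
by case: eqP => _; [exact: measurable_id|exact: measurable_cst].
Qed.

Lemma shift_coord j h s (Phi : seqsp R -> \bar R) :
  (forall A, measurable A -> nu j A = normal_prob 0 s A) -> s != 0%R ->
  measurable_fun setT Phi -> (forall x, 0 <= Phi x) ->
  \int[P]_w Phi (set_coord (seq_of b w) j (b j w + h)%R) =
  \int[P]_w (Phi (seq_of b w) *
    (expR (h / s ^+ 2 * b j w - h ^+ 2 / (2 * s ^+ 2)))%:E).
Proof.
move=> nuE s0 mPhi Phi0.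
have mE : measurable_fun setT
    (fun y : R => (expR (h / s ^+ 2 * y - h ^+ 2 / (2 * s ^+ 2)))%:E).
  apply/measurable_EFinP; apply: measurableT_comp => //.
  by apply: measurable_funB => //; exact: measurable_funM.
have mF : measurable_fun setT
    (fun x : seqsp R => set_coord x j (x j + h)%R : seqsp R).
  apply: measurable_fun_seqsp => k; rewrite /set_coord.
  case: eqP => _; last exact: measurable_coord.
  by apply: measurable_funD => //; exact: measurable_coord.
rewrite (resample ib j (Phi := fun x => Phi (set_coord x j (x j + h)%R)))//; last first.
  exact: (measurableT_comp mPhi).
rewrite [RHS](resample ib j (Phi := fun x => Phi x *
    (expR (h / s ^+ 2 * x j - h ^+ 2 / (2 * s ^+ 2)))%:E)); last 2 first.
- by apply: emeasurable_funM => //; apply: (measurableT_comp mE); exact: measurable_coord.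
- by move=> x; rewrite mule_ge0// lee_fin expR_ge0.
apply: eq_integral => w _.
have e (f : R -> \bar R) : \int[nu j]_y f y = \int[normal_prob 0 s]_y f y.
  by apply: eq_measure_integral => A mA _; exact: nuE.
rewrite !e.
transitivity (\int[normal_prob 0 s]_y
    (fun z => Phi (set_coord (seq_of b w) j z)) (y + h)%R).
  apply: eq_integral => y _; congr (Phi _); apply/funext => k.
  by rewrite /set_coord eqxx; case: eqP.
have mPw : measurable_fun setT (fun y : R => Phi (set_coord (seq_of b w) j y)).
  by apply: (measurableT_comp mPhi); exact: measurable_set_coord_snd.
rewrite (normal_shift h s0 mPw) => [|y]; last exact: Phi0.
by apply: eq_integral => y _; rewrite /set_coord eqxx.
Qed.

(** By induction: shift the last coordinate, then apply the hypothesis to the product of [Phi] and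
    the last tilt, a tilt that shifting the earlier coordinates leaves unchanged. *)
Lemma cameron_martin N h (s : nat -> R) (Phi : seqsp R -> \bar R) :
  (forall k, (k < N)%N -> s k != 0%R) ->
  (forall k, (k < N)%N -> forall A, measurable A -> nu k A = normal_prob 0 (s k) A) ->
  measurable_fun setT Phi -> (forall x, 0 <= Phi x) ->
  \int[P]_w Phi (shift_below N h (seq_of b w)) =
  \int[P]_w (Phi (seq_of b w) * (expR (\sum_(k < N)
     (h k / s k ^+ 2 * b k w - h k ^+ 2 / (2 * s k ^+ 2))))%:E).
Proof.
elim: N Phi => [|N IH] Phi s0 nuE mPhi Phi0.
  by apply: eq_integral => w _; rewrite big_ord0 expR0 mule1.
have mE : measurable_fun setT (fun y : R =>
    (expR (h N / s N ^+ 2 * y - h N ^+ 2 / (2 * s N ^+ 2)))%:E).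
  apply/measurable_EFinP; apply: measurableT_comp => //.
  by apply: measurable_funB => //; exact: measurable_funM.
have := @shift_coord N (h N) (s N) (fun x => Phi (shift_below N h x)) (nuE _ (ltnSn N)) (s0 _ (ltnSn N)).
move=> /(_ (measurableT_comp mPhi (measurable_shift_below N h)) (fun=> Phi0 _)) sc.
transitivity (\int[P]_w Phi (shift_below N h (set_coord (seq_of b w) N (b N w + h N)%R))).
  apply: eq_integral => w _; congr (Phi _); apply/funext => k.
  rewrite /shift_below /set_coord ltnS leq_eqVlt.
  case: eqP => [->|]/=; first by rewrite ltnn.
  by case: ifP.
rewrite sc.
have := IH (fun x => Phi x * (expR (h N / s N ^+ 2 * x N - h N ^+ 2 / (2 * s N ^+ 2)))%:E).
have h1 k : (k < N)%N -> (k < N.+1)%N by move=> /ltnW.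
move=> /(_ (fun k kN => s0 k (h1 k kN)) (fun k kN => nuE k (h1 k kN))) IH'.
transitivity (\int[P]_w (Phi (shift_below N h (seq_of b w)) *
   (expR (h N / s N ^+ 2 * shift_below N h (seq_of b w) N - h N ^+ 2 / (2 * s N ^+ 2)))%:E)).
  by apply: eq_integral => w _; rewrite /shift_below ltnn.
rewrite IH'; last 2 first.
- by apply: emeasurable_funM => //; apply: (measurableT_comp mE); exact: measurable_coord.
- by move=> x; rewrite mule_ge0// lee_fin expR_ge0.
apply: eq_integral => w _; rewrite -muleA; congr (_ * _).
by rewrite -EFinM -expRD big_ord_recr/= addrC.
Qed.

Lemma gaussian_expR_sum (s : nat -> R) (c : nat -> R) N :
  (forall k, (k < N)%N -> s k != 0%R) ->
  (forall k, (k < N)%N -> forall A, measurable A -> nu k A = normal_prob 0 (s k) A) ->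
  \int[P]_w (expR (\sum_(k < N) c k * b k w))%:E =
  (expR (\sum_(k < N) c k ^+ 2 * s k ^+ 2 / 2))%:E.
Proof.
move=> s0 nuE.
under eq_integral do rewrite expR_sum.
rewrite (expectation_prod ib (u := fun k x => expR (c k * x))); last 2 first.
- by move=> k; apply: measurableT_comp => //; exact: measurable_funM.
- by move=> k x; exact: expR_ge0.
rewrite expR_sum -prodEFin; apply: eq_bigr => k _.
rewrite -(normal_expR (c k) (s0 k (ltn_ord k))).
by apply: eq_measure_integral => A mA _; exact: nuE.
Qed.

Hypothesis nuE : forall k A, measurable A -> nu k A = normal_prob 0 1 A.

Lemma gaussian_expR_sqr (c : nat -> R) N : (forall k, (k < N)%N -> (-1 < c k)%R) ->
  \int[P]_w (expR (- (\sum_(k < N) c k / 2 * b k w ^+ 2)))%:E =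
  (\prod_(k < N) (Num.sqrt (1 + c k))^-1)%:E.
Proof.
move=> c1.
under eq_integral do rewrite -sumrN expR_sum.
rewrite (expectation_prod ib (u := fun k x => expR (- (c k / 2 * x ^+ 2)))); last 2 first.
- move=> k; apply: measurableT_comp => //; apply: measurableT_comp => //.
  by apply: measurable_funM => //; exact: measurable_funX.
- by move=> k x; exact: expR_ge0.
rewrite -prodEFin; apply: eq_bigr => k _.
rewrite -(normal_expR_sqr (c1 k (ltn_ord k))).
by apply: eq_measure_integral => A mA _; exact: nuE.
Qed.

(** With the other coordinates frozen, the event confines coordinate [j] to an interval centered at
    g / c whose length does not depend on [g]; [normal_anderson] moves the center to 0. *)
Lemma anderson_coord j c g r (F : seqsp R -> R) : (0 < c)%R ->
  measurable_fun setT F -> (forall x y, F (set_coord x j y) = F x) ->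
  P [set w | ((c * b j w - g) ^+ 2 + F (seq_of b w) < r)%R] <=
  P [set w | ((c * b j w) ^+ 2 + F (seq_of b w) < r)%R].
Proof.
move=> c0 mF Fj.
pose A u := [set x : seqsp R | ((c * x j - u) ^+ 2 + F x < r)%R].
have mf u : measurable_fun setT (fun x : seqsp R => (c * x j - u) ^+ 2 + F x)%R.
  apply: measurable_funD => //; apply: measurable_funX; apply: measurable_funB => //.
  by apply: measurable_funM => //; exact: measurable_coord.
have mA u : measurable (A u) by exact: measurable_lt_set.
have PA u : P [set w | ((c * b j w - u) ^+ 2 + F (seq_of b w) < r)%R] =
    \int[P]_w nu j [set y | ((c * y - u) ^+ 2 < r - F (seq_of b w))%R].
  transitivity (\int[P]_w (\1_(A u) (seq_of b w))%:E).
    rewrite measure_integral_indic; last first.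
      rewrite -[X in measurable X]setTI.
      exact: (measurable_seq_of ib measurableT (mA u)).
    by apply: eq_integral => w _; rewrite !indicE.
  rewrite (resample ib j (Phi := fun x => (\1_(A u) x)%:E))//; last first.
    by apply/measurable_EFinP; exact: measurable_indic.
  apply: eq_integral => w _.
  rewrite (_ : [set y | _] = (fun y : R => set_coord (seq_of b w) j y) @^-1` A u); last first.
    by apply/seteqP; split => y; rewrite /A/= Fj /set_coord eqxx ltrBrDr.
  rewrite measure_integral_indic; last first.
    rewrite (_ : _ @^-1` _ = [set y : R | (c * y - u) ^+ 2 < r - F (seq_of b w)]%R); last first.
      by apply/seteqP; split => y; rewrite /A/= Fj /set_coord eqxx ltrBrDr.
    by apply: measurable_lt_set; apply: measurable_funX; apply: measurable_funB => //; exact: measurable_funM.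
  by apply: eq_integral => y _; rewrite !indicE.
have -> : P [set w | ((c * b j w) ^+ 2 + F (seq_of b w) < r)%R] =
    P [set w | ((c * b j w - 0) ^+ 2 + F (seq_of b w) < r)%R].
  by congr (P _); apply/seteqP; split => w /=; rewrite subr0.
have msec u : measurable_fun setT
    (fun w => nu j [set y : R | ((c * y - u) ^+ 2 < r - F (seq_of b w))%R]).
  pose B := [set z : Omega * measurableTypeR R |
    ((c * z.2 - u) ^+ 2 + F (seq_of b z.1) < r)%R].
  have mB : measurable B.
    apply: measurable_lt_set; apply: measurable_funD.
      apply: measurable_funX; apply: measurable_funB => //.
      by apply: measurable_funM => //; exact: measurable_snd.
    apply: (measurableT_comp mF); apply: (measurableT_comp (measurable_seq_of ib)).
    exact: measurable_fst.
  have := measurable_fun_xsection (nu j) mB.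
  apply: eq_measurable_fun => w _ /=; congr (nu j _); apply/seteqP; split => y /=;
    by rewrite /xsection/= inE /B/= ltrBrDr.
rewrite !PA; apply: ge0_le_integral => //.
move=> w _; set t := (r - _)%R.
have [t0|t0] := leP t 0%R.
  rewrite (_ : [set y | _] = set0) ?measure0//; apply/seteqP; split => y //=.
  by rewrite ltNge => /negP; apply; rewrite (le_trans t0)// sqr_ge0.
have setE u : [set y : R | ((c * y - u) ^+ 2 < t)%R] =
    [set y | (`|y - u / c| < Num.sqrt t / c)%R].
  apply: eq_set => y; rewrite ltr_pdivlMr//.
  rewrite -[X in _ = is_true (_ * X < _)%R](gtr0_norm c0) -normrM.
  have -> : ((y - u / c) * c = c * y - u)%R by field; rewrite gt_eqF.
  by rewrite -sqrtr_sqr ltr_sqrt.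
have mI u : measurable [set y : R | (`|y - u / c| < Num.sqrt t / c)%R].
  by rewrite -setE; apply: measurable_lt_set; apply: measurable_funX;
     apply: measurable_funB => //; exact: measurable_funM.
rewrite !setE (nuE _ (mI g)) (nuE _ (mI 0%R)).
have := normal_anderson (g / c) (Num.sqrt t / c).
by congr (_ <= normal_prob 0 1 _); apply/seteqP; split => y /=; rewrite mul0r subr0.
Qed.

End gaussian_sequence.

(** * Inner product and norm of L^2[0, 1] *)

Section inner_product.
Variable R : realType.
Local Notation mu := (@lebesgue_measure R).
Local Notation nu := (leb01 R).
Implicit Types f g h : R -> R.

Definition square_integrable f : Prop := f \in Lfun nu 2%:E.

Definition inner f g : R := \int[nu]_x (f x * g x).

Lemma sqi_measurable f : square_integrable f -> measurable_fun setT f.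
Proof. by rewrite /square_integrable inE => /andP[]; rewrite inE. Qed.

Lemma L2_sqi (f : L2 R) : square_integrable f.
Proof.
rewrite /square_integrable inE; apply/andP; split; rewrite inE/=.
  exact: (@measurable_funPT _ _ _ _ (repr (LebesgueSpace.sort f))).
exact: Lebesgue_finite.
Qed.

Lemma leb01E (A : set R) : measurable A -> nu A = mu (A `&` `[0, 1]).
Proof. by []. Qed.

Lemma leb01_setT : nu setT = 1%E.
Proof.
by rewrite leb01E// setTI lebesgue_measure_itv/= lte_fin ltr01 oppr0 adde0.
Qed.

Lemma sqi0 : square_integrable (fun=> 0).
Proof. exact: (Lfun_submod_closed nu (lee1n 2)).1. Qed.

Lemma sqi_linear a f g : square_integrable f -> square_integrable g ->
  square_integrable (fun x => a * f x + g x).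
Proof. exact: (Lfun_submod_closed nu (lee1n 2)).2. Qed.

Lemma sqiD f g : square_integrable f -> square_integrable g ->
  square_integrable (f \+ g).
Proof.
move=> hf hg; have := sqi_linear 1 hf hg.
by under eq_fun do rewrite mul1r.
Qed.

Lemma sqiZ a f : square_integrable f -> square_integrable (fun x => a * f x).
Proof.
move=> hf; have := sqi_linear a hf sqi0.
by under eq_fun do rewrite addr0.
Qed.

Lemma sqiB f g : square_integrable f -> square_integrable g ->
  square_integrable (f \- g).
Proof.
move=> hf hg; have := sqi_linear (-1) hg hf.
by under eq_fun do rewrite mulN1r addrC.
Qed.

Lemma sqi_sum (I : Type) (r : seq I) (F : I -> R -> R) :
  (forall i, square_integrable (F i)) ->
  square_integrable (fun x => \sum_(i <- r) F i x).
Proof.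
move=> hF; elim: r => [|i r IH].
  by under eq_fun do rewrite big_nil; exact: sqi0.
under eq_fun do rewrite big_cons; exact: sqiD.
Qed.

Lemma sqi_bounded f (K : R) : measurable_fun setT f -> (forall x, `|f x| <= K) ->
  square_integrable f.
Proof.
move=> mf fK; rewrite /square_integrable inE; apply/andP; split; rewrite inE//=.
rewrite /finite_norm unlock; apply: poweR_lty.
apply: (@le_lt_trans _ _ (\int[nu]_x (cst (K ^+ 2)%:E x))%E); last first.
  by rewrite integral_cst// leb01_setT mule1 ltry.
apply: ge0_le_integral => //.
- by move=> x _; exact: poweR_ge0.
- by apply/measurable_EFinP; apply: (measurableT_comp (measurable_powR _)) => //;
    exact: measurableT_comp.
- move=> x _; rewrite /= lee_fin powR_mulrn// lerXn2r// nnegrE//.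
  exact: le_trans (fK x).
Qed.

Lemma sqi_mul_integrable f g : square_integrable f -> square_integrable g ->
  nu.-integrable setT (EFin \o (fun x => f x * g x)).
Proof. by move=> hf hg; apply/Lfun1_integrable; exact: Lfun2_mul_Lfun1. Qed.

Lemma innerC f g : inner f g = inner g f.
Proof. by apply: eq_Rintegral => x _; rewrite mulrC. Qed.

Lemma innerDl f g h : square_integrable f -> square_integrable g ->
  square_integrable h -> inner (f \+ g) h = inner f h + inner g h.
Proof.
move=> hf hg hh; rewrite -RintegralD//; [|exact: sqi_mul_integrable..].
by apply: eq_Rintegral => x _; rewrite /= mulrDl.
Qed.

Lemma innerZl a f h : square_integrable f -> square_integrable h ->
  inner (fun x => a * f x) h = a * inner f h.
Proof.
move=> hf hh; rewrite -RintegralZl//; last exact: sqi_mul_integrable.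
by apply: eq_Rintegral => x _; rewrite /= mulrA.
Qed.

Lemma innerBl f g h : square_integrable f -> square_integrable g ->
  square_integrable h -> inner (f \- g) h = inner f h - inner g h.
Proof.
move=> hf hg hh; rewrite -RintegralB//; [|exact: sqi_mul_integrable..].
by apply: eq_Rintegral => x _; rewrite /= mulrBl.
Qed.

Lemma inner_suml (I : Type) (r : seq I) (F : I -> R -> R) h :
  (forall i, square_integrable (F i)) -> square_integrable h ->
  inner (fun x => \sum_(i <- r) F i x) h = \sum_(i <- r) inner (F i) h.
Proof.
move=> hF hh; elim: r => [|i r IH].
  rewrite big_nil -[RHS](mul0r (inner h h)) -innerZl//.
  by apply: eq_Rintegral => x _; rewrite big_nil !mul0r.
rewrite big_cons -IH -innerDl//; last exact: sqi_sum.
by apply: eq_Rintegral => x _; rewrite big_cons.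
Qed.

Lemma inner_ge0 f : 0 <= inner f f.
Proof. by apply: Rintegral_ge0 => x _; rewrite -expr2 sqr_ge0. Qed.

Lemma l2norm_ge0 f : 0 <= l2norm f.
Proof. by rewrite /l2norm fine_ge0// Lnorm_ge0. Qed.

Lemma l2norm_sqr f : square_integrable f -> l2norm f ^+ 2 = inner f f.
Proof.
move=> hf; have ff : ('N[nu]_2%:E[EFin \o f] < +oo)%E.
  by move: hf; rewrite /square_integrable inE => /andP[_]; rewrite inE.
apply: EFin_inj; rewrite /inner /Rintegral fineK; last first.
  by apply: integrable_fin_num => //; exact: sqi_mul_integrable.
have n20 : (2 : R) != 0 by rewrite pnatr_eq0.
have f2 := poweR_Lnorm nu (EFin \o f) n20.
rewrite /l2norm.
have fn : 'N[nu]_2%:E[EFin \o f]%E \is a fin_num by rewrite ge0_fin_numE// Lnorm_ge0.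
move: f2; rewrite -{1}(fineK fn) /= powR_mulrn ?fine_ge0 ?Lnorm_ge0// => ->.
by apply: eq_integral => x _; rewrite /= powR_mulrn// real_normK ?num_real// expr2.
Qed.

Lemma inner_cauchy_schwarz f g : square_integrable f -> square_integrable g ->
  inner f g ^+ 2 <= inner f f * inner g g.
Proof.
move=> hf hg.
have key t : 0 <= inner f f - 2 * t * inner f g + t ^+ 2 * inner g g.
  have := inner_ge0 (f \- (fun x => t * g x)).
  have htg := sqiZ t hg; have hfg := sqiB hf htg.
  rewrite innerBl// (innerC f) innerBl// (innerC _ (f \- _)) innerBl//.
  rewrite !(innerC _ (fun x => t * g x)) !innerZl// (innerC g (fun x => t * g x)) innerZl//.
  by rewrite (innerC g f); lra.
have [C0|C0] := eqVneq (inner g g) 0.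
  have B0 : inner f g = 0.
    apply/eqP; apply: contraT => B0.
    (* The polynomial in t is affine because <g, g> = 0, and at this argument it takes the value
       -1. *)
    have := key ((inner f f + 1) / (2 * inner f g)).
    rewrite C0 mulr0 addr0.
    have -> : 2 * ((inner f f + 1) / (2 * inner f g)) * inner f g = inner f f + 1 by field.
    lra.
  by rewrite B0 C0 mulr0 expr0n.
have Cp : 0 < inner g g by rewrite lt_neqAle eq_sym C0 inner_ge0.
have := key (inner f g / inner g g).
have -> : inner f f - 2 * (inner f g / inner g g) * inner f g +
   (inner f g / inner g g) ^+ 2 * inner g g =
   (inner f f * inner g g - inner f g ^+ 2) / inner g g by field.
by rewrite pmulr_lge0 ?invr_gt0// subr_ge0.
Qed.

Lemma inner_le_norm f g : square_integrable f -> square_integrable g ->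
  `|inner f g| <= l2norm f * l2norm g.
Proof.
move=> hf hg; rewrite -ler_sqr ?nnegrE ?mulr_ge0 ?l2norm_ge0//.
by rewrite exprMn !l2norm_sqr// real_normK ?num_real// inner_cauchy_schwarz.
Qed.

Lemma l2norm_triangle f g : square_integrable f -> square_integrable g ->
  l2norm (f \+ g) <= l2norm f + l2norm g.
Proof.
move=> hf hg; rewrite -ler_sqr ?nnegrE ?addr_ge0 ?l2norm_ge0//.
have hfg := sqiD hf hg.
rewrite l2norm_sqr// innerDl// !(innerC _ (f \+ g)) !innerDl// (innerC g f).
rewrite sqrrD !l2norm_sqr//.
have := le_trans (ler_norm _) (inner_le_norm hf hg); lra.
Qed.

Lemma l2normN f : l2norm (\- f) = l2norm f.
Proof.
rewrite /l2norm; have -> : EFin \o (\- f) = (\- (EFin \o f))%E by [].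
by rewrite oppe_Lnorm.
Qed.

Lemma l2norm_distC f g : l2norm (f \- g) = l2norm (g \- f).
Proof.
by rewrite -l2normN; congr l2norm; apply/funext => x /=; rewrite opprB.
Qed.

Lemma l2norm_distD f g h : square_integrable f -> square_integrable g ->
  square_integrable h -> l2norm (f \- h) <= l2norm (f \- g) + l2norm (g \- h).
Proof.
move=> hf hg hh; apply: le_trans (l2norm_triangle (sqiB hf hg) (sqiB hg hh)).
by rewrite le_eqVlt; apply/orP; left; apply/eqP; congr l2norm; apply/funext => x /=; rewrite addrA subrK.
Qed.

Lemma Lnorm2_ae f g : f = g %[ae nu] -> measurable_fun setT f ->
  measurable_fun setT g -> ('N[nu]_2%:E[EFin \o f] = 'N[nu]_2%:E[EFin \o g])%E.
Proof.
move=> fg mf mg.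
suff e : (\int[nu]_x (`|(EFin \o f) x| `^ 2) = \int[nu]_x (`|(EFin \o g) x| `^ 2))%E.
  by rewrite unlock e.
apply: ae_eq_integral => //.
- by apply/measurable_EFinP; apply: (measurableT_comp (measurable_powR _)) => //;
    exact: measurableT_comp.
- by apply/measurable_EFinP; apply: (measurableT_comp (measurable_powR _)) => //;
    exact: measurableT_comp.
- by apply: (@filterS _ _ (ae_filter_ringOfSetsType nu) _ _ _ fg) => x /= h _; rewrite h.
Qed.

Lemma l2norm_ae f g : f = g %[ae nu] -> measurable_fun setT f ->
  measurable_fun setT g -> l2norm f = l2norm g.
Proof. by move=> fg mf mg; rewrite /l2norm (Lnorm2_ae fg). Qed.

(** The representative of a class agrees with the given function only almost everywhere. Signals
    built from finite or infinite sums become elements of [L2] through this lemma. *)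
Lemma L2_class f : square_integrable f -> exists F : L2 R, L2_fun F = f %[ae nu].
Proof.
move=> hf; have mf := sqi_measurable hf.
have /andP[_] : (f \in mfun) && (f \in finLfun nu 2%:E).
  by move: hf; rewrite /square_integrable inE.
rewrite inE /= => fn.
pose m : {mfun measurableTypeR R >-> measurableTypeR R} :=
  HB.pack (f : measurableTypeR R -> measurableTypeR R)
    (isMeasurableFun.Build _ _ (measurableTypeR R) (measurableTypeR R) f mf).
pose c : {mfun_ nu, measurableTypeR R >-> measurableTypeR R} :=
  (\pi_({mfun_ nu, measurableTypeR R >-> measurableTypeR R}) m)%qT.
have cm : (repr c : R -> R) = f %[ae nu].
  have /eqmodP/asboolP : repr c = m %[mod {mfun_ nu,
      measurableTypeR R >-> measurableTypeR R}]%qT by rewrite reprK.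
  exact.
have mc : measurable_fun setT (repr c : R -> R) by exact: (@measurable_funPT _ _ _ _ (repr c)).
have fc : finite_norm nu 2%:E c.
  by rewrite /finite_norm (Lnorm2_ae cm mc mf).
pose F : L2 R := HB.pack_for (LspaceType nu (lee1n 2)) c
  (isFinLebesgue.Build _ _ _ nu 2%:E (lee1n 2) c fc).
by exists F.
Qed.

End inner_product.

(** * The trigonometric basis *)

Section trig_basis.
Variable R : realType.
Local Notation mu := (@lebesgue_measure R).
Local Notation nu := (leb01 R).
Implicit Types (f g F : R -> R) (D : set R).

Lemma integral_leb01 (F : R -> \bar R) D : measurable D -> measurable_fun setT F ->
  (\int[nu]_(x in D) F x = \int[mu]_(x in D `&` `[0%R, 1%R]) F x)%E.
Proof.
move=> mD mF.
have ge0 (G : R -> \bar R) : measurable_fun setT G -> (forall x, 0 <= G x)%E ->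
    (\int[nu]_x G x = \int[mu]_(x in `[0%R, 1%R]) G x)%E.
  move=> mG G0.
  rewrite (@ge0_integral_density _ _ _ mu nu (\1_(`[0%R, 1%R]%classic)))//; last first.
    move=> A mA; rewrite integral_indic//= setIC; exact: leb01E.
  rewrite [RHS]integral_mkcond; apply: eq_integral => x _.
  by rewrite epatch_indic.
have mI : measurable (`[0%R, 1%R]%classic : set R) by exact: measurable_itv.
rewrite setIC [RHS]integral_mkcondr [LHS]integral_mkcond.
have mFD : measurable_fun setT (F \_ D) by apply/(measurable_restrictT _ mD); exact: measurable_funTS.
rewrite [LHS]integralE [RHS]integralE !ge0//.
- exact: measurable_funeneg.
- exact: measurable_funepos.
Qed.

Lemma ftc_everywhere f F (a b : R) : a < b -> continuous f ->
  (forall x : R, is_derive x 1 F (f x)) ->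
  \int[mu]_(x in `[a, b]) f x = F b - F a.
Proof.
move=> ab cf dF.
have cF : continuous F.
  move=> x; apply: differentiable_continuous; apply/derivable1_diffP.
  exact: ex_derive.
rewrite /Rintegral (continuous_FTC2 (F := F))//.
- exact: continuous_subspaceT.
- split.
  + by move=> x _; exact: ex_derive.
  + by apply: cvg_at_right_filter; exact: cF.
  + by apply: cvg_at_left_filter; exact: cF.
- by move=> x _; rewrite derive1E; exact: derive_val.
Qed.

(** Antiderivatives of waves of such a nonzero frequency agree at 0 and 1, so the waves integrate to
    0 over [0, 1]. The condition is stable under sum and difference, as the product-to-sum formulas
    require. *)
Definition period_frequency (w : R) := sin w = 0 /\ cos w = 1.

Lemma period_frequency_nat (m : nat) : period_frequency (2 * pi * m%:R).
Proof.
elim: m => [|m [s c]]; first by rewrite /period_frequency mulr0 sin0 cos0.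
rewrite /period_frequency -[m.+1%:R]natr1 mulrDr mulr1 sinD cosD s c.
have -> : 2 * pi = pi *+ 2 :> R by rewrite mulr_natl.
by rewrite sin2pi cos2pi !mul0r !mul1r addr0 subr0.
Qed.

Lemma period_frequencyD w v : period_frequency w -> period_frequency v ->
  period_frequency (w + v).
Proof.
by move=> [s c] [s' c']; rewrite /period_frequency sinD cosD s c s' c' !mul0r !mul1r addr0 subr0.
Qed.

Lemma period_frequencyB w v : period_frequency w -> period_frequency v ->
  period_frequency (w - v).
Proof.
by move=> [s c] [s' c']; rewrite /period_frequency sinB cosB s c s' c' !mul0r !mul1r addr0 subr0.
Qed.

Lemma Rintegral_cos w : period_frequency w ->
  \int[mu]_(x in `[0, 1]) cos (w * x) = (w == 0)%:R.
Proof.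
move=> [s c]; have [->|w0] := eqVneq w 0.
  under eq_Rintegral do rewrite mul0r cos0.
  by rewrite Rintegral_cst//= lebesgue_measure_itv/= lte_fin ltr01 oppr0 adde0 mulr1.
have cf : continuous (fun x => cos (w * x)).
  move=> x; apply: (continuous_comp (g := @cos R)); last exact: continuous_cos.
  exact: mulrl_continuous.
have dF (x : R) : is_derive x 1 (fun x => w^-1 * sin (w * x)) (cos (w * x)).
  apply: is_derive_eq.
  rewrite -[_ *: _]/(_ * _) -[_ *: 1]/(_ * _) mulr1.
  by rewrite mulrCA mulVf// mulr1.
by rewrite (ftc_everywhere ltr01 cf dF) mulr1 s !mulr0 sin0 mulr0 subrr.
Qed.

Lemma Rintegral_sin w : period_frequency w ->
  \int[mu]_(x in `[0, 1]) sin (w * x) = 0.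
Proof.
move=> [s c]; have [->|w0] := eqVneq w 0.
  under eq_Rintegral do rewrite mul0r sin0.
  by rewrite Rintegral_cst// mul0r.
have cf : continuous (fun x => sin (w * x)).
  move=> x; apply: (continuous_comp (g := @sin R)); last exact: continuous_sin.
  exact: mulrl_continuous.
have dF (x : R) : is_derive x 1 (fun x => - (w^-1 * cos (w * x))) (sin (w * x)).
  apply: is_derive_eq.
  rewrite -[_ *: _]/(_ * _) -[_ *: 1]/(_ * _) mulr1.
  by rewrite mulNr mulrN opprK mulrCA mulVf// mulr1.
by rewrite (ftc_everywhere ltr01 cf dF) mulr1 c mulr0 cos0 subrr.
Qed.

Lemma measurable_trig k : measurable_fun setT (@trig R k).
Proof.
rewrite /trig; case: eqP => _; first exact: measurable_cst.
have ml : measurable_fun setT (fun t : R => 2 * pi * k./2%:R * t) by exact: measurable_funM.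
case: (odd k); apply: measurable_funM => //.
  by apply: (measurableT_comp _ ml); apply: continuous_measurable_fun; exact: continuous_sin.
by apply: (measurableT_comp _ ml); apply: continuous_measurable_fun; exact: continuous_cos.
Qed.

Lemma trig_bounded k (t : R) : `|trig k t| <= Num.sqrt 2.
Proof.
have s1 : 1 <= Num.sqrt 2 :> R by rewrite -[leLHS]sqrtr1 ler_wsqrtr// ler1n.
rewrite /trig; case: eqP => _; first by rewrite normr1.
by case: (odd k); rewrite normrM ger0_norm ?sqrtr_ge0// ler_piMr ?sqrtr_ge0 ?sin_max ?cos_max.
Qed.

Lemma sqi_trig k : square_integrable (@trig R k).
Proof. exact: sqi_bounded (measurable_trig k) (trig_bounded k). Qed.

(** Mean value theorem. The constant grows with the frequency, which is why the sampling step of the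
    tests depends on the cutoff. *)
Lemma trig_lipschitz k (s t : R) :
  `|trig k s - trig k t| <= Num.sqrt 2 * (2 * pi * k./2%:R) * `|s - t|.
Proof.
have lip (f df : R -> R) : (forall x : R, is_derive x 1 f (df x)) -> (forall x, `|df x| <= 1) ->
    forall a b : R, `|f a - f b| <= `|a - b|.
  move=> fd df1.
  have W (a b : R) : a <= b -> `|f b - f a| <= `|b - a|.
    move=> ab; have [|c _ ->] := @MVT_segment R f df a b ab (fun x _ => fd x).
      apply: continuous_subspaceT => x; apply: differentiable_continuous.
      by apply/derivable1_diffP; exact: ex_derive.
    by rewrite normrM ler_piMl.
  by move=> a b; have [/W|/ltW/W] := leP a b; rewrite // distrC (distrC b).
have w0 : 0 <= 2 * pi * k./2%:R :> R by rewrite !mulr_ge0 ?pi_ge0.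
have s20 : 0 <= Num.sqrt 2 :> R by exact: sqrtr_ge0.
rewrite /trig; case: eqP => _; first by rewrite subrr normr0 mulr_ge0// mulr_ge0.
have e : 2 * pi * k./2%:R * `|s - t| = `|2 * pi * k./2%:R * s - 2 * pi * k./2%:R * t|.
  by rewrite -mulrBr normrM ger0_norm.
rewrite -[X in _ <= X]mulrA e; case: (odd k); rewrite -mulrBr normrM ger0_norm// ler_wpM2l//.
  by apply: (lip _ cos) => x; exact: cos_max.
by apply: (lip _ (fun x => - sin x)) => x; rewrite normrN sin_max.
Qed.

Lemma Rintegral_leb01 f D : measurable D -> measurable_fun setT f ->
  \int[nu]_(x in D) f x = \int[mu]_(x in D `&` `[0, 1]) f x.
Proof.
move=> mD mf; rewrite /Rintegral integral_leb01//; exact/measurable_EFinP.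
Qed.

Lemma Rintegral_leb01T f : measurable_fun setT f ->
  \int[nu]_x f x = \int[mu]_(x in `[0, 1]) f x.
Proof. by move=> mf; rewrite Rintegral_leb01// setTI. Qed.

Lemma integrable_cos_sin w : mu.-integrable `[0, 1] (EFin \o (fun x => cos (w * x))) /\
  mu.-integrable `[0, 1] (EFin \o (fun x => sin (w * x))).
Proof.
split; apply: continuous_compact_integrable; try exact: segment_compact.
  apply: continuous_subspaceT => x; apply: (continuous_comp (g := @cos R)).
    exact: mulrl_continuous.
  exact: continuous_cos.
apply: continuous_subspaceT => x; apply: (continuous_comp (g := @sin R)).
  exact: mulrl_continuous.
exact: continuous_sin.
Qed.

Lemma Rintegral_cos_cos w v : period_frequency w -> period_frequency v ->
  \int[mu]_(x in `[0, 1]) (cos (w * x) * cos (v * x)) =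
  2^-1 * ((w - v == 0)%:R + (w + v == 0)%:R).
Proof.
move=> pw pv.
rewrite -(Rintegral_cos (period_frequencyB pw pv)) -(Rintegral_cos (period_frequencyD pw pv)).
rewrite -RintegralD//; [|exact: (integrable_cos_sin _).1..].
rewrite -RintegralZl//; last first.
  rewrite (_ : _ \o _ = (fun x => (cos ((w - v) * x))%:E + (cos ((w + v) * x))%:E)%E); last by apply/funext.
  by apply: integrableD => //; exact: (integrable_cos_sin _).1.
apply: eq_Rintegral => x _; rewrite mulrBl mulrDl cosB cosD; lra.
Qed.

Lemma Rintegral_sin_sin w v : period_frequency w -> period_frequency v ->
  \int[mu]_(x in `[0, 1]) (sin (w * x) * sin (v * x)) =
  2^-1 * ((w - v == 0)%:R - (w + v == 0)%:R).
Proof.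
move=> pw pv.
rewrite -(Rintegral_cos (period_frequencyB pw pv)) -(Rintegral_cos (period_frequencyD pw pv)).
rewrite -RintegralB//; [|exact: (integrable_cos_sin _).1..].
rewrite -RintegralZl//; last first.
  rewrite (_ : _ \o _ = (fun x => (cos ((w - v) * x))%:E - (cos ((w + v) * x))%:E)%E); last by apply/funext.
  by apply: integrableB => //; exact: (integrable_cos_sin _).1.
apply: eq_Rintegral => x _; rewrite mulrBl mulrDl cosB cosD; lra.
Qed.

Lemma Rintegral_sin_cos w v : period_frequency w -> period_frequency v ->
  \int[mu]_(x in `[0, 1]) (sin (w * x) * cos (v * x)) = 0.
Proof.
move=> pw pv.
transitivity (2^-1 * (\int[mu]_(x in `[0, 1]) sin ((w - v) * x) +
                      \int[mu]_(x in `[0, 1]) sin ((w + v) * x))); last first.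
  by rewrite !Rintegral_sin ?addr0 ?mulr0//; [exact: period_frequencyD|exact: period_frequencyB].
rewrite -RintegralD//; [|exact: (integrable_cos_sin _).2..].
rewrite -RintegralZl//; last first.
  rewrite (_ : _ \o _ = (fun x => (sin ((w - v) * x))%:E + (sin ((w + v) * x))%:E)%E); last by apply/funext.
  by apply: integrableD => //; exact: (integrable_cos_sin _).2.
apply: eq_Rintegral => x _; rewrite mulrBl mulrDl sinB sinD; lra.
Qed.

Lemma trig_orthonormal j k : (0 < j)%N -> (0 < k)%N ->
  inner (@trig R j) (trig k) = (j == k)%:R.
Proof.
pose W (i : nat) : R := 2 * pi * i%:R.
have pW i : period_frequency (W i) by exact: period_frequency_nat.
have p2 : 0 < 2 * pi :> R by rewrite mulr_gt0// pi_gt0.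
have WB i i' : (W i - W i' == 0) = (i == i').
  by rewrite -mulrBr mulf_eq0 gt_eqF//= subr_eq0 eqr_nat.
have WD i i' : (0 < i)%N -> (W i + W i' == 0) = false.
  by move=> i0; rewrite -mulrDr -natrD mulf_eq0 gt_eqF//= pnatr_eq0 addn_eq0 gtn_eqF.
have s2 : Num.sqrt 2 * Num.sqrt 2 = 2 :> R by rewrite -expr2 sqr_sqrtr.
have iE i i' : inner (@trig R i) (trig i') = \int[mu]_(x in `[0, 1]) (trig i x * trig i' x).
  by apply: Rintegral_leb01T; apply: measurable_funM; exact: measurable_trig.
have intP (f g : R -> R) : continuous f -> continuous g ->
    mu.-integrable `[0, 1] (EFin \o (fun x => f x * g x)).
  move=> cf cg; apply: continuous_compact_integrable; first exact: segment_compact.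
  by apply: continuous_subspaceT => x; apply: cvgM; [exact: cf|exact: cg].
have cc i : continuous (fun x => cos (W i * x)).
  by move=> x; apply: (continuous_comp (g := @cos R)); [exact: mulrl_continuous|exact: continuous_cos].
have cs i : continuous (fun x => sin (W i * x)).
  by move=> x; apply: (continuous_comp (g := @sin R)); [exact: mulrl_continuous|exact: continuous_sin].
have key i i' (c : R) (f g : R -> R) : continuous f -> continuous g ->
    (forall x, trig i x * trig i' x = c * (f x * g x)) ->
    inner (@trig R i) (trig i') = c * \int[mu]_(x in `[0, 1]) (f x * g x).
  move=> cf cg e; rewrite iE -RintegralZl//; last exact: intP.
  by apply: eq_Rintegral => x _; exact: e.
(* The constant function counts as the cosine of frequency 0 with amplitude 1; four cases remain,
   cosine or sine for each index. *)
pose a (i : nat) : R := if i == 1%N then 1 else Num.sqrt 2.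
have tc i x : (i == 1%N) || ~~ odd i -> trig i x = a i * cos (W i./2 * x).
  rewrite /trig /a; case: eqP => [->|_] /=; first by rewrite /W mulr0 mul0r cos0 mulr1.
  by move/negbTE => ->.
have ts i x : ~~ ((i == 1%N) || ~~ odd i) -> trig i x = Num.sqrt 2 * sin (W i./2 * x).
  by rewrite negb_or negbK /trig => /andP[/negbTE -> ->].
have half i i' : odd i = odd i' -> (i./2 == i'./2) = (i == i').
  by move=> o; apply/eqP/eqP => [h|->//]; rewrite -(odd_double_half i) -(odd_double_half i') o h.
have even2 i : (0 < i)%N -> ~~ odd i -> (0 < i./2)%N.
  by case: i => [|[|i]].
have odd3 i : i != 1%N -> odd i -> (0 < i./2)%N.
  by case: i => [|[|[|i]]].
move=> j0 k0.
case: (boolP ((j == 1%N) || ~~ odd j)) => Hj; case: (boolP ((k == 1%N) || ~~ odd k)) => Hk.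
- rewrite (key j k (a j * a k) _ _ (cc j./2) (cc k./2)) => [|x]; last by rewrite (tc _ _ Hj) (tc _ _ Hk); ring.
  rewrite Rintegral_cos_cos// WB.
  case: (eqVneq j 1%N) Hj => [->|j1]/= oj; case: (eqVneq k 1%N) Hk => [->|k1]/= ok.
  + have -> : W 0%N + W 0%N = 0 by rewrite /W mulr0 addr0.
    have -> : a 1%N = 1 by [].
    by rewrite eqxx !mul1r -[true%:R]/(1 : R); lra.
  + rewrite (addrC (W _)) WD ?even2// addr0.
    have /negbTE -> : 0%N != k./2 by rewrite eq_sym -lt0n even2.
    by rewrite !mulr0.
  + rewrite WD ?even2// addr0.
    have /negbTE -> : j./2 != 0%N by rewrite -lt0n even2.
    by rewrite !mulr0 (negbTE j1).
  + rewrite WD ?even2// addr0 half ?(negbTE oj) ?(negbTE ok)//.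
    by rewrite /a (negbTE j1) (negbTE k1) s2 mulrA divff ?mul1r// pnatr_eq0.
- rewrite innerC (key k j (a j * Num.sqrt 2) _ _ (cs k./2) (cc j./2)) => [|x]; last first.
    by rewrite (tc _ _ Hj) (ts _ _ Hk); ring.
  rewrite Rintegral_sin_cos// mulr0.
  have /negbTE -> // : j != k by apply: contraNneq Hk => <-.
- rewrite (key j k (a k * Num.sqrt 2) _ _ (cs j./2) (cc k./2)) => [|x]; last first.
    by rewrite (tc _ _ Hk) (ts _ _ Hj); ring.
  rewrite Rintegral_sin_cos// mulr0.
  have /negbTE -> // : j != k by apply: contraNneq Hj => ->.
- rewrite (key j k 2 _ _ (cs j./2) (cs k./2)) => [|x]; last by rewrite (ts _ _ Hj) (ts _ _ Hk) mulrACA s2.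
  move: Hj Hk; rewrite !negb_or !negbK => /andP[j1 oj] /andP[k1 ok].
  rewrite Rintegral_sin_sin// WB WD ?odd3// subr0 half ?oj ?ok//.
  by rewrite mulrA divff ?mul1r// pnatr_eq0.
Qed.

End trig_basis.

(** * Coefficients, Bessel's identity and Parseval's identity *)

Section parseval.
Variable R : realType.
Implicit Types (f g : R -> R) (c d : nat -> R).

(** Indices start at 0 here: coefficient [k] belongs to the basis function of index k + 1, and
    [weight] is shifted in the same way. *)
Definition coef f (k : nat) : R := inner f (trig k.+1).

Definition trig_sum c (n : nat) : R -> R := fun t => \sum_(k < n) c k * trig k.+1 t.

(** Elements of the Sobolev ball, of the reproducing kernel Hilbert space and almost all draws from
    the prior come with a convergent expansion. This predicate carries that fact, and Parseval's
    identity rests on it. *)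
Definition expandable f : Prop := square_integrable f /\
  l2norm (f \- trig_sum (coef f) n) @[n --> \oo] --> 0.

Lemma sqi_trig_sum c n : square_integrable (trig_sum c n).
Proof.
apply: (@sqi_sum _ _ (index_enum 'I_n) (fun k t => c k * trig k.+1 t)) => k.
by apply: sqiZ; exact: sqi_trig.
Qed.

Lemma trig_coefB f g k : square_integrable f -> square_integrable g ->
  coef (f \- g) k = coef f k - coef g k.
Proof. by move=> hf hg; rewrite /coef innerBl//; exact: sqi_trig. Qed.

Lemma coef_trig_sum c n k : coef (trig_sum c n) k = if (k < n)%N then c k else 0.
Proof.
rewrite /coef /trig_sum inner_suml; last 2 first.
- by move=> i; apply: sqiZ; exact: sqi_trig.
- exact: sqi_trig.
have e (i : 'I_n) : inner (fun x => c i * trig i.+1 x) (trig k.+1) = c i * (i == k :> nat)%:R.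
  by rewrite innerZl ?trig_orthonormal//; exact: sqi_trig.
under eq_bigr do rewrite e.
case: ifPn => kn.
  rewrite (bigD1 (Ordinal kn))//= eqxx mulr1 big1 ?addr0// => i /eqP ik.
  case: eqP => [ek|]; last by rewrite mulr0.
  by exfalso; apply: ik; apply: val_inj.
rewrite big1// => i _; case: eqP => [ek|]; last by rewrite mulr0.
by move: kn; rewrite -ek ltn_ord.
Qed.

Lemma inner_trig_sum f c n : square_integrable f ->
  inner f (trig_sum c n) = \sum_(k < n) c k * coef f k.
Proof.
move=> hf; rewrite innerC inner_suml//; last first.
  by move=> i; apply: sqiZ; exact: sqi_trig.
by apply: eq_bigr => i _; rewrite innerZl 1?innerC//; exact: sqi_trig.
Qed.

Lemma l2norm_trig_sum c n : l2norm (trig_sum c n) ^+ 2 = \sum_(k < n) c k ^+ 2.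
Proof.
rewrite l2norm_sqr; last exact: sqi_trig_sum.
rewrite inner_trig_sum; last exact: sqi_trig_sum.
by apply: eq_bigr => i _; rewrite coef_trig_sum ltn_ord expr2.
Qed.

Lemma bessel f n : square_integrable f ->
  l2norm (f \- trig_sum (coef f) n) ^+ 2 = l2norm f ^+ 2 - \sum_(k < n) coef f k ^+ 2.
Proof.
move=> hf; have hs := sqi_trig_sum (coef f) n; have hd := sqiB hf hs.
rewrite !l2norm_sqr// innerBl// innerC innerBl// (innerC _ (_ \- _)) innerBl//.
rewrite -(l2norm_sqr hs) l2norm_trig_sum (innerC _ f) inner_trig_sum//.
under [X in _ - X - _]eq_bigr do rewrite -expr2.
by rewrite subrr subr0.
Qed.

Lemma sum_coef_le f n : square_integrable f -> \sum_(k < n) coef f k ^+ 2 <= l2norm f ^+ 2.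
Proof. by move=> hf; rewrite -subr_ge0 -bessel// sqr_ge0. Qed.

Lemma parseval f : expandable f ->
  \sum_(k < n) coef f k ^+ 2 @[n --> \oo] --> l2norm f ^+ 2.
Proof.
move=> [hf cf].
have -> : (fun n : nat => \sum_(k < n) coef f k ^+ 2) =
    (fun n => l2norm f ^+ 2 - l2norm (f \- trig_sum (coef f) n) ^+ 2).
  by apply/funext => n; rewrite bessel// opprB addrC subrK.
rewrite -[X in _ --> X]subr0; apply: cvgB; first exact: cvg_cst.
by rewrite -[X in _ --> X](expr0n _ 2); apply: cvgM => //; exact: cf.
Qed.

Lemma trig_expansion_sum c n :
  (fun t => \sum_(1 <= k < n.+1) c k * @trig R k t) = trig_sum (fun k => c k.+1) n.
Proof. by apply/funext => t; rewrite big_add1 big_mkord. Qed.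

Lemma trig_expansion_coef f c : square_integrable f ->
  l2norm (f \- trig_sum c n) @[n --> \oo] --> 0 -> forall k, coef f k = c k.
Proof.
move=> hf cf k; apply/eqP; rewrite -subr_eq0 -normr_le0.
have : (\forall n \near \oo, `|coef f k - c k| <= l2norm (f \- trig_sum c n) * l2norm (@trig R k.+1)).
  exists k.+1 => // n /= kn.
  have hs := sqi_trig_sum c n.
  have -> : coef f k - c k = inner (f \- trig_sum c n) (trig k.+1).
    rewrite innerBl//; last exact: sqi_trig.
    by rewrite -/(coef f k) -/(coef _ k) coef_trig_sum kn.
  by apply: inner_le_norm; [exact: sqiB|exact: sqi_trig].
move=> h; rewrite -(mul0r (l2norm (@trig R k.+1))).
by apply: (cvgr_to_ge _ h); apply: cvgM => //; exact: cvg_cst.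
Qed.

Lemma trig_sum_ext c d n : (forall k, (k < n)%N -> c k = d k) -> trig_sum c n = trig_sum d n.
Proof. by move=> cd; apply/funext => t; apply: eq_bigr => k _; rewrite cd. Qed.

Lemma expandableP f c : square_integrable f ->
  l2norm (f \- trig_sum c n) @[n --> \oo] --> 0 ->
  expandable f /\ (forall k, coef f k = c k).
Proof.
move=> hf cf; have e := trig_expansion_coef hf cf; split=> //; split=> //.
by have -> : coef f = c by apply/funext.
Qed.

Lemma trig_expansionP (f : L2 R) c : trig_expansion f c <->
  expandable f /\ (forall k, coef f k = c k.+1).
Proof.
rewrite /trig_expansion.
have -> : (fun n : nat => l2norm (fun t => f t - \sum_(1 <= k < n.+1) c k * trig k t)) =
    (fun n => l2norm (f \- trig_sum (fun k => c k.+1) n)).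
  by apply/funext => n; rewrite -trig_expansion_sum.
split; first by apply: expandableP; exact: L2_sqi.
by move=> [[hf cf] e]; have <- : coef f = (fun k => c k.+1) by apply/funext.
Qed.

Lemma squeeze0 (u v : nat -> R) : (forall n, 0 <= u n <= v n) ->
  v n @[n --> \oo] --> 0 -> u n @[n --> \oo] --> 0.
Proof.
move=> uv cv; apply: (squeeze_cvgr _ _ cv); last exact: cvg_cst.
by apply: nearW => n; have /andP[-> ->] := uv n.
Qed.

Lemma expandableB f g : expandable f -> expandable g -> expandable (f \- g).
Proof.
move=> [hf cf] [hg cg]; split; first exact: sqiB.
apply: (@squeeze0 _ (fun n => l2norm (f \- trig_sum (coef f) n) + l2norm (g \- trig_sum (coef g) n))).
  move=> n; rewrite l2norm_ge0/=.
  have hsf := sqi_trig_sum (coef f) n; have hsg := sqi_trig_sum (coef g) n.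
  have -> : (f \- g) \- trig_sum (coef (f \- g)) n =
    (f \- trig_sum (coef f) n) \+ (\- (g \- trig_sum (coef g) n)).
    apply/funext => t /=; rewrite /trig_sum.
    under eq_bigr do rewrite trig_coefB// mulrBl.
    by rewrite sumrB; lra.
  rewrite -[leRHS](_ : l2norm (f \- trig_sum (coef f) n) + l2norm (\- (g \- trig_sum (coef g) n)) = _); last by rewrite l2normN.
  apply: l2norm_triangle; first exact: sqiB.
  have -> : \- (g \- trig_sum (coef g) n) = trig_sum (coef g) n \- g.
    by apply/funext => t /=; rewrite opprB.
  exact: sqiB.
by rewrite -[X in _ --> X](addr0 0); exact: cvgD.
Qed.

Lemma expandable_trig_sum c n : expandable (trig_sum c n).
Proof.
split; first exact: sqi_trig_sum.
have h : \forall m \near \oo, 0 = l2norm (trig_sum c n \- trig_sum (coef (trig_sum c n)) m).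
  exists n => // m /= nm.
  have -> : trig_sum (coef (trig_sum c n)) m = trig_sum c n.
    apply/funext => t; rewrite /trig_sum (big_ord_widen m (fun k => c k * trig k.+1 t))// [RHS]big_mkcond/=.
    apply: eq_bigr => k _; rewrite coef_trig_sum.
    by case: ifP => //; rewrite mul0r.
  have -> : trig_sum c n \- trig_sum c n = (fun=> 0) by apply/funext => t /=; rewrite subrr.
  apply/esym/eqP; rewrite -sqrf_eq0 l2norm_sqr; last exact: sqi0.
  by rewrite /inner; under eq_Rintegral do rewrite mul0r; rewrite Rintegral_cst// mul0r.
apply: cvg_near_cst; apply: filterS h => m e; exact/esym.
Qed.

Lemma expandable_ae f g : f = g %[ae leb01 R] -> square_integrable f -> expandable g ->
  expandable f /\ (forall k, coef f k = coef g k).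
Proof.
move=> fg hf [hg cg]; apply: expandableP => //.
have e n : l2norm (f \- trig_sum (coef g) n) = l2norm (g \- trig_sum (coef g) n).
  apply: l2norm_ae; last 2 first.
  - by apply: sqi_measurable; apply: sqiB => //; exact: sqi_trig_sum.
  - by apply: sqi_measurable; apply: sqiB => //; exact: sqi_trig_sum.
  by apply: (@filterS _ _ (ae_filter_ringOfSetsType (leb01 R)) _ _ _ fg) => x /= h _; rewrite h.
by under eq_fun do rewrite e.
Qed.

(* Stated for a squared radius so that it applies to sums of squares of coefficients. *)
Lemma l2norm_sqr_le f (r : R) : expandable f ->
  (forall n, \sum_(k < n) coef f k ^+ 2 <= r) -> l2norm f ^+ 2 <= r.
Proof.
move=> hf h; apply: (cvgr_to_le (parseval hf)); exact: nearW.
Qed.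

Lemma l2norm_tail f (e : R) : expandable f -> 0 < e ->
  exists N, forall m, (N <= m)%N ->
    l2norm f ^+ 2 - e < \sum_(k < m) coef f k ^+ 2.
Proof.
move=> hf e0; have /cvgr_gt := parseval hf.
move=> /(_ (l2norm f ^+ 2 - e)); rewrite gtrBl => /(_ e0)[N _ h].
by exists N => m Nm; exact: h.
Qed.

End parseval.

(** * The reproducing kernel Hilbert space and the approximation cost *)

Section rkhs.
Variables (R : realType) (alpha : R).
Implicit Types (f g : R -> R) (c u : nat -> R).

(** The series of the definitions start at 1 and take extended real values; this turns bounds on
    them into uniform bounds on partial sums indexed from 0. *)
Lemma eseries1_le (v : nat -> R) (M : R) : (forall k, 0 <= v k) ->
  (\sum_(1 <= k <oo) (v k)%:E <= M%:E)%E <-> forall n, \sum_(k < n) v k.+1 <= M.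
Proof.
move=> v0.
have e n : (\sum_(1 <= k < n.+1) (v k)%:E = (\sum_(k < n) v k.+1)%:E)%E.
  by rewrite sumEFin big_add1 big_mkord.
split=> [h n|h].
  rewrite -lee_fin -e; apply: le_trans h; apply: nneseries_lim_ge => k _ _.
  by rewrite lee_fin.
apply: lime_le; first by apply: is_cvg_nneseries => k _ _; rewrite lee_fin.
apply: nearW => -[|n]; first by rewrite big_geq// lee_fin; have := h 0%N; rewrite big_ord0.
by rewrite e lee_fin.
Qed.

Lemma sum_support_le (v : nat -> R) N n : (forall k, 0 <= v k) ->
  (forall k, ~~ (k < N)%N -> v k = 0) -> \sum_(k < n) v k <= \sum_(k < N) v k.
Proof.
move=> v0 vN; have [nN|/ltnW Nn] := leqP n N.
  rewrite (big_ord_widen N v)// big_mkcond/=.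
  by apply: ler_sum => k _; case: ifP.
rewrite [leRHS](big_ord_widen n v)// [leRHS]big_mkcond/=.
by apply: ler_sum => k _; case: ifPn => // kN; rewrite vN.
Qed.

Definition weight (k : nat) : R := prior_weight alpha k.+1.

Lemma weight_gt0 k : 0 < weight k.
Proof. by rewrite powR_gt0. Qed.

Lemma rkhs_coordP (f : L2 R) (h : nat -> R) :
  rkhs_coord alpha f h <-> [/\ expandable f, (forall k, coef f k = weight k * h k.+1) &
    exists M, forall n, \sum_(k < n) h k.+1 ^+ 2 <= M].
Proof.
have h2 k : 0 <= h k ^+ 2 by exact: sqr_ge0.
split=> [[fin /trig_expansionP[ef cf]]|[ef cf [M hM]]].
  split=> //; first by move=> k; rewrite cf mulrC.
  have fn : (\sum_(1 <= k <oo) (h k ^+ 2)%:E)%E \is a fin_num.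
    by rewrite ge0_fin_numE// nneseries_ge0// => k _ _; rewrite lee_fin.
  exists (fine (\sum_(1 <= k <oo) (h k ^+ 2)%:E)%E).
  by apply/(@eseries1_le (fun k => h k ^+ 2)) => //; rewrite fineK.
split; last by apply/trig_expansionP; split=> // k; rewrite cf mulrC.
have /(@eseries1_le (fun k => h k ^+ 2) M h2) := hM.
by move=> /le_lt_trans; apply; exact: ltry.
Qed.

Lemma rkhsP (f : L2 R) : rkhs alpha f <-> expandable f /\
  exists M, forall n, \sum_(k < n) (coef f k / weight k) ^+ 2 <= M.
Proof.
split=> [[h /rkhs_coordP[ef cf hM]]|[ef [M hM]]].
  case: hM => M hM; split=> //; exists M => n.
  have e k : coef f k / weight k = h k.+1.
    by rewrite cf mulrC mulrA mulVf ?mul1r// gt_eqF ?weight_gt0.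
  by under eq_bigr do rewrite e.
exists (fun k => coef f k.-1 / weight k.-1); apply/rkhs_coordP; split=> //=.
  by move=> k; rewrite mulrCA mulfV ?mulr1// gt_eqF ?weight_gt0.
by exists M.
Qed.

(** The expansion determines the coordinates, so whatever [get] returns, the squared norm is the
    least upper bound of these partial sums. *)
Lemma rkhs_sqnorm_le (f : L2 R) M : rkhs alpha f ->
  rkhs_sqnorm alpha f <= M <-> forall n, \sum_(k < n) (coef f k / weight k) ^+ 2 <= M.
Proof.
move=> rf; rewrite /rkhs_sqnorm.
have hc : rkhs_coord alpha f (get (rkhs_coord alpha f)).
  by case: rf => h; exact: getI.
have [fin _] := hc; have /rkhs_coordP[_ cf _] := hc.
set h := get _ in hc fin cf *.
have h2 k : 0 <= h k ^+ 2 by exact: sqr_ge0.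
have fn : (\sum_(1 <= k <oo) (h k ^+ 2)%:E)%E \is a fin_num.
  by rewrite ge0_fin_numE// nneseries_ge0// => k _ _; rewrite lee_fin.
rewrite -lee_fin fineK// (@eseries1_le (fun k => h k ^+ 2))//.
have e k : coef f k / weight k = h k.+1.
  by rewrite cf mulrC mulrA mulVf ?mul1r// gt_eqF ?weight_gt0.
have E n : \sum_(k < n) (coef f k / weight k) ^+ 2 = \sum_(k < n) h k.+1 ^+ 2.
  by apply: eq_bigr => k _; rewrite e.
by split=> H n; rewrite ?E// -E.
Qed.

Lemma rkhs_sqnorm_ge0 (f : L2 R) : 0 <= rkhs_sqnorm alpha f.
Proof.
by rewrite fine_ge0// nneseries_ge0// => k _ _; rewrite lee_fin sqr_ge0.
Qed.

(** The infimum in the concentration function, separated from the small ball term because the two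
    are estimated by different means. *)
Definition approx_cost (f0 : L2 R) (e : R) : R :=
  inf [set rkhs_sqnorm alpha h | h in [set h | rkhs alpha h /\ l2norm (h \- f0) < e]].

Lemma approx_cost_le_sqnorm (f0 h : L2 R) e : rkhs alpha h -> l2norm (h \- f0) < e ->
  approx_cost f0 e <= rkhs_sqnorm alpha h.
Proof.
move=> rh he; apply: ge_inf; last by exists h.
by exists 0 => _ [g _ <-]; exact: rkhs_sqnorm_ge0.
Qed.

Lemma trig_sum_class c n : exists F : L2 R,
  L2_fun F = trig_sum c n %[ae leb01 R] /\ expandable F /\
  forall k, coef F k = if (k < n)%N then c k else 0.
Proof.
have [F Fc] := L2_class (sqi_trig_sum c n).
exists F; split=> //.
have [eF cF] := expandable_ae Fc (L2_sqi F) (expandable_trig_sum c n).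
by split=> // k; rewrite cF coef_trig_sum.
Qed.

Lemma l2norm_dist_ae (F f0 : L2 R) f : L2_fun F = f %[ae leb01 R] -> square_integrable f ->
  l2norm (F \- f0) = l2norm (f \- f0).
Proof.
move=> Ff hf; apply: l2norm_ae.
- by apply: (@filterS _ _ (ae_filter_ringOfSetsType (leb01 R)) _ _ _ Ff) => x /= h _; rewrite h.
- by apply: sqi_measurable; apply: sqiB; exact: L2_sqi.
- by apply: sqi_measurable; apply: sqiB => //; exact: L2_sqi.
Qed.

Lemma approx_cost_le (f0 : L2 R) e u N :
  l2norm (trig_sum (fun k => weight k * u k) N \- f0) < e ->
  approx_cost f0 e <= \sum_(k < N) u k ^+ 2.
Proof.
move=> he; have [F [Fc [eF cF]]] := trig_sum_class (fun k => weight k * u k) N.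
have cw k : (k < N)%N -> coef F k / weight k = u k.
  by move=> kN; rewrite cF kN mulrAC mulfV ?mul1r// gt_eqF ?weight_gt0.
have cw0 k : ~~ (k < N)%N -> coef F k / weight k = 0.
  by move=> /negbTE kN; rewrite cF kN mul0r.
have bd n : \sum_(k < n) (coef F k / weight k) ^+ 2 <= \sum_(k < N) u k ^+ 2.
  have -> : \sum_(k < N) u k ^+ 2 = \sum_(k < N) (coef F k / weight k) ^+ 2.
    by apply: eq_bigr => k _; rewrite cw.
  apply: (@sum_support_le (fun k => (coef F k / weight k) ^+ 2)) => k; first exact: sqr_ge0.
  by move=> kN; rewrite cw0// expr0n.
have rF : rkhs alpha F by apply/rkhsP; split=> //; eexists; exact: bd.
apply: le_trans (approx_cost_le_sqnorm rF _) _; last exact/rkhs_sqnorm_le.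
by rewrite (l2norm_dist_ae _ Fc)//; exact: sqi_trig_sum.
Qed.

(** The infimum is approached by finite trigonometric sums: truncating an admissible [h] does not
    increase its norm, and the strict inequality defining the ball leaves room for the error. This
    lets every shift act on finitely many coordinates. *)
Lemma approx_cost_adherent (f0 : L2 R) e d : expandable f0 -> 0 < e -> 0 < d ->
  exists N u, l2norm (trig_sum (fun k => weight k * u k) N \- f0) < e /\
    \sum_(k < N) u k ^+ 2 < approx_cost f0 e + d.
Proof.
move=> ef0 e0 d0.
have trunc (h : R -> R) : expandable h -> l2norm (h \- f0) < e ->
    exists N, l2norm (trig_sum (coef h) N \- f0) < e.
  move=> [hh ch] he.
  have : \forall n \near \oo, l2norm (h \- trig_sum (coef h) n) < e - l2norm (h \- f0).
    by apply: cvgr_lt ch _ _; rewrite subr_gt0.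
  move=> [N _ hN]; exists N; have := hN N (leqnn N) => /= hN'.
  apply: le_lt_trans (l2norm_distD (sqi_trig_sum _ _) hh (L2_sqi f0)) _.
  by rewrite -ltrBrDr l2norm_distC.
have hi : has_inf [set rkhs_sqnorm alpha h | h in [set h | rkhs alpha h /\ l2norm (h \- f0) < e]].
  split; last by exists 0 => _ [g _ <-]; exact: rkhs_sqnorm_ge0.
  (* A truncation of [f0] itself shows that the set of admissible costs is nonempty. *)
  have [|N hN] := trunc f0 ef0.
    have -> : f0 \- f0 = (fun=> 0) by apply/funext => t /=; rewrite subrr.
    have -> // : l2norm (fun=> 0 : R) = 0.
    apply/eqP; rewrite -sqrf_eq0 l2norm_sqr; last exact: sqi0.
    by rewrite /inner; under eq_Rintegral do rewrite mul0r; rewrite Rintegral_cst// mul0r.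
  have [F [Fc [eF cF]]] := trig_sum_class (coef f0) N.
  exists (rkhs_sqnorm alpha F), F => //; split; last first.
    by rewrite (l2norm_dist_ae _ Fc)//; exact: sqi_trig_sum.
  apply/rkhsP; split=> //; exists (\sum_(k < N) (coef F k / weight k) ^+ 2) => n.
  apply: (@sum_support_le (fun k => (coef F k / weight k) ^+ 2)) => k; first exact: sqr_ge0.
  by move=> /negbTE kN; rewrite cF kN mul0r expr0n.
have [_ [h [rh he] <-] hlt] := inf_adherent d0 hi.
have /rkhsP[eh _] := rh.
have [N hN] := trunc h eh he.
exists N, (fun k => coef h k / weight k); split.
  have -> // : trig_sum (fun k => weight k * (coef h k / weight k)) N = trig_sum (coef h) N.
  by apply: trig_sum_ext => k _; rewrite mulrCA mulfV ?mulr1// gt_eqF ?weight_gt0.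
by apply: le_lt_trans hlt; move: N {hN}; exact/(rkhs_sqnorm_le _ rh).
Qed.

Lemma approx_cost_ge0 (f0 : L2 R) e : expandable f0 -> 0 < e -> 0 <= approx_cost f0 e.
Proof.
move=> ef0 e0; apply/ler_addgt0Pr => d d0.
have [N [u [_ /ltW]]] := approx_cost_adherent ef0 e0 d0.
by apply: le_trans; apply: sumr_ge0 => k _; exact: sqr_ge0.
Qed.

End rkhs.

(** * Measurability in L^2 and the prior in coordinates *)

Section L2_measurability.
Variable R : realType.
Implicit Types (f g : R -> R).

Lemma L2_ball_open g r : square_integrable g -> L2_open [set f : L2 R | l2norm (f \- g) < r].
Proof.
move=> hg f /= fr; exists (r - l2norm (f \- g)); first by rewrite subr_gt0.
move=> h hf; apply: le_lt_trans (l2norm_distD (L2_sqi h) (L2_sqi f) hg) _.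
by rewrite -ltrBrDr.
Qed.

Lemma measurable_L2_ball g r : square_integrable g ->
  measurable [set f : L2 R | l2norm (f \- g) < r].
Proof. by move=> hg; apply: sub_sigma_algebra; exact: L2_ball_open. Qed.

Lemma measurable_l2dist g : square_integrable g ->
  measurable_fun setT (fun f : L2 R => l2norm (f \- g)).
Proof.
move=> hg; apply: (@measurability _ _ (L2 R) (measurableTypeR R) setT
  (fun f : L2 R => l2norm (f \- g)) (@RGenInftyO.G R)).
  exact: RGenInftyO.measurableE.
move=> _ [_ [x ->] <-]; rewrite setTI.
rewrite (_ : _ @^-1` _ = [set f : L2 R | l2norm (f \- g) < x]).
  exact: measurable_L2_ball.
by apply/seteqP; split => f /=; rewrite in_itv.
Qed.

End L2_measurability.

Section independence_of_prior_coordinates.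
Context d (Omega : measurableType d) (R : realType) (P : probability Omega R).

Definition std_normal : probability (measurableTypeR R) R := normal_prob (0 : R) 1.

Lemma mutually_independent_with_laws (X : nat -> Omega -> R)
    (nu : nat -> probability (measurableTypeR R) R) :
  (forall k, measurable_fun setT (X k)) -> mutually_independent P X ->
  (forall k A, measurable A -> P (X k @^-1` A) = nu k A) ->
  independent_with_laws P X nu.
Proof.
move=> mX mi Xnu; split=> // N B mB.
pose K : {fset nat} := [fset x in iota 0 N]%fset.
have KE k : (k \in K) = (k < N)%N by rewrite !inE mem_iota.
have -> : [set w | forall k, (k < N)%N -> B k (X k w)] =
    \bigcap_(k in [set` K]) X k @^-1` B k.
  apply/seteqP; split => w h k.
    by rewrite /= KE => kN; exact: h.
  by move=> kN; apply: h; rewrite /= KE.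
rewrite mi//.
have pK : perm_eq K (iota 0 N).
  by apply: uniq_perm; [exact: fset_uniq|exact: iota_uniq|move=> k; rewrite KE mem_iota].
rewrite (perm_big _ pK)/= -{1}(subn0 N) -/(index_iota 0 N) big_mkord.
by apply: eq_bigr => k _; exact: (Xnu k _ (mB k)).
Qed.

(** Transfer of events from functions to sequences of independent standard normals. The events have
    to agree on expandable functions only, since almost every draw is one; taking the empty set for
    [B] proves that an event is null. *)
Definition prior_coordinates (alpha : R) (Pi : probability (L2 R) R) (b : nat -> Omega -> R) : Prop :=
  independent_with_laws P b (fun=> std_normal) /\
  forall (A : set (L2 R)) (B : set (seqsp R)), measurable A -> measurable B ->
    (forall f : L2 R, expandable f -> forall x : nat -> R,
      (forall k, coef f k = weight alpha k * x k) -> A f <-> B x) ->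
    Pi A = P (seq_of b @^-1` B).

End independence_of_prior_coordinates.

Lemma ae_measure_eq d (T : measurableType d) (R : realType)
  (mu : {measure set T -> \bar R}) (A B : set T) : measurable A -> measurable B ->
  {ae mu, forall x, A x <-> B x} -> mu A = mu B.
Proof.
move=> mA mB AB; rewrite !measure_integral_indic//.
apply: ae_eq_integral => //; try by apply/measurable_EFinP; exact: measurable_indic.
apply: (@filterS _ _ (ae_filter_ringOfSetsType mu) _ _ _ AB) => x /= h _.
rewrite !indicE; suff -> : (x \in A) = (x \in B) by [].
by apply/idP/idP; rewrite !inE => /h.
Qed.

Lemma series_prior_coordinates (R : realType) (alpha : R) (Pi : probability (L2 R) R) :
  series_prior alpha Pi -> exists d (Omega : measurableType d) (P : probability Omega R)
    (b : nat -> Omega -> R), prior_coordinates P alpha Pi b.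
Proof.
move=> [d [T [P [a [X [[mi na ex] PiE]]]]]].
exists d, T, P, (fun k => a k.+1).
have ib : independent_with_laws P (fun k => a k.+1) (fun=> std_normal R).
  apply: (@mutually_independent_with_laws _ _ _ _ (fun k => a k.+1)) => //.
  by move=> k A mA; exact: (na k.+1).
split=> // A B mA mB AB; rewrite PiE//=.
rewrite /distribution /pushforward.
have mXA : measurable (X @^-1` A) by exact: measurable_funPTI.
have mB' : measurable (seq_of (fun k => a k.+1 : T -> R) @^-1` B).
  by rewrite -[X in measurable X]setTI; exact: (measurable_seq_of ib measurableT mB).
apply: ae_measure_eq => //.
apply: (@filterS _ _ (ae_filter_ringOfSetsType P) _ _ _ ex) => w /= /trig_expansionP[eX cX].
by apply: AB => // k; rewrite cX.
Qed.

Section prior_ball.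
Context d (Omega : measurableType d) (R : realType) (P : probability Omega R).
Variables (alpha : R) (Pi : probability (L2 R) R) (b : nat -> Omega -> R).
Hypothesis pc : prior_coordinates P alpha Pi b.
Implicit Types (f g : R -> R) (c u x : nat -> R).
Local Notation w := (weight alpha).
Local Notation ib := (proj1 pc).

Definition partial_sqdist c (N : nat) x : R := \sum_(k < N) (w k * x k - c k) ^+ 2.

(** This is the event that the infinite sum is less than [r]: one bound below [r] for all partial
    sums replaces the limit, and the event becomes a countable combination of conditions on partial
    sums. *)
Definition sqdist_lt c (r : R) : set (seqsp R) :=
  [set x | exists2 s, s < r & forall N, partial_sqdist c N x <= s].

Lemma measurable_partial_sqdist c N :
  measurable_fun setT (partial_sqdist c N : seqsp R -> R).
Proof.
apply: measurable_sum => k; apply: measurable_funX; apply: measurable_funB => //.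
by apply: measurable_funM => //; exact: measurable_coord.
Qed.

Lemma sqdist_ltE c r : sqdist_lt c r =
  \bigcup_m \bigcap_N [set x : seqsp R | partial_sqdist c N x <= r - m.+1%:R^-1].
Proof.
apply/seteqP; split => x.
  move=> [s sr h]; have [m hm] := ltr_add_invr sr.
  by exists m => // N _ /=; apply: le_trans (h N) _; rewrite lerBrDr ltW.
move=> [m _ h]; exists (r - m.+1%:R^-1); last by move=> N; exact: h.
by rewrite gtrBl invr_gt0.
Qed.

Lemma measurable_sqdist_lt c r : measurable (sqdist_lt c r).
Proof.
rewrite sqdist_ltE; apply: bigcupT_measurable => m; apply: bigcapT_measurable => N.
by apply: measurable_le_set; exact: measurable_partial_sqdist.
Qed.

Lemma measurable_seq_event (B : set (seqsp R)) : measurable B ->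
  measurable (seq_of b @^-1` B).
Proof. by move=> mB; rewrite -[X in measurable X]setTI; exact: (measurable_seq_of ib). Qed.

Lemma l2norm_lt_sqdist (f : L2 R) g r x : expandable f -> expandable g ->
  (forall k, coef f k = w k * x k) -> 0 < r ->
  l2norm (f \- g) < r <-> sqdist_lt (coef g) (r ^+ 2) x.
Proof.
move=> ef eg cf r0; have efg := expandableB ef eg.
have hf := ef.1; have hg := eg.1.
have E N : \sum_(k < N) coef (f \- g) k ^+ 2 = partial_sqdist (coef g) N x.
  by apply: eq_bigr => k _; rewrite trig_coefB// cf.
have -> : (l2norm (f \- g) < r) = (l2norm (f \- g) ^+ 2 < r ^+ 2).
  by rewrite ltr_sqr ?nnegrE ?l2norm_ge0// ltW.
split=> [lt|[s sr h]].
  exists (l2norm (f \- g) ^+ 2) => // N; rewrite -E; apply: sum_coef_le; exact: efg.1.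
by apply: le_lt_trans sr; apply: l2norm_sqr_le => // N; rewrite E.
Qed.

Lemma prior_ball g r : expandable g -> 0 < r ->
  Pi [set f : L2 R | l2norm (f \- g) < r] = P (seq_of b @^-1` sqdist_lt (coef g) (r ^+ 2)).
Proof.
move=> eg r0; apply: pc.2.
- by apply: measurable_L2_ball; exact: eg.1.
- exact: measurable_sqdist_lt.
- by move=> f ef x cf; exact: l2norm_lt_sqdist.
Qed.

End prior_ball.

Section gaussian_symmetry.
Context d (Omega : measurableType d) (R : realType) (P : probability Omega R).

Lemma same_law d' (Omega' : measurableType d') (P' : probability Omega' R)
    (b : nat -> Omega -> R) (b' : nat -> Omega' -> R) nu (A : set (seqsp R)) :
  independent_with_laws P b nu -> independent_with_laws P' b' nu ->
  measurable A -> P (seq_of b @^-1` A) = P' (seq_of b' @^-1` A).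
Proof.
move=> ib ib' mA.
apply: (@seqsp_measure_unique _
  (measure_function_pushforward__canonical__measure_function_Measure P (measurable_seq_of ib))
  (measure_function_pushforward__canonical__measure_function_Measure P' (measurable_seq_of ib'))) => //.
  by rewrite /= /pushforward preimage_setT probability_setT ltry.
move=> N B mB; rewrite /= /pushforward.
by rewrite [LHS](ib.2 N B mB) [RHS](ib'.2 N B mB).
Qed.

Lemma normal_symmetric (A : set (measurableTypeR R)) : measurable A ->
  normal_prob (0 : R) 1 (-%R @^-1` A) = normal_prob 0 1 A.
Proof.
move=> mA; have mN : measurable (-%R @^-1` A : set R).
  by rewrite -[X in measurable X]setTI; exact: oppr_measurable.
pose p : R -> \bar R := fun x => (normal_pdf 0 1 x)%:E.
have pN x : p (- x) = p x.
  by rewrite /p !normal_pdfE ?oner_neq0// /normal_fun !subr0 sqrrN.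
have mp : measurable_fun setT p by apply/measurable_EFinP; exact: measurable_normal_pdf.
have m1 (B : set R) : measurable B -> measurable_fun setT (fun x => (p x * (\1_B x)%:E)%E).
  by move=> mB; apply: emeasurable_funM => //; apply/measurable_EFinP.
have E (B : set R) : measurable B -> normal_prob 0 1 B = (\int[lebesgue_measure]_x (p x * (\1_B x)%:E))%E.
  move=> mB; rewrite /normal_prob integral_mkcond.
  by apply: eq_integral => x _; rewrite epatch_indic.
rewrite !E// -[RHS](ge0_integral_reflect 0 (m1 A mA)); last first.
  by move=> x; rewrite mule_ge0// lee_fin ?normal_pdf_ge0.
apply: eq_integral => x _; rewrite sub0r pN; congr (_ * _)%E.
Qed.

Lemma independent_opp (b : nat -> Omega -> R) :
  independent_with_laws P b (fun=> std_normal R) ->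
  independent_with_laws P (fun k w => - b k w) (fun=> std_normal R).
Proof.
move=> ib; split=> [k|N B mB].
  by apply: measurableT_comp => //; exact: ib.1.
have mB' k : measurable (-%R @^-1` B k : set (measurableTypeR R)).
  by rewrite -[X in measurable X]setTI; exact: (@oppr_measurable R setT measurableT (B k) (mB k)).
rewrite [LHS](ib.2 N _ mB'); apply: eq_bigr => k _; exact: normal_symmetric.
Qed.

End gaussian_symmetry.

(** * Prior masses of balls under shifts *)

Section cameron_martin_bounds.
Context d (Omega : measurableType d) (R : realType) (P : probability Omega R).
Variables (alpha : R) (Pi : probability (L2 R) R) (b : nat -> Omega -> R).
Hypothesis pc : prior_coordinates P alpha Pi b.
Implicit Types (f g : R -> R) (c u x : nat -> R).
Local Notation w := (weight alpha).
Local Notation ib := (proj1 pc).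
Local Notation Pb A := (P (seq_of b @^-1` A)).

Lemma std_cameron_martin N u (Phi : seqsp R -> \bar R) :
  measurable_fun setT Phi -> (forall x, (0 <= Phi x)%E) ->
  (\int[P]_t Phi (shift_below N u (seq_of b t)) =
   \int[P]_t (Phi (seq_of b t) *
     (expR (\sum_(k < N) u k * b k t - (\sum_(k < N) u k ^+ 2) / 2))%:E))%E.
Proof.
move=> mPhi Phi0.
rewrite (@cameron_martin _ _ _ _ _ _ ib N u (fun=> 1) Phi (fun k _ => oner_neq0 R)
  (fun k _ A _ => erefl) mPhi Phi0).
apply: eq_integral => t _; congr (_ * (expR _)%:E)%E.
rewrite mulr_suml -sumrB; apply: eq_bigr => k _.
by rewrite expr1n divr1 mulr1.
Qed.

Definition finite_coef u N : nat -> R := fun k => if (k < N)%N then w k * u k else 0.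

Lemma sqdist_lt_shift c u N r x :
  sqdist_lt alpha c r (shift_below N u x) <->
  sqdist_lt alpha (fun k => c k - finite_coef u N k) r x.
Proof.
have E M : partial_sqdist alpha c M (shift_below N u x) =
    partial_sqdist alpha (fun k => c k - finite_coef u N k) M x.
  apply: eq_bigr => k _; rewrite /shift_below /finite_coef.
  by case: ifP => _; [congr (_ ^+ 2); ring|rewrite subr0].
by split=> -[s sr h]; exists s => // M; rewrite ?E// -E.
Qed.

Lemma sqdist_lt_opp r x : sqdist_lt alpha (fun=> 0) r (fun k => - x k) <->
  sqdist_lt alpha (fun=> 0) r x.
Proof.
have E M : partial_sqdist alpha (fun=> 0) M (fun k => - x k) =
    partial_sqdist alpha (fun=> 0) M x.
  by apply: eq_bigr => k _; rewrite !subr0 mulrN sqrrN.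
by split=> -[s sr h]; exists s => // M; rewrite ?E// -E.
Qed.

Lemma sqdist_lt_ext c c' r : (forall k, c k = c' k) -> sqdist_lt alpha c r = sqdist_lt alpha c' r.
Proof. by move=> cc; have -> : c = c' by apply/funext. Qed.

Lemma indicE_shift (A B : set (seqsp R)) (x y : seqsp R) : (A x <-> B y) ->
  (\1_A x : R) = \1_B y.
Proof.
move=> AB; rewrite !indicE; suff -> : (x \in A) = (y \in B) by [].
by apply/idP/idP; rewrite !inE => /AB.
Qed.

Lemma measurable_indicE (A : set (seqsp R)) : measurable A ->
  measurable_fun setT (fun x : seqsp R => (\1_A x : R)%:E).
Proof. by move=> mA; apply/measurable_EFinP; exact: measurable_indic. Qed.

Lemma indicE_ge0 (A : set (seqsp R)) (x : seqsp R) : (0 <= (\1_A x : R)%:E)%E.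
Proof. by rewrite lee_fin. Qed.

Lemma prob_indic (A : set (seqsp R)) : measurable A ->
  Pb A = (\int[P]_t (\1_A (seq_of b t) : R)%:E)%E.
Proof.
by move=> mA; rewrite (measure_integral_indic P (measurable_seq_event pc mA)).
Qed.

(** The Cameron-Martin formula expresses the mass of the shifted ball by the weight exp(Z - U) and,
    as the normal law is symmetric, equally by exp(- Z - U). The mean of the two weights is at least
    exp(- U). *)
Lemma prior_ball_shift_ge u N r :
  ((expR (- ((\sum_(k < N) u k ^+ 2) / 2)))%:E * Pb (sqdist_lt alpha (fun=> 0%R) r) <=
   Pb (sqdist_lt alpha (finite_coef u N) r))%E.
Proof.
set A0 := sqdist_lt alpha (fun=> 0) r; set Au := sqdist_lt alpha (finite_coef u N) r.
set U := (\sum_(k < N) u k ^+ 2) / 2.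
have mA0 : measurable A0 by exact: measurable_sqdist_lt.
have mAu : measurable Au by exact: measurable_sqdist_lt.
pose Z t := \sum_(k < N) u k * b k t.
have mZ : measurable_fun setT Z.
  by apply: measurable_sum => k; apply: measurable_funM => //; exact: ib.1.
pose ind t : R := \1_A0 (seq_of b t).
have mind : measurable_fun setT ind.
  by apply: measurable_indic; exact: (measurable_seq_event pc).
have iop := independent_opp ib.
have e1 : (Pb Au = \int[P]_t (ind t * expR (- Z t - U))%:E)%E.
  rewrite prob_indic//.
  transitivity (\int[P]_t (\1_A0 (shift_below N (fun k => - u k) (seq_of b t)) : R)%:E)%E.
    apply: eq_integral => t _; congr EFin; apply: indicE_shift.
    rewrite /A0 (sqdist_lt_shift _ (fun k => - u k)).
    rewrite (@sqdist_lt_ext _ (finite_coef u N)) => // k.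
    by rewrite /finite_coef; case: ifP => _; rewrite ?subr0// mulrN opprK add0r.
  rewrite (std_cameron_martin _ _ (measurable_indicE mA0) (@indicE_ge0 A0)).
  apply: eq_integral => t _; rewrite -EFinM; congr (_ * expR _)%:E.
  rewrite /Z /U -sumrN; congr (_ - _ / 2); last by apply: eq_bigr => k _; rewrite sqrrN.
  by apply: eq_bigr => k _; rewrite mulNr.
(* Changing the sign of all coordinates keeps their law and the centered ball, but reverses the sign
   of [Z]. *)
have e2 : (Pb Au = \int[P]_t (ind t * expR (Z t - U))%:E)%E.
  rewrite (same_law ib iop mAu).
  have mi : measurable (seq_of (fun k s => - b k s) @^-1` Au).
    by rewrite -[X in measurable X]setTI; exact: (measurable_seq_of iop).
  rewrite (measure_integral_indic P mi).
  transitivity (\int[P]_t (\1_A0 (shift_below N u (seq_of b t)) : R)%:E)%E.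
    apply: eq_integral => t _; congr EFin; apply: indicE_shift.
    apply: (iff_trans _ (sqdist_lt_opp r _)).
    have -> : (fun k => - shift_below N u (seq_of b t) k) =
      shift_below N (fun k => - u k) (seq_of (fun k s => - b k s) t).
      by apply/funext => k; rewrite /shift_below /seq_of; case: ifP => // _; rewrite opprD.
    apply: iff_sym; apply: (iff_trans (sqdist_lt_shift _ _ _ _ _)).
    rewrite (@sqdist_lt_ext _ (finite_coef u N)) => // k.
    by rewrite /finite_coef; case: ifP => _; rewrite ?subr0// mulrN opprK add0r.
  rewrite (std_cameron_martin _ _ (measurable_indicE mA0) (@indicE_ge0 A0)).
  by apply: eq_integral => t _; rewrite -EFinM.
have mexp (s : R) : measurable_fun setT (fun t => (ind t * expR (s * Z t - U))%:E).
  apply/measurable_EFinP; apply: measurable_funM => //; apply: measurableT_comp => //.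
  by apply: measurable_funB => //; exact: measurable_funM.
have ind0 t : 0 <= ind t by [].
have e1' : (Pb Au = \int[P]_t (ind t * expR (-1 * Z t - U))%:E)%E.
  by rewrite e1; apply: eq_integral => t _; rewrite mulN1r.
have e2' : (Pb Au = \int[P]_t (ind t * expR (1 * Z t - U))%:E)%E.
  by rewrite e2; apply: eq_integral => t _; rewrite mul1r.
have : ((expR (- U))%:E * Pb A0 + (expR (- U))%:E * Pb A0 <= Pb Au + Pb Au)%E.
  have mie : measurable_fun setT (fun t => ((expR (- U))%:E * (ind t)%:E)%E).
    by apply/measurable_EFinP; exact: measurable_funM.
  rewrite {1}e1' e2' prob_indic// -ge0_integralZl//; last first.
    exact/measurable_EFinP.
  rewrite -!ge0_integralD//.
  all: try by move=> t _; rewrite ?(=^~ EFinM) lee_fin mulr_ge0 ?expR_ge0.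
  apply: ge0_le_integral => //.
  - by move=> t _; rewrite -EFinM -EFinD lee_fin addr_ge0// mulr_ge0 ?expR_ge0.
  - exact: emeasurable_funD.
  - exact: emeasurable_funD.
  move=> t _; rewrite -!EFinM -!EFinD lee_fin -/(ind t) mul1r mulN1r -mulrDr.
  have h : expR (- U) *+ 2 <= expR (- Z t - U) + expR (Z t - U).
    rewrite !expRD -mulrDl -mulr_natl ler_wpM2r ?expR_ge0//.
    have := expR_ge1Dx (Z t); have := expR_ge1Dx (- Z t); lra.
  have := ler_wpM2l (ind0 t) h; lra.
have fA0 : Pb A0 \is a fin_num by apply: fin_num_measure; exact: (measurable_seq_event pc).
have fAu : Pb Au \is a fin_num by apply: fin_num_measure; exact: (measurable_seq_event pc).
rewrite -(fineK fA0) -(fineK fAu) -!EFinM -!EFinD !lee_fin; lra.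
Qed.

End cameron_martin_bounds.

Section small_ball_bounds.
Context d (Omega : measurableType d) (R : realType) (P : probability Omega R).
Variables (alpha : R) (Pi : probability (L2 R) R) (b : nat -> Omega -> R).
Hypothesis pc : prior_coordinates P alpha Pi b.
Implicit Types (f g : R -> R) (c u x : nat -> R).
Local Notation w := (weight alpha).
Local Notation ib := (proj1 pc).
Local Notation Pb A := (P (seq_of b @^-1` A)).

Definition partial_lt c N r : set (seqsp R) := [set x | partial_sqdist alpha c N x < r].

Lemma measurable_partial_lt c N r : measurable (partial_lt c N r).
Proof. by apply: measurable_lt_set; exact: measurable_partial_sqdist. Qed.

Lemma Pb_le (A B : set (seqsp R)) : measurable A -> measurable B -> A `<=` B ->
  (Pb A <= Pb B)%E.
Proof.
move=> mA mB AB; apply: le_measure; rewrite ?inE.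
- exact: (measurable_seq_event pc).
- exact: (measurable_seq_event pc).
- by move=> t; exact: AB.
Qed.

(** The center is moved to 0 one coordinate at a time; [cj j] has its first [j] entries already
    moved. *)
Lemma anderson_partial c N r :
  (Pb (partial_lt c N r) <= Pb (partial_lt (fun=> 0%R) N r))%E.
Proof.
pose cj j k : R := if (k < j)%N then 0 else c k.
have step j : (j < N)%N -> (Pb (partial_lt (cj j) N r) <= Pb (partial_lt (cj j.+1) N r))%E.
  move=> jN; pose F (x : seqsp R) : R :=
    \sum_(k < N | k != Ordinal jN) (w k * x k - cj j k) ^+ 2.
  have mF : measurable_fun setT F.
    rewrite /F; under eq_fun do rewrite big_mkcond/=.
    apply: measurable_sum => k; case: (k != _) => //.
    apply: measurable_funX; apply: measurable_funB => //.
    by apply: measurable_funM => //; exact: measurable_coord.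
  have Fj x y : F (set_coord x j y) = F x.
    apply: eq_bigr => k kj; rewrite /set_coord; case: eqP => // e.
    by move: kj; rewrite -val_eqE/= e eqxx.
  have nE (k : nat) A : measurable A -> std_normal R A = normal_prob 0 1 A by [].
  have cjE (k : 'I_N) : k != Ordinal jN -> cj j.+1 k = cj j k.
    rewrite -val_eqE/= /cj ltnS leq_eqVlt => /negbTE e.
    by have -> : (k == j :> nat) = false by [].
  have E0 x : partial_sqdist alpha (cj j) N x = (w j * x j - c j) ^+ 2 + F x.
    by rewrite /partial_sqdist (bigD1 (Ordinal jN))//= {1}/cj ltnn.
  have E1 x : partial_sqdist alpha (cj j.+1) N x = (w j * x j) ^+ 2 + F x.
    rewrite /partial_sqdist (bigD1 (Ordinal jN))//= {1}/cj ltnSn subr0; congr (_ + _).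
    by apply: eq_bigr => k kj; rewrite cjE.
  have := @anderson_coord _ _ _ _ _ _ ib nE j (w j) (c j) r F (weight_gt0 _ _) mF Fj.
  have -> : [set t | (w j * b j t - c j) ^+ 2 + F (seq_of b t) < r] =
      seq_of b @^-1` partial_lt (cj j) N r.
    by apply/seteqP; split => t; rewrite /partial_lt/= E0.
  have -> // : [set t | (w j * b j t) ^+ 2 + F (seq_of b t) < r] =
      seq_of b @^-1` partial_lt (cj j.+1) N r.
  by apply/seteqP; split => t; rewrite /partial_lt/= E1.
have ind j : (j <= N)%N -> (Pb (partial_lt c N r) <= Pb (partial_lt (cj j) N r))%E.
  elim: j => [|j IH] jN.
    have -> // : cj 0%N = c by apply/funext.
  by apply: le_trans (IH (ltnW jN)) (step j jN).
apply: le_trans (ind N (leqnn N)) _.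
suff -> : partial_lt (cj N) N r = partial_lt (fun=> 0) N r by [].
have E x : partial_sqdist alpha (cj N) N x = partial_sqdist alpha (fun=> 0) N x.
  by apply: eq_bigr => k _; rewrite /cj ltn_ord.
by apply/seteqP; split => x; rewrite /partial_lt/= E.
Qed.

Lemma partial_sqdist_le c N M x : (N <= M)%N ->
  partial_sqdist alpha c N x <= partial_sqdist alpha c M x.
Proof.
move=> NM; rewrite /partial_sqdist (big_ord_widen M (fun k => (w k * x k - c k) ^+ 2))//.
rewrite big_mkcond/=; apply: ler_sum => k _; case: ifP => // _; exact: sqr_ge0.
Qed.

(** The events decrease with [N], and strict inequalities for all partial sums give only a weak one
    for the whole sum; this accounts for the gap between [r] and [s]. *)
Lemma partial_lt_limit c r s (p : \bar R) : r < s ->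
  (forall N, p <= Pb (partial_lt c N r))%E -> (p <= Pb (sqdist_lt alpha c s))%E.
Proof.
move=> rs h.
have mI : measurable (\bigcap_N partial_lt c N r).
  by apply: bigcapT_measurable => N; exact: measurable_partial_lt.
apply: (@le_trans _ _ (Pb (\bigcap_N partial_lt c N r))); last first.
  apply: Pb_le => //; first exact: measurable_sqdist_lt.
  by move=> x hx; exists r => // N; apply: ltW; exact: hx.
have cv : (P \o (fun N => seq_of b @^-1` partial_lt c N r)) N @[N --> \oo] -->
    P (\bigcap_N (seq_of b @^-1` partial_lt c N r)).
  apply: nonincreasing_cvg_mu.
  - by rewrite ltey_eq fin_num_measure//; apply: (measurable_seq_event pc); exact: measurable_partial_lt.
  - by move=> N; apply: (measurable_seq_event pc); exact: measurable_partial_lt.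
  - by rewrite -preimage_bigcap; exact: (measurable_seq_event pc).
  - move=> N M NM; apply/subsetPset => t; rewrite /partial_lt/=; apply: le_lt_trans.
    exact: partial_sqdist_le.
rewrite preimage_bigcap; apply: (cvge_to_ge cv); exact: nearW.
Qed.

Lemma anderson c r s : r < s ->
  (Pb (sqdist_lt alpha c r) <= Pb (sqdist_lt alpha (fun=> 0%R) s))%E.
Proof.
move=> rs; apply: (partial_lt_limit rs) => N.
apply: le_trans (anderson_partial c N r).
apply: Pb_le; [exact: measurable_sqdist_lt|exact: measurable_partial_lt|].
by move=> x [t tr h]; exact: le_lt_trans (h N) tr.
Qed.

(** Left continuity of the mass in the squared radius; it closes the gap that [anderson] leaves
    between its two radii. *)
Lemma sqdist_lt_sup c s (p : \bar R) :
  (forall r, r < s -> (Pb (sqdist_lt alpha c r) <= p)%E) -> (Pb (sqdist_lt alpha c s) <= p)%E.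
Proof.
move=> h; pose A m := sqdist_lt alpha c (s - m.+1%:R^-1).
have AE : sqdist_lt alpha c s = \bigcup_m A m.
  apply/seteqP; split => x.
    move=> [t ts ht]; have [m hm] := ltr_add_invr ts.
    by exists m => //; exists t => //; rewrite ltrBrDr.
  move=> [m _ [t ht h']]; exists t => //; apply: (lt_trans ht).
  by rewrite gtrBl invr_gt0.
have mA m : measurable (A m) by exact: measurable_sqdist_lt.
have cv : (P \o (fun m => seq_of b @^-1` A m)) m @[m --> \oo] -->
    P (\bigcup_m (seq_of b @^-1` A m)).
  apply: nondecreasing_cvg_mu.
  - by move=> m; exact: (measurable_seq_event pc).
  - by rewrite -preimage_bigcup -AE; apply: (measurable_seq_event pc); exact: measurable_sqdist_lt.
  - move=> m m' mm; apply/subsetPset => t [v vm hv]; exists v => //.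
    apply: (lt_le_trans vm); rewrite lerD2l lerN2 lef_pV2 ?posrE ?ltr0n// ler_nat ltnS.
    exact: mm.
rewrite AE preimage_bigcup; apply: (cvge_to_le cv); apply: nearW => m /=.
by apply: h; rewrite gtrBl invr_gt0.
Qed.

End small_ball_bounds.

Section prior_ball_upper_bound.
Context d (Omega : measurableType d) (R : realType) (P : probability Omega R).
Variables (alpha : R) (Pi : probability (L2 R) R) (b : nat -> Omega -> R).
Hypothesis pc : prior_coordinates P alpha Pi b.
Implicit Types (c u x : nat -> R).
Local Notation w := (weight alpha).
Local Notation ib := (proj1 pc).
Local Notation Pb A := (P (seq_of b @^-1` A)).

(** On the ball recentered by the shift, the density is exp(- U - Z) with [Z] the linear form of the
    hypothesis, so a nonnegative [Z] yields the factor exp(- U). *)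
Lemma prior_ball_tilt c u N r :
  (forall x, sqdist_lt alpha (fun k => c k - finite_coef alpha u N k) r x ->
     0 <= \sum_(k < N) u k * x k) ->
  (Pb (sqdist_lt alpha c r) <= (expR (- ((\sum_(k < N) u k ^+ 2) / 2)))%:E *
   Pb (sqdist_lt alpha (fun k => c k - finite_coef alpha u N k)%R r))%E.
Proof.
set U := _ / 2; set g := fun k => _; set A := sqdist_lt alpha c r => pos.
set B := sqdist_lt alpha g r in pos *.
have mA : measurable A by exact: measurable_sqdist_lt.
have mB : measurable B by exact: measurable_sqdist_lt.
pose Z x := \sum_(k < N) u k * x k.
have mZ : measurable_fun setT (Z : seqsp R -> R).
  by apply: measurable_sum => k; apply: measurable_funM => //; exact: measurable_coord.
(* The exponential factor is chosen to cancel the Cameron-Martin density, so that the integral of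
   the shifted [Phi] is the mass of [A]. *)
pose Phi (x : seqsp R) : R := \1_A x * expR (U - Z x).
have mPhi : measurable_fun setT (fun x : seqsp R => (Phi x)%:E).
  apply/measurable_EFinP; apply: measurable_funM; first exact: measurable_indic.
  by apply: measurableT_comp => //; exact: measurable_funB.
have Phi0 x : (0 <= (Phi x)%:E)%E by rewrite lee_fin mulr_ge0// expR_ge0.
have e1 : (Pb A = \int[P]_t (Phi (shift_below N u (seq_of b t)))%:E)%E.
  rewrite (std_cameron_martin pc N u mPhi Phi0) (prob_indic pc mA).
  apply: eq_integral => t _; rewrite /Phi -EFinM -mulrA -expRD.
  by rewrite [X in expR X](_ : _ = 0) ?expR0 ?mulr1// /Z /U /seq_of; ring.
rewrite e1 (prob_indic pc mB) -ge0_integralZl//; last first.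
  by apply/measurable_EFinP; apply: measurable_indic; exact: (measurable_seq_event pc).
apply: ge0_le_integral => //.
- apply/measurable_EFinP; apply: (measurableT_comp (f := Phi)); first exact/measurable_EFinP.
  by apply: (measurableT_comp (measurable_shift_below N u)); exact: (measurable_seq_of ib).
- apply/measurable_EFinP; apply: measurable_funM => //; apply: measurable_indic.
  exact: (measurable_seq_event pc).
move=> t _; rewrite -EFinM lee_fin /Phi.
have -> : \1_A (shift_below N u (seq_of b t)) = \1_B (seq_of b t) :> R.
  by apply: indicE_shift; exact: sqdist_lt_shift.
rewrite mulrC indicE; case: (boolP (_ \in B)) => hB; last by rewrite !mulr0.
rewrite !mulr1 ler_expR.
have -> : Z (shift_below N u (seq_of b t)) = \sum_(k < N) u k * seq_of b t k + U *+ 2.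
  rewrite /U -mulr_natr mulfVK ?pnatr_eq0// -big_split/=; apply: eq_bigr => k _.
  by rewrite /shift_below ltn_ord; ring.
by have := pos (seq_of b t) (set_mem hB); rewrite -mulr_natr; lra.
Qed.

(** The number [m] is the Lagrange multiplier for the element of least Hilbert norm at squared
    distance [r] from [c]; the quotients are the coordinates of the residual. It exists by the
    intermediate value theorem. *)
Lemma shrinkage_exists c N (r : R) : 0 < r -> r < \sum_(k < N) c k ^+ 2 ->
  exists2 m, 0 <= m & \sum_(k < N) (c k / (1 + m * w k ^+ 2)) ^+ 2 = r.
Proof.
move=> r0 rc.
have w2 k : 0 < w k ^+ 2 by rewrite exprn_gt0// weight_gt0.
have pos (m : R) k : 0 <= m -> 0 < 1 + m * w k ^+ 2 by move=> m0; rewrite ltr_pwDl// mulr_ge0// ltW.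
(* The absolute value keeps the denominators positive on the whole line, where [G] is then
   continuous. *)
pose G (m : R) : R := \sum_(k < N) (c k / (1 + `|m| * w k ^+ 2)) ^+ 2.
pose S := \sum_(k < N) c k ^+ 2 / w k ^+ 2.
have S0 : 0 <= S by apply: sumr_ge0 => k _; rewrite divr_ge0// ?sqr_ge0// ltW.
(* Since (1 + M w^2)^2 >= M w^2, the residual at [M] is at most S / M, hence at most r. *)
pose M := S / r + 1.
have M0 : 0 < M by rewrite ltr_wpDl// divr_ge0// ltW.
have cG : continuous G.
  rewrite /G; elim: (N) => [|n IH] m.
    by under eq_fun do rewrite big_ord0; exact: cvg_cst.
  under eq_fun do rewrite big_ord_recr/=.
  apply: cvgD; first exact: IH.
  apply: (cvg_comp _ (fun y : R => y ^+ 2)); last exact: exprn_continuous.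
  apply: cvgM; first exact: cvg_cst.
  apply: cvgV; first by rewrite gt_eqF// pos.
  apply: cvgD; first exact: cvg_cst.
  apply: cvgM; last exact: cvg_cst.
  exact: norm_continuous.
have G0 : G 0 = \sum_(k < N) c k ^+ 2.
  by apply: eq_bigr => k _; rewrite normr0 mul0r addr0 divr1.
have GM : G M <= r.
  apply: (@le_trans _ _ (S / M)); last first.
    by rewrite ler_pdivrMr// /M mulrDr mulr1 mulrCA divff ?gt_eqF// mulr1 lerDl ltW.
  rewrite /S mulr_suml; apply: ler_sum => k _; rewrite gtr0_norm// expr_div_n -mulrA.
  rewrite ler_wpM2l ?sqr_ge0// -invfM lef_pV2 ?posrE ?mulr_gt0 ?exprn_gt0 ?pos ?(ltW M0) ?weight_gt0//.
  have := mulr_ge0 (ltW M0) (ltW (w2 k)); nra.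
have hr : Num.min (G 0) (G M) <= r <= Num.max (G 0) (G M).
  by rewrite ge_min le_max GM G0 (ltW rc) orbT.
have [m] := IVT (ltW M0) (continuous_subspaceT cG) hr.
rewrite in_itv/= => /andP[m0 _] Gm; exists m => //.
by rewrite -Gm; apply: eq_bigr => k _; rewrite ger0_norm.
Qed.

Lemma expandable0 : @expandable R (fun=> 0) /\ coef (fun=> 0 : R) = (fun=> 0).
Proof.
have [e0 c0] : @expandable R (fun=> 0) /\ forall k, coef (fun=> 0 : R) k = 0.
  apply: expandableP; first exact: sqi0.
  have -> : (fun n => l2norm ((fun=> 0) \- trig_sum (fun=> 0 : R) n)) = (fun=> 0).
    apply/funext => n; apply/eqP; rewrite -sqrf_eq0 l2norm_distC.
    have -> : trig_sum (fun=> 0) n \- (fun=> 0) = trig_sum (fun=> 0 : R) n.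
      by apply/funext => t /=; rewrite subr0.
    by rewrite l2norm_trig_sum big1// => k _; rewrite expr0n.
  exact: cvg_cst.
by split=> //; apply/funext.
Qed.

Lemma centered_prior_ball (z : R) : 0 < z ->
  Pi [set f : L2 R | l2norm f < z] = Pb (sqdist_lt alpha (fun=> 0) (z ^+ 2)).
Proof.
move=> z0.
have -> : [set f : L2 R | l2norm f < z] = [set f : L2 R | l2norm (f \- (fun=> 0)) < z].
  by apply/seteqP; split => f /=; have -> : f \- (fun=> 0) = f by apply/funext => t /=; rewrite subr0.
by rewrite (prior_ball pc)// ?expandable0.2//; exact: expandable0.1.
Qed.

(** The ball is shifted by the approximant of least cost. The residual center lies at the boundary
    of the admissible set, so the shifted ball stays in the half-space where the tilt is favorable,
    and Anderson's inequality then moves its center to 0. *)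
Lemma prior_ball_le (f0 : L2 R) (z : R) : expandable f0 -> 0 < z ->
  (Pi [set f : L2 R | l2norm (f \- f0) < z]%R <=
   (expR (- (approx_cost alpha f0 z / 2)))%:E * Pi [set f : L2 R | l2norm f < z]%R)%E.
Proof.
move=> ef0 z0; set I := approx_cost alpha f0 z.
rewrite (centered_prior_ball z0) (prior_ball pc)//.
set c := coef f0.
apply: (sqdist_lt_sup pc) => r rz.
have [r0|r0] := leP r 0.
  have -> : seq_of b @^-1` sqdist_lt alpha c r = set0.
    apply/seteqP; split => t // -[s sr /(_ 0%N)].
    by rewrite /partial_sqdist big_ord0 => s0; have := lt_le_trans sr r0; rewrite ltNge s0.
  by rewrite measure0 mule_ge0// lee_fin expR_ge0.
(* The gap between [r] and z^2 pays for the energy of [f0] beyond the truncation level. *)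
have zr : 0 < z ^+ 2 - r by rewrite subr_gt0.
have [N0 hN0] := l2norm_tail ef0 zr.
have tailN := hN0 N0 (leqnn N0).
set N := N0 in tailN.
(* Shifting the coordinates k < N by h = m lam g with g = c / (1 + m lam) leaves
   the ball centered at g, on which <h, x>_H = m <g, x> is nonnegative. *)
have [u [cost tilt]] : exists u, I <= \sum_(k < N) u k ^+ 2 /\
    forall x, sqdist_lt alpha (fun k => c k - finite_coef alpha u N k) r x ->
     0 <= \sum_(k < N) u k * x k.
  have costP u rho : \sum_(k < N) (c k - w k * u k) ^+ 2 <= rho -> rho <= r ->
      I <= \sum_(k < N) u k ^+ 2.
    move=> hr rr; apply: approx_cost_le.
    have hw := expandable_trig_sum (fun k => w k * u k) N.
    rewrite l2norm_distC -(@ltr_pXn2r _ 2)// ?nnegrE ?l2norm_ge0 ?(ltW z0)//.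
    apply: (@le_lt_trans _ _ (rho + (l2norm f0 ^+ 2 - \sum_(k < N) c k ^+ 2))); last by rewrite /c; lra.
    apply: l2norm_sqr_le => [|M]; first exact: expandableB.
    have hM : \sum_(k < M) coef (f0 \- trig_sum (fun k => w k * u k) N) k ^+ 2 <=
      \sum_(k < M + N) coef (f0 \- trig_sum (fun k => w k * u k) N) k ^+ 2.
      rewrite (big_ord_widen (M + N) (fun k => coef (f0 \- trig_sum (fun k => w k * u k) N) k ^+ 2)) ?leq_addr//.
      by rewrite big_mkcond/=; apply: ler_sum => k _; case: ifP => // _; exact: sqr_ge0.
    apply: (le_trans hM); have cM := sum_coef_le (M + N) ef0.1.
    move: cM; rewrite addnC !big_split_ord/=.
    have -> : \sum_(i < N) coef (f0 \- trig_sum (fun k => w k * u k) N) (lshift M i) ^+ 2 =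
        \sum_(k < N) (c k - w k * u k) ^+ 2.
      apply: eq_bigr => k _; rewrite trig_coefB ?coef_trig_sum//=; last exact: sqi_trig_sum.
        by rewrite ltn_ord.
      exact: ef0.1.
    have -> : \sum_(i < M) coef (f0 \- trig_sum (fun k => w k * u k) N) (rshift N i) ^+ 2 =
        \sum_(i < M) c (rshift N i) ^+ 2.
      apply: eq_bigr => k _; rewrite trig_coefB ?coef_trig_sum//=; last exact: sqi_trig_sum.
        by rewrite ltnNge leq_addr subr0.
      exact: ef0.1.
    by rewrite -/c; lra.
  have [rc|rc] := ltP r (\sum_(k < N) c k ^+ 2); last first.
    exists (fun=> 0); split.
      apply: (costP (fun=> 0) (\sum_(k < N) c k ^+ 2)) => //.
      by apply: ler_sum => k _; rewrite mulr0 subr0.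
    by move=> x _; rewrite big1// => k _; rewrite mul0r.
  have [m m0 mr] := shrinkage_exists r0 rc.
  pose g k := c k / (1 + m * w k ^+ 2).
  have pos k : 0 < 1 + m * w k ^+ 2.
    by rewrite ltr_pwDl// mulr_ge0// exprn_ge0// ltW// weight_gt0.
  have gE k : c k - w k * (m * w k * g k) = g k.
    by rewrite /g; field; rewrite gt_eqF.
  exists (fun k => m * w k * g k); split.
    apply: (costP (fun k => m * w k * g k) r) => //.
    by rewrite -[leRHS]mr; apply: ler_sum => k _; rewrite gE.
  move=> x [s sr /(_ N)]; rewrite /partial_sqdist => hs.
  have hs' : \sum_(k < N) (w k * x k - g k) ^+ 2 <= s.
    apply: le_trans hs; apply: ler_sum => k _.
    by rewrite /finite_coef ltn_ord gE.
  have -> : \sum_(k < N) m * w k * g k * x k = m * \sum_(k < N) g k * (w k * x k).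
    by rewrite mulr_sumr; apply: eq_bigr => k _; ring.
  apply: mulr_ge0 => //.
  (* As |g|^2 = r, a point y = w x with |y - g|^2 <= s < r satisfies 2 <g, y> >= |y|^2 + r - s >=
     0. *)
  have E : \sum_(k < N) (w k * x k - g k) ^+ 2 =
      \sum_(k < N) (w k * x k) ^+ 2 - (\sum_(k < N) g k * (w k * x k)) *+ 2 + r.
    rewrite -mr -sumrMnl -sumrB -big_split/=; apply: eq_bigr => k _.
    by rewrite sqrrB (mulrC (w k * x k)).
  have : 0 <= \sum_(k < N) (w k * x k) ^+ 2 by apply: sumr_ge0 => k _; exact: sqr_ge0.
  by move: hs'; rewrite E -mulr_natr; lra.
apply: le_trans (prior_ball_tilt tilt) _.
apply: lee_pmul => //.
- by rewrite lee_fin ler_expR; lra.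
- exact: (anderson pc).
Qed.

End prior_ball_upper_bound.

(** * Laplace transforms: small balls and high frequencies *)

Section gaussian_series.
Context d (Omega : measurableType d) (R : realType) (P : probability Omega R).
Variables (alpha : R) (Pi : probability (L2 R) R) (b : nat -> Omega -> R).
Hypothesis pc : prior_coordinates P alpha Pi b.
Implicit Types (c u x : nat -> R) (N : nat) (r s t n V : R).
Local Notation w := (weight alpha).
Local Notation ib := (proj1 pc).
Local Notation Pb A := (P (seq_of b @^-1` A)).

(** The log-determinant of I + t times the covariance of the first [N] coordinates, that is, -2
    times the logarithm of the Laplace transform of their squared norm at t / 2. *)
Definition log_complexity (t : R) N : R := \sum_(k < N) ln (1 + t * w k ^+ 2).

Lemma weight_sqr_gt0 k : 0 < w k ^+ 2.
Proof. by rewrite exprn_gt0// weight_gt0. Qed.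

Lemma partial_laplace t N : 0 <= t ->
  (\int[P]_z (expR (- (t / 2 * partial_sqdist alpha (fun=> 0%R) N (seq_of b z))))%:E =
   (expR (- (log_complexity t N / 2)))%:E)%E.
Proof.
move=> t0; pose c k := t * w k ^+ 2.
have c0 k : 0 < 1 + c k by rewrite ltr_pwDl// mulr_ge0// ltW// weight_sqr_gt0.
transitivity (\int[P]_z (expR (- (\sum_(k < N) c k / 2 * b k z ^+ 2)))%:E)%E.
  apply: eq_integral => z _; congr (expR (- _))%:E.
  rewrite mulr_sumr; apply: eq_bigr => k _.
  by rewrite subr0 exprMn /c /seq_of; ring.
have c1 k : (k < N)%N -> -1 < c k by move=> _; have := c0 k; lra.
rewrite (gaussian_expR_sqr ib (fun k A _ => erefl) c1); congr EFin.
rewrite /log_complexity mulr_suml -sumrN expR_sum; apply: eq_bigr => k _.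
apply/eqP; rewrite -(@eqrXn2 _ 2)// ?invr_ge0 ?sqrtr_ge0 ?expR_ge0//.
rewrite exprVn sqr_sqrtr ?(ltW (c0 k))// -expRM_natl mulr2n; apply/eqP.
rewrite [X in expR X](_ : _ = - ln (1 + c k)); last by rewrite -/(c k) mulrN mulrCA divff ?mulr1 ?pnatr_eq0.
by rewrite expRN lnK// posrE.
Qed.

Lemma chernoff_sqdist r t N : 0 <= t ->
  (Pb (sqdist_lt alpha (fun=> 0%R) r) <= (expR ((t * r - log_complexity t N) / 2))%:E)%E.
Proof.
move=> t0; have mA : measurable (sqdist_lt alpha (fun=> 0) r) by exact: measurable_sqdist_lt.
pose E z := expR (- (t / 2 * partial_sqdist alpha (fun=> 0) N (seq_of b z))).
have mE : measurable_fun setT (EFin \o E).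
  apply/measurable_EFinP; apply: measurableT_comp => //; apply: measurableT_comp => //.
  apply: measurable_funM => //.
  exact: (measurableT_comp (measurable_partial_sqdist alpha _ _) (measurable_seq_of ib)).
rewrite (prob_indic pc mA) mulrBl expRD EFinM -(partial_laplace N t0) -ge0_integralZl//.
apply: ge0_le_integral => //.
- exact: (measurableT_comp (measurable_indicE mA) (measurable_seq_of ib)).
- by apply: emeasurable_funM => //; exact: measurable_cst.
move=> z _; rewrite /= -EFinM lee_fin /E indicE.
have [/set_mem[s sr h]|_] := boolP (_ \in _); last by rewrite mulr_ge0 ?expR_ge0.
rewrite -expRD -[leLHS]expR0 ler_expR.
have := ler_wpM2l t0 (le_trans (h N) (ltW sr)); lra.
Qed.

(** Converse of Chernoff: the Laplace transform is at least exp(- V / 2), while points with squared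
    norm above 2 V / t contribute at most exp(- V). The rest is at least exp(- V) because exp(- V /
    2) <= 1 / 2. *)
Lemma small_ball_ge t V r : 0 <= t -> 2 <= V -> (forall N, log_complexity t N <= V) ->
  2 * V < t * r -> ((expR (- V))%:E <= Pb (sqdist_lt alpha (fun=> 0%R) r))%E.
Proof.
move=> t0 V2 hV tr.
have tp : 0 < t by rewrite lt0r t0 andbT; apply/eqP => t00; move: tr; rewrite t00; lra.
pose s := 2 * V / t.
have ts : t * s = 2 * V by rewrite /s mulrC divfK// gt_eqF.
have sr : s < r by rewrite /s ltr_pdivrMr// (mulrC r).
apply: (partial_lt_limit pc sr) => N.
have mA : measurable (partial_lt alpha (fun=> 0) N s) by exact: measurable_partial_lt.
pose E z := expR (- (t / 2 * partial_sqdist alpha (fun=> 0) N (seq_of b z))).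
have mE : measurable_fun setT (EFin \o E).
  apply/measurable_EFinP; apply: measurableT_comp => //; apply: measurableT_comp => //.
  apply: measurable_funM => //.
  exact: (measurableT_comp (measurable_partial_sqdist alpha _ _) (measurable_seq_of ib)).
have h : (\int[P]_z (EFin \o E) z <= Pb (partial_lt alpha (fun=> 0%R) N s) + (expR (- V))%:E)%E.
  rewrite (prob_indic pc mA) -[X in (_ + X)%E]mule1 -(@probability_setT _ _ _ P).
  rewrite -integral_cst//.
  have mi : measurable_fun setT (fun z => (\1_(partial_lt alpha (fun=> 0) N s) (seq_of b z) : R)%:E).
    exact: (measurableT_comp (measurable_indicE mA) (measurable_seq_of ib)).
  rewrite -ge0_integralD//; last by move=> z _; rewrite lee_fin expR_ge0.
  apply: ge0_le_integral => //.
  - by move=> z _; rewrite /= lee_fin expR_ge0.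
  - by apply: emeasurable_funD => //; exact: measurable_cst.
  move=> z _; rewrite /= -EFinD lee_fin /E indicE.
  have [_|hn] := boolP (_ \in _).
    rewrite ler_wpDr ?expR_ge0// -[leRHS]expR0 ler_expR oppr_le0 mulr_ge0 ?divr_ge0//.
    by apply: sumr_ge0 => k _; exact: sqr_ge0.
  rewrite add0r ler_expR lerN2.
  have hs : s <= partial_sqdist alpha (fun=> 0) N (seq_of b z).
    by rewrite leNgt; apply: contra hn => hs; exact/mem_set.
  have := ler_wpM2l t0 hs; lra.
have fA : Pb (partial_lt alpha (fun=> 0) N s) \is a fin_num.
  by apply: fin_num_measure; exact: (measurable_seq_event pc).
move: h; rewrite (partial_laplace N t0) -(fineK fA) -EFinD !lee_fin.
have hN := hV N.
have e1 : expR (- (V / 2)) <= expR (- (log_complexity t N / 2)) by rewrite ler_expR; lra.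
have e2 : expR (- V) = expR (- (V / 2)) ^+ 2 by rewrite -expRM_natl; congr expR; lra.
have e3 : expR (- (V / 2)) <= 2^-1.
  rewrite expRN lef_pV2 ?posrE ?expR_gt0//.
  by apply: le_trans (expR_ge1Dx _); lra.
rewrite e2; have := expR_gt0 (- (V / 2)); nra.
Qed.

Definition tail_gt J r : set (seqsp R) :=
  [set x : seqsp R | exists N, r < \sum_(k < N | (J <= k)%N) (w k * x k) ^+ 2].

Lemma measurable_tail_sum J N : measurable_fun setT
  (fun x : seqsp R => \sum_(k < N | (J <= k)%N) (w k * x k) ^+ 2).
Proof.
have -> : (fun x : seqsp R => \sum_(k < N | (J <= k)%N) (w k * x k) ^+ 2) =
    (fun x => \sum_(k < N) (if (J <= k)%N then (w k * x k) ^+ 2 else 0)).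
  by apply/funext => x; rewrite big_mkcond.
apply: measurable_sum => k; case: (J <= k)%N => //.
by apply: measurable_funX; apply: measurable_funM => //; exact: measurable_coord.
Qed.

Lemma tail_gtE J r : tail_gt J r =
  \bigcup_N [set x : seqsp R | r < \sum_(k < N | (J <= k)%N) (w k * x k) ^+ 2].
Proof. by apply/seteqP; split => x; [move=> [N h]; exists N | move=> [N _ h]; exists N]. Qed.

Lemma measurable_tail_gt J r : measurable (tail_gt J r).
Proof.
rewrite tail_gtE; apply: bigcupT_measurable => N; apply: measurable_gt_set.
exact: measurable_tail_sum.
Qed.

(** Markov's inequality for exp(n S / 4) with [S] the tail energy. The bound n w^2 <= 1 keeps the
    exponential moment of each squared normal finite and of size at most exp(n w^2 / 2). *)
Lemma tail_bound J r n V : 0 <= n -> (forall k, (J <= k)%N -> n * w k ^+ 2 <= 1) ->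
  (forall N, n * \sum_(k < N | (J <= k)%N) w k ^+ 2 <= V) ->
  (Pb (tail_gt J r) <= (expR (V / 2 - n * r / 4))%:E)%E.
Proof.
move=> n0 hJ hV; pose S N (x : nat -> R) := \sum_(k < N | (J <= k)%N) (w k * x k) ^+ 2.
have mS N : measurable_fun setT (S N : seqsp R -> R) by exact: measurable_tail_sum.
pose A N := [set x : seqsp R | r < S N x].
have mA N : measurable (A N) by exact: measurable_gt_set.
have cv : (P \o (fun m => seq_of b @^-1` A m)) m @[m --> \oo] -->
    P (\bigcup_m (seq_of b @^-1` A m)).
  apply: nondecreasing_cvg_mu.
  - by move=> m; exact: (measurable_seq_event pc).
  - rewrite -preimage_bigcup -tail_gtE; apply: (measurable_seq_event pc).
    exact: measurable_tail_gt.
  - move=> m m' mm; apply/subsetPset => t; rewrite /A/= => /lt_le_trans; apply.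
    rewrite /S big_mkcond [leRHS]big_mkcond/=.
    rewrite (big_ord_widen m' (fun k => if (J <= k)%N then (w k * seq_of b t k) ^+ 2 else 0))//.
    rewrite big_mkcond/=; apply: ler_sum => k _; case: ifP => // _.
    by case: ifP => // _; exact: sqr_ge0.
rewrite tail_gtE preimage_bigcup; apply: (cvge_to_le cv); apply: nearW => N /=.
pose c k := if (J <= k)%N then - (n / 2 * w k ^+ 2) else 0.
have hc k : 0 < 1 + c k /\ (Num.sqrt (1 + c k))^-1 <=
    expR (if (J <= k)%N then n * w k ^+ 2 / 2 else 0).
  rewrite /c; case: ifP => [/hJ h|_]; last by rewrite addr0 sqrtr1 invr1 expR0.
  have hw := mulr_ge0 n0 (ltW (weight_sqr_gt0 k)).
  have p : 0 < 1 - n / 2 * w k ^+ 2 by lra.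
  split=> //; rewrite -(@ler_pXn2r _ 2)// ?nnegrE ?invr_ge0 ?sqrtr_ge0 ?expR_ge0//.
  rewrite exprVn sqr_sqrtr ?(ltW p)// -expRM_natl -[leLHS]mul1r ler_pdivrMr// mulrC.
  (* With u = n w^2 in [0, 1] this is 1 <= (1 - u / 2)(1 + u), followed by 1 + u <= exp u. *)
  apply: (@le_trans _ _ ((1 - n / 2 * w k ^+ 2) * (1 + n * w k ^+ 2))); first nra.
  rewrite ler_wpM2l ?(ltW p)//; apply: le_trans (expR_ge1Dx _) _.
  by rewrite (mulrCA 2) divff ?mulr1// pnatr_eq0.
have c1 k : (k < N)%N -> -1 < c k by move=> _; have := (hc k).1; lra.
pose E z := expR (n / 4 * S N (seq_of b z)).
have mE : measurable_fun setT (EFin \o E).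
  apply/measurable_EFinP; apply: measurableT_comp => //.
  apply: measurable_funM => //.
  exact: (measurableT_comp (mS N) (measurable_seq_of ib)).
have hE : (\int[P]_z (EFin \o E) z <= (expR (V / 2))%:E)%E.
  have -> : (\int[P]_z (EFin \o E) z = \int[P]_z (expR (- (\sum_(k < N) c k / 2 * b k z ^+ 2)))%:E)%E.
    apply: eq_integral => z _; rewrite /= /E; congr (expR _)%:E.
    rewrite /S big_mkcond mulr_sumr -sumrN; apply: eq_bigr => k _; rewrite /c.
    by case: ifP => _; [rewrite exprMn /seq_of; field|rewrite !mul0r mulr0 oppr0].
  rewrite (gaussian_expR_sqr ib (fun k A _ => erefl) c1) lee_fin.
  apply: (@le_trans _ _ (\prod_(k < N) expR (if (J <= k)%N then n * w k ^+ 2 / 2 else 0))).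
    apply: ler_prod => k _; rewrite (hc k).2 andbT invr_ge0; exact: sqrtr_ge0.
  rewrite -expR_sum ler_expR -big_mkcond/= -mulr_suml -mulr_sumr.
  by have := hV N; lra.
rewrite (prob_indic pc (mA N)) addrC expRD EFinM.
apply: (@le_trans _ _ ((expR (- (n * r / 4)))%:E * \int[P]_z (EFin \o E) z)%E); last first.
  by apply: lee_wpmul2l => //; rewrite lee_fin expR_ge0.
rewrite -ge0_integralZl//.
apply: ge0_le_integral => //.
- exact: (measurableT_comp (measurable_indicE (mA N)) (measurable_seq_of ib)).
- by apply: emeasurable_funM => //; exact: measurable_cst.
move=> z _; rewrite /= -EFinM lee_fin /E indicE.
have [/set_mem h|_] := boolP (_ \in _); last by rewrite mulr_ge0 ?expR_ge0.
rewrite -expRD -[leLHS]expR0 ler_expR.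
have := ler_wpM2l n0 (ltW h); lra.
by move=> z _; rewrite /= lee_fin expR_ge0.
Qed.

End gaussian_series.

(** * Time grids and Brownian increments *)

Section time_grid.
Variable R : realType.
Local Notation mu := (@lebesgue_measure R).
Implicit Types (f g : R -> R) (s t : R) (tau : nat -> R).

(** The data at time [t] see the signal through its inner product with this indicator. *)
Definition up_to (t : R) : R -> R := \1_(`[0, t]%classic).

Lemma sqi_up_to t : square_integrable (up_to t).
Proof.
apply: (@sqi_bounded _ _ 1); first exact: measurable_indic.
by move=> x; rewrite /up_to indicE; case: (_ \in _); rewrite /= ?normr1 ?normr0.
Qed.

Lemma inner_up_to f t : square_integrable f -> 0 <= t <= 1 ->
  \int[mu]_(x in `[0, t]) f x = inner f (up_to t).
Proof.
move=> hf /andP[t0 t1]; have mf := sqi_measurable hf.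
rewrite /inner Rintegral_leb01T; last first.
  by apply: measurable_funM => //; exact: measurable_indic.
have -> : (\int[mu]_(x in `[0, 1]) (f x * up_to t x) = \int[mu]_(x in `[0, 1] `&` `[0, t]) f x)%R.
  by rewrite [RHS]Rintegral_mkcondr; apply: eq_Rintegral => x _; rewrite patch_indic.
congr (\int[mu]_(x in _) f x)%R; apply/seteqP; split => x /=; rewrite !in_itv/=; last by case.
move=> /andP[x0 xt]; split; rewrite ?x0//=; exact: le_trans t1.
Qed.

Lemma inner_up_to_up_to s t : 0 <= s -> s <= 1 -> 0 <= t -> t <= 1 -> s <= t ->
  inner (up_to s) (up_to t) = s.
Proof.
move=> s0 s1 t0 t1 st; rewrite -inner_up_to ?t0 ?t1//; last exact: sqi_up_to.
rewrite Rintegral_mkcond.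
have -> : up_to s \_ `[0, t] = (cst (1 : R)) \_ `[0, s].
  rewrite !patch_indic; apply/funext => x /=; rewrite /up_to !indicE mul1r.
  case: (boolP (x \in `[0, s]%classic)) => [|_]; last by rewrite mul0r.
  rewrite inE/= in_itv/= => /andP[x0 xs].
  by rewrite mul1r mem_set//= in_itv/= x0 (le_trans xs st).
rewrite -Rintegral_mkcond Rintegral_cst//= mul1r lebesgue_measure_itv/= lte_fin.
by case: ltP => /= h; [rewrite oppr0 addr0|apply/eqP; rewrite eq_le s0 h].
Qed.

(** Times form an infinite nondecreasing sequence, as in the independence clause of Brownian motion.
    Only the first [N] steps must be strict, so a finite grid can be continued by a constant. *)
Record grid tau N : Prop := Grid {
  grid0 : tau 0%N = 0;
  grid01 : forall i, 0 <= tau i <= 1;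
  grid_le : forall i, tau i <= tau i.+1;
  grid_lt : forall i, (i < N)%N -> tau i < tau i.+1 }.

Definition box tau i : R -> R := up_to (tau i.+1) \- up_to (tau i).

Lemma sqi_box tau i : square_integrable (box tau i).
Proof. by apply: sqiB; exact: sqi_up_to. Qed.

Lemma grid_mono tau N : grid tau N -> {homo tau : i j / (i <= j)%N >-> i <= j}.
Proof. by move=> g; apply: homo_leq => //; [exact: le_trans|exact: grid_le g]. Qed.

Lemma inner_box tau N i j : grid tau N ->
  inner (box tau i) (box tau j) = if i == j then tau i.+1 - tau i else 0.
Proof.
move=> g; have u k : 0 <= tau k /\ tau k <= 1 by have /andP[] := grid01 g k.
have I k l : (k <= l)%N -> inner (up_to (tau k)) (up_to (tau l)) = tau k.
  by move=> kl; apply: inner_up_to_up_to; rewrite ?(u _).1 ?(u _).2//; exact: (grid_mono g).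
have sq k := sqi_up_to (tau k).
have main k l : (k < l)%N -> inner (box tau k) (box tau l) = 0.
  move=> kl; rewrite innerBl//; last exact: sqi_box.
  rewrite ![inner _ (box tau l)]innerC !innerBl// !(innerC (up_to (tau l.+1))) !(innerC (up_to (tau l))).
  by rewrite (I k.+1 l.+1 (leqW kl)) (I k.+1 l kl) (I k l.+1 (leqW (ltnW kl))) (I k l (ltnW kl)); ring.
case: ltngtP => [ij|ji|->]; first exact: main.
  by rewrite innerC main.
rewrite innerBl//; last exact: sqi_box.
rewrite ![inner _ (box tau j)]innerC !innerBl//.
rewrite (innerC (up_to (tau j.+1)) (up_to (tau j))) !I//; ring.
Qed.

(** Bessel's inequality for the orthogonal boxes: no grid can tell two signals apart better than
    their L^2 distance allows. *)
Lemma box_bessel tau N g : grid tau N -> square_integrable g ->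
  \sum_(i < N) inner g (box tau i) ^+ 2 / (tau i.+1 - tau i) <= l2norm g ^+ 2.
Proof.
move=> gr hg; pose c i := inner g (box tau i) / (tau i.+1 - tau i).
pose S x := \sum_(i < N) c i * box tau i x.
have hS : square_integrable S.
  by apply: (@sqi_sum _ _ (index_enum 'I_N) (fun i x => c i * box tau i x)) => i; apply: sqiZ; exact: sqi_box.
set D := \sum_(i < N) _.
have d0 (i : 'I_N) : tau i.+1 - tau i != 0 by rewrite subr_eq0 gt_eqF// (grid_lt gr).
have lin h : square_integrable h -> inner S h = \sum_(i < N) c i * inner (box tau i) h.
  move=> hh; rewrite /S (@inner_suml _ _ (index_enum 'I_N) (fun i x => c i * box tau i x))//.
    by apply: eq_bigr => i _; rewrite innerZl//; exact: sqi_box.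
  by move=> i; apply: sqiZ; exact: sqi_box.
have e1 : inner g S = D.
  rewrite innerC lin//; apply: eq_bigr => i _; rewrite innerC /c; ring.
have e2 : inner S S = D.
  rewrite lin//; apply: eq_bigr => i _.
  rewrite innerC lin; last exact: sqi_box.
  rewrite (bigD1 i)//= (inner_box _ _ gr) eqxx big1 ?addr0; last first.
    by move=> j ji; rewrite (inner_box _ _ gr) (negbTE ji : (j == i :> nat) = false) mulr0.
  by rewrite /c; field; exact: d0.
have hgS := sqiB hg hS; have := inner_ge0 (g \- S).
rewrite l2norm_sqr// innerBl// !(innerC _ (g \- S)) !innerBl// (innerC S g) e1 e2; lra.
Qed.

End time_grid.

Section brownian_increments.
Context d (T : measurableType d) (R : realType) (P : probability T R).
Variable W : R -> {RV P >-> R}.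
Hypothesis BM : brownian_motion W.
Implicit Types (f g : R -> R) (tau : nat -> R).

Definition incr tau (i : nat) (w : T) : R := W (tau i.+1) w - W (tau i) w.

Lemma measurable_incr tau i : measurable_fun setT (incr tau i).
Proof. by apply: measurable_funB => //; exact: measurable_funP. Qed.

Lemma increments_law tau N : grid tau N -> exists nu : nat -> probability (measurableTypeR R) R,
  independent_with_laws P (incr tau) nu /\
  forall k, (k < N)%N -> forall A, measurable A ->
    nu k A = normal_prob 0 (Num.sqrt (tau k.+1 - tau k)) A.
Proof.
move=> g; have [_ hi hn _] := BM.
pose mi k : {mfun T >-> measurableTypeR R} :=
  HB.pack (incr tau k) (isMeasurableFun.Build _ _ T (measurableTypeR R) (incr tau k) (measurable_incr tau k)).
pose nu k : probability (measurableTypeR R) R := distribution P (mi k).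
exists nu; split; last first.
  move=> k kN A mA; rewrite /nu/= /distribution /pushforward/=.
  have /andP[t0 _] := grid01 g k; have /andP[_ t1] := grid01 g k.+1.
  by apply: hn => //; exact: grid_lt g _ kN.
apply: mutually_independent_with_laws => //.
- by move=> k; exact: measurable_incr.
- by apply: hi => i; [exact: grid01 g i|exact: grid_le g i].
Qed.

End brownian_increments.

(** * Comparison of the laws of the data under two signals *)

Section change_of_signal.
Context d (T : measurableType d) (R : realType) (P : probability T R).
Variable W : R -> {RV P >-> R}.
Hypothesis BM : brownian_motion W.
Variable n : nat.
Hypothesis n_gt0 : (0 < n)%N.
Implicit Types (f g : R -> R) (tau : nat -> R).
Local Notation X f := (white_noise W n f).
Local Notation sn := (Num.sqrt (n%:R : R)).

Lemma sqrtn_gt0 : 0 < sn. Proof. by rewrite sqrtr_gt0 ltr0n. Qed.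

Lemma white_noiseE f t w : square_integrable f -> 0 <= t <= 1 ->
  X f w t = inner f (up_to t) + W t w / sn.
Proof. by move=> hf t01; rewrite /white_noise inner_up_to. Qed.

Lemma measurable_white_noise f : measurable_fun setT (X f).
Proof.
apply: (@measurability _ _ _ (trajectory R) setT (X f) (@cylinder R)) => //.
move=> _ [A [t [B [t01 mB ->]]] <-]; rewrite setTI.
have mf : measurable_fun setT (fun w => X f w t : measurableTypeR R).
  by apply: measurable_funD => //; apply: measurable_funM => //; exact: measurable_funP.
by have := mf measurableT B mB; rewrite setTI.
Qed.

Lemma white_noise_incr tau N f i w : grid tau N -> square_integrable f ->
  X f w (tau i.+1) - X f w (tau i) = inner f (box tau i) + incr W tau i w / sn.
Proof.
move=> g hf; rewrite !white_noiseE//; [|exact: grid01 g _..].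
rewrite (innerC f (box tau i)) innerBl//; [|exact: sqi_up_to..].
by rewrite !(innerC f) /incr; ring.
Qed.

Definition increments tau N (x : R -> R) : seqsp R :=
  fun i => if (i < N)%N then x (tau i.+1) - x (tau i) else 0.

Definition shifted_increments tau N f (y : seqsp R) : seqsp R :=
  fun i => if (i < N)%N then inner f (box tau i) + y i / sn else 0.

Lemma measurable_shifted_increments tau N f :
  measurable_fun setT (shifted_increments tau N f).
Proof.
apply: measurable_fun_seqsp => i; rewrite /shifted_increments.
case: (i < N)%N => //; apply: measurable_funD => //; apply: measurable_funM => //.
exact: measurable_coord.
Qed.

Lemma increments_white_noise tau N f w : grid tau N -> square_integrable f ->
  increments tau N (X f w) = shifted_increments tau N f (seq_of (incr W tau) w).
Proof.
move=> g hf; apply/funext => i; rewrite /increments /shifted_increments.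
by case: (i < N)%N => //; rewrite (white_noise_incr _ _ g).
Qed.

(** With v = y exp(z / 3) this is v^3 / 4 + 3 / (4 v) >= 1. It is the pointwise form of Hölder's
    inequality with exponents 4 and 4 / 3; the free parameter [y] is optimized in
    [change_of_signal]. *)
Lemma young_tilt (y z : R) : 0 < y ->
  1 <= y ^+ 3 / 4 * expR z + 3 / (4 * y) * expR (- (z / 3)).
Proof.
move=> y0; pose v := y * expR (z / 3).
have v0 : 0 < v by rewrite mulr_gt0// expR_gt0.
have -> : y ^+ 3 / 4 * expR z = v ^+ 3 / 4.
  have -> : expR z = expR (z / 3) ^+ 3 by rewrite -expRM_natl; congr expR; field.
  by rewrite /v exprMn; ring.
have -> : 3 / (4 * y) * expR (- (z / 3)) = 3 / (4 * v).
  by rewrite expRN /v; field; rewrite gt_eqF ?expR_gt0//= gt_eqF.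
rewrite -subr_ge0.
have -> : v ^+ 3 / 4 + 3 / (4 * v) - 1 = (v - 1) ^+ 2 * ((v + 1) ^+ 2 + 2) / (4 * v).
  by field; rewrite gt_eqF.
apply: divr_ge0; last by rewrite mulr_ge0// ltW.
by apply: mulr_ge0; [exact: sqr_ge0|apply: addr_ge0 => //; exact: sqr_ge0].
Qed.

(** The increments under [f] are those under [f0] after a shift of the Brownian increments, so their
    density is an explicit exp(Z); [young_tilt] is integrated against it. *)
Lemma grid_change tau N (C : set (seqsp R)) f f0 (y : R) : grid tau N ->
  square_integrable f -> square_integrable f0 -> measurable C -> 0 < y ->
  (P [set w | C (increments tau N (X f0 w))] <=
   (y ^+ 3 / 4)%:E * P [set w | C (increments tau N (X f w))] +
   (3 / (4 * y) * expR (2 / 9 * (n%:R * l2norm (f \- f0) ^+ 2)))%:E)%E.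
Proof.
move=> g hf hf0 mC y0.
have [nu [ib nuE]] := increments_law BM g.
pose b := incr W tau.
pose Phi h (x : seqsp R) : R := \1_C (shifted_increments tau N h x).
have mPhi h : measurable_fun setT (fun x => (Phi h x)%:E).
  exact: (measurableT_comp (measurable_indicE mC) (measurable_shifted_increments tau N h)).
have PE h : square_integrable h ->
    P [set w | C (increments tau N (X h w))] = (\int[P]_w (Phi h (seq_of b w))%:E)%E.
  move=> hh.
  have -> : [set w | C (increments tau N (X h w))] =
      (shifted_increments tau N h \o seq_of b) @^-1` C.
    by apply/seteqP; split => w /=; rewrite (increments_white_noise w g hh).
  rewrite measure_integral_indic//.
  have := measurableT_comp (measurable_shifted_increments tau N h) (measurable_seq_of ib).
  by move=> /(_ measurableT C mC); rewrite setTI.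
pose D k := tau k.+1 - tau k.
have D0 k : (k < N)%N -> 0 < D k by move=> kN; rewrite subr_gt0 (grid_lt g).
pose s k := Num.sqrt (D k).
have s0 k : (k < N)%N -> s k != 0 by move=> kN; rewrite gt_eqF// sqrtr_gt0 D0.
have s2 k : (k < N)%N -> s k ^+ 2 = D k by move=> kN; rewrite sqr_sqrtr// ltW// D0.
(* The factor sqrt n undoes the noise level: adding [h] to the Brownian increments turns data of
   [f0] into data of [f]. *)
pose h k := sn * inner (f \- f0) (box tau k).
pose Z w := \sum_(k < N) (h k / s k ^+ 2 * b k w - h k ^+ 2 / (2 * s k ^+ 2)).
have mZ : measurable_fun setT Z.
  apply: measurable_sum => k; apply: measurable_funB => //; apply: measurable_funM => //.
  exact: measurable_incr.
have e1 : P [set w | C (increments tau N (X f w))] =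
    (\int[P]_w (Phi f0 (seq_of b w) * expR (Z w))%:E)%E.
  rewrite (PE f hf); transitivity (\int[P]_w (Phi f0 (shift_below N h (seq_of b w)))%:E)%E.
    apply: eq_integral => w _; congr EFin; rewrite /Phi; congr (\1_C _).
    apply/funext => k; rewrite /shifted_increments /shift_below; case: ifP => // kN.
    rewrite /h (innerBl hf hf0) ?mulrDl; last exact: sqi_box.
    by field; rewrite gt_eqF// sqrtn_gt0.
  rewrite (cameron_martin ib h s0 nuE (mPhi f0)); last by move=> x; rewrite lee_fin.
  by apply: eq_integral => w _.
pose DD := \sum_(k < N) h k ^+ 2 / D k.
have DDle : DD <= n%:R * l2norm (f \- f0) ^+ 2.
  have -> : DD = n%:R * \sum_(k < N) inner (f \- f0) (box tau k) ^+ 2 / D k.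
    rewrite mulr_sumr; apply: eq_bigr => k _.
    by rewrite /h exprMn sqr_sqrtr// mulrA.
  by rewrite ler_wpM2l//; exact: (box_bessel g (sqiB hf hf0)).
(* The quadratic term of Z / 3 gives 1 / 6 and the variance of its linear term 1 / 18, together 2 /
   9. *)
have e2 : (\int[P]_w (expR (- (Z w / 3)))%:E = (expR (2 / 9 * DD))%:E)%E.
  pose c k := - (h k / (3 * D k)).
  pose K := \sum_(k < N) h k ^+ 2 / (6 * D k).
  transitivity (\int[P]_w ((expR K)%:E * (expR (\sum_(k < N) c k * b k w))%:E))%E.
    apply: eq_integral => w _; rewrite -EFinM -expRD; congr (expR _)%:E.
    rewrite /Z /K mulr_suml -sumrN -big_split/=; apply: eq_bigr => k _.
    by rewrite s2// /c; field; rewrite gt_eqF ?D0.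
  rewrite ge0_integralZl//; last first.
    apply/measurable_EFinP; apply: measurableT_comp => //; apply: measurable_sum => k.
    by apply: measurable_funM => //; exact: measurable_incr.
  rewrite (gaussian_expR_sum ib c s0 nuE) -EFinM -expRD; congr (expR _)%:E.
  rewrite /K /DD -big_split/= mulr_sumr; apply: eq_bigr => k _.
  by rewrite s2// /c; field; rewrite gt_eqF ?D0.
rewrite (PE f0 hf0) e1.
have mE1 : measurable_fun setT (fun w => (Phi f0 (seq_of b w) * expR (Z w))%:E).
  apply/measurable_EFinP; apply: measurable_funM; last exact: measurableT_comp.
  by apply/measurable_EFinP; exact: (measurableT_comp (mPhi f0) (measurable_seq_of ib)).
have mE2 : measurable_fun setT (fun w => (expR (- (Z w / 3)))%:E).
  apply/measurable_EFinP; apply: measurableT_comp => //; apply: measurableT_comp => //.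
  exact: measurable_funM.
have y3 : 0 <= y ^+ 3 / 4 by rewrite divr_ge0// exprn_ge0// ltW.
have y1 : 0 <= 3 / (4 * y) by rewrite divr_ge0// mulr_ge0// ltW.
apply: (@le_trans _ _ (\int[P]_w ((y ^+ 3 / 4)%:E * (Phi f0 (seq_of b w) * expR (Z w))%:E +
    (3 / (4 * y))%:E * (expR (- (Z w / 3)))%:E))%E).
  apply: ge0_le_integral => //.
  - by move=> w _; rewrite lee_fin.
  - by exact: (measurableT_comp (mPhi f0) (measurable_seq_of ib)).
  - by apply: emeasurable_funD; apply: emeasurable_funM => //; exact: measurable_cst.
  move=> w _; rewrite -!EFinM -EFinD lee_fin.
  rewrite /Phi indicE; have := young_tilt (Z w) y0; case: (_ \in _); rewrite /= ?mul1r// => _.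
  by rewrite mul0r mulr0 add0r mulr_ge0 ?expR_ge0.
rewrite ge0_integralD//.
- rewrite !ge0_integralZl//.
  + rewrite e2 leeD2l// -EFinM lee_fin ler_wpM2l// ler_expR; lra.
  + by move=> w _; rewrite lee_fin mulr_ge0// expR_ge0.
- by move=> w _; rewrite -EFinM lee_fin; apply: mulr_ge0 => //; rewrite mulr_ge0// expR_ge0.
- by apply: emeasurable_funM => //; exact: measurable_cst.
- by move=> w _; rewrite -EFinM lee_fin mulr_ge0// expR_ge0.
- by apply: emeasurable_funM => //; exact: measurable_cst.
Qed.

End change_of_signal.

(** An affine inequality between finite measures passes to monotone unions and intersections. The
    generating ring contains the whole space, so the generated sigma-ring is the sigma-algebra. *)
Lemma monotone_class_le d (U : measurableType d) (R : realType)
    (m0 m1 : {measure set U -> \bar R}) (a c : R) (G : set (set U)) :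
  0 < a -> (m0 setT < +oo)%E -> (m1 setT < +oo)%E ->
  setring G -> G setT -> measurable `<=` <<s G >> -> G `<=` measurable ->
  (forall A, G A -> (m0 A <= a%:E * m1 A + c%:E)%E) ->
  forall A, measurable A -> (m0 A <= a%:E * m1 A + c%:E)%E.
Proof.
move=> a0 f0 f1 rG GT mG Gm h.
have fin (m : {measure set U -> \bar R}) B : (m setT < +oo)%E -> measurable B -> m B \is a fin_num.
  move=> fm mB; rewrite ge0_fin_numE//; apply: le_lt_trans fm.
  by apply: le_measure; rewrite ?inE.
pose M : set (set U) := [set A | measurable A /\ (m0 A <= a%:E * m1 A + c%:E)%E].
have mM : monotone M.
  split=> F Fm FM.
    have mF i : measurable (F i) := (FM i).1.
    have mU : measurable (\bigcup_i F i) by exact: bigcupT_measurable.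
    split=> //; apply: (cvge_to_le (nondecreasing_cvg_mu mF mU Fm)); apply: nearW => i /=.
    apply: le_trans (FM i).2 _; rewrite leeD2r// lee_pmul2l ?lte_fin//.
    by apply: le_measure; rewrite ?inE//; exact: bigcup_sup.
  have mF i : measurable (F i) := (FM i).1.
  have mI : measurable (\bigcap_i F i) by exact: bigcapT_measurable.
  have F0 : (m1 (F 0%N) < +oo)%E by rewrite ltey_eq fin.
  split=> //; have fI := fin m0 _ f0 mI; have fI1 := fin m1 _ f1 mI.
  (* The mass under [m0] of the intersection is below that of each [F i], so only [m1] has to pass
     to the limit. *)
  suff : (((fine (m0 (\bigcap_i F i)) - c) / a)%:E <= m1 (\bigcap_i F i))%E.
    rewrite -(fineK fI1) -(fineK fI) -EFinM -EFinD !lee_fin ler_pdivrMr//.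
    by rewrite lerBlDr (mulrC a).
  apply: (cvge_to_ge (nonincreasing_cvg_mu F0 mF mI Fm)); apply: nearW => i /=.
  have h1 : (m0 (\bigcap_i F i) <= m0 (F i))%E.
    by apply: le_measure; rewrite ?inE//; exact: bigcap_inf.
  have := le_trans h1 (FM i).2.
  rewrite -(fineK fI) -(fineK (fin m1 _ f1 (mF i))) -EFinM -EFinD !lee_fin ler_pdivrMr//.
  by rewrite lerBlDr (mulrC a).
have GM : G `<=` M by move=> B GB; split; [exact: Gm|exact: h].
have sub := monotone_setring_sub_g_sigma_ring mM rG GM.
move=> A mA; suff : M A by case.
apply: sub; apply: (_ : <<s G >> `<=` <<sr G >>); last exact: mG.
have [s0 sD sU] := smallest_sigma_ring G.
apply: smallest_sub; last exact: sub_g_sigma_ring.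
split=> //.
by move=> B hB; apply: sD => //; exact: sub_g_sigma_ring.
Qed.

Section likelihood_ratio_bound.
Context d (T : measurableType d) (R : realType) (P : probability T R).
Variable W : R -> {RV P >-> R}.
Hypothesis BM : brownian_motion W.
Variable n : nat.
Hypothesis n_gt0 : (0 < n)%N.
Implicit Types (f g : R -> R) (tau : nat -> R).
Local Notation X f := (white_noise W n f).

(** The list of times may be unordered and repetitive, so concatenation gives closure under union
    and difference. Positions beyond its end read the time 0, which is admissible. *)
Definition finite_events : set (set (trajectory R)) :=
  [set A | exists s : seq R, (forall t, t \in s -> 0 <= t <= 1) /\
     exists2 C : set (seqsp R), measurable C &
       A = [set x : trajectory R | C (fun k => x (nth 0 s k))]].

Lemma white_noise0 f : square_integrable f -> {ae P, forall w, X f w 0 = 0}.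
Proof.
move=> hf; have [W0 _ _ _] := BM.
apply: (@filterS _ _ (ae_filter_ringOfSetsType P) _ _ _ W0) => w w0.
rewrite white_noiseE ?lexx ?ler01// w0 mul0r addr0.
have := inner_le_norm hf (sqi_up_to 0).
have -> : l2norm (up_to (0 : R)) = 0.
  apply/eqP; rewrite -sqrf_eq0 (l2norm_sqr (sqi_up_to 0)).
  by rewrite inner_up_to_up_to ?lexx ?ler01.
by rewrite mulr0 normr_le0 => /eqP.
Qed.

Lemma measurable_eval (s : seq R) : (forall t, t \in s -> 0 <= t <= 1) ->
  measurable_fun setT (fun x : trajectory R => (fun k => x (nth 0 s k)) : seqsp R).
Proof.
move=> s01; apply: measurable_fun_seqsp => k _ B mB; rewrite setTI.
apply: sub_sigma_algebra; exists (nth 0 s k), B; split=> //.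
have [ks|ks] := ltnP k (size s); first exact/s01/mem_nth.
by rewrite nth_default// lexx ler01.
Qed.

Lemma finite_events_measurable : finite_events `<=` measurable.
Proof.
move=> _ [s [s01 [C mC ->]]].
by have := measurable_eval s01 measurableT mC; rewrite setTI.
Qed.

Lemma finite_events_setT : finite_events setT.
Proof. by exists [::]; split=> //; exists setT. Qed.

Lemma finite_events_op (op : set (trajectory R) -> set (trajectory R) -> set (trajectory R))
    (op' : set (seqsp R) -> set (seqsp R) -> set (seqsp R)) :
  (forall C D, measurable C -> measurable D -> measurable (op' C D)) ->
  (forall (u v : trajectory R -> seqsp R) (C D : set (seqsp R)) (w : trajectory R -> seqsp R) (p q : seqsp R -> seqsp R),
     (forall x, p (w x) = u x) -> (forall x, q (w x) = v x) ->
     op (u @^-1` C) (v @^-1` D) = w @^-1` (op' (p @^-1` C) (q @^-1` D))) ->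
  forall A B, finite_events A -> finite_events B -> finite_events (op A B).
Proof.
move=> mop opE _ _ [s [s01 [C mC ->]]] [t [t01 [D mD ->]]].
(* Position size s + size t lies past the end of the concatenated list and therefore reads the
   default time 0, as positions past the end of [s] do. *)
pose p (y : seqsp R) : seqsp R := fun k => if (k < size s)%N then y k else y (size s + size t)%N.
pose q (y : seqsp R) : seqsp R := fun k => y (size s + k)%N.
have mp : measurable_fun setT p.
  by apply: measurable_fun_seqsp => k; rewrite /p; case: (k < size s)%N; exact: measurable_coord.
have mq : measurable_fun setT q.
  by apply: measurable_fun_seqsp => k; exact: measurable_coord.
exists (s ++ t); split; first by move=> x; rewrite mem_cat => /orP[/s01|/t01].
exists (op' (p @^-1` C) (q @^-1` D)).
  by apply: mop; [have := mp measurableT C mC|have := mq measurableT D mD]; rewrite setTI.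
apply: (opE (fun x k => x (nth 0 s k)) (fun x k => x (nth 0 t k)) C D
  (fun x k => x (nth 0 (s ++ t) k))) => x; apply/funext => k.
  rewrite /p; case: ltnP => ks; first by rewrite nth_cat ks.
  by rewrite !nth_default// size_cat.
by rewrite /q nth_cat ltnNge leq_addr/= addKn.
Qed.

Lemma finite_events_setring : setring finite_events.
Proof.
split; first by exists [::]; split=> //; exists set0.
- apply: (@finite_events_op setU setU) => [C D|u v C D w p q pu qv]; first exact: measurableU.
  by apply/seteqP; split => x /=; rewrite pu qv.
- apply: (@finite_events_op setD setD) => [C D|u v C D w p q pu qv]; first exact: measurableD.
  by apply/seteqP; split => x /=; rewrite pu qv.
Qed.

Lemma measurable_trajectory_generated :
  (measurable : set (set (trajectory R))) `<=` <<s finite_events >>.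
Proof.
apply: smallest_sub; first exact: smallest_sigma_algebra.
move=> _ [t [B [t01 mB ->]]]; apply: sub_sigma_algebra.
exists [:: t]; split=> [x|]; first by rewrite inE => /eqP->.
exists [set y | B (y 0%N)] => //.
by have := @measurable_coord R 0 measurableT B mB; rewrite setTI.
Qed.

(** Sorting the positive times of the list gives a strict grid from 0, continued by the constant 1.
    Values at these times are sums of increments because the data vanish at 0 almost surely, so the
    event coincides with a grid event up to a null set. *)
Lemma finite_events_change A f f0 (y : R) :
  square_integrable f -> square_integrable f0 -> finite_events A -> 0 < y ->
  (P (X f0 @^-1` A) <= (y ^+ 3 / 4)%:E * P (X f @^-1` A) +
   (3 / (4 * y) * expR (2 / 9 * (n%:R * l2norm (f \- f0) ^+ 2)))%:E)%E.
Proof.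
move=> hf hf0 fA y0; have mA := finite_events_measurable fA.
have [s [s01 [C mC AE]]] := fA.
pose L := sort <=%O (undup [seq t <- s | 0 < t]).
pose tau i := nth 1 (0 :: L) i; pose N := size L.
have Ls t : t \in L -> 0 < t /\ t <= 1.
  by rewrite mem_sort mem_undup mem_filter => /andP[t0 /s01/andP[_ t1]].
have L01 t : t \in 0 :: L -> 0 <= t <= 1.
  rewrite inE => /orP[/eqP->|/Ls[t0 t1]]; first by rewrite lexx ler01.
  by rewrite t1 ltW.
have pL : path <%O 0 L.
  rewrite path_min_sorted; last by apply/allP => t /Ls[].
  by rewrite sort_lt_sorted undup_uniq.
have lt_tau i : (i < N)%N -> tau i < tau i.+1 by move=> iN; exact: (pathP 1 pL).
have tau01 i : 0 <= tau i <= 1.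
  have [ks|ks] := ltnP i (size (0 :: L)); first exact/L01/mem_nth.
  by rewrite /tau nth_default// lexx ler01.
have g : grid tau N.
  split=> // i; have [/lt_tau/ltW//|iN] := ltnP i N.
  by rewrite [leRHS]/tau nth_default//; have /andP[] := tau01 i.
pose idx k := index (nth 0 s k) (0 :: L).
have idxL k : (idx k <= N)%N /\ tau (idx k) = nth 0 s k.
  suff h : nth 0 s k \in 0 :: L by rewrite /tau nth_index//; split=> //; rewrite -ltnS -/(size (0 :: L)) index_mem.
  have [ks|ks] := ltnP k (size s); last by rewrite nth_default// mem_head.
  have ms := mem_nth 0 ks; have /andP[] := s01 _ ms.
  rewrite le_eqVlt => /orP[/eqP<-|t0] _; first by rewrite mem_head.
  by rewrite inE mem_sort mem_undup mem_filter t0 ms orbT.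
pose C' := [set y : seqsp R | C (fun k => \sum_(i < idx k) y i)].
have mC' : measurable C'.
  have mS : measurable_fun setT (fun y : seqsp R => (fun k => \sum_(i < idx k) y i) : seqsp R).
    by apply: measurable_fun_seqsp => k; apply: measurable_sum => i; exact: measurable_coord.
  by have := mS measurableT C mC; rewrite setTI.
have sumE x k : x 0 = 0 -> \sum_(i < idx k) increments tau N x i = x (nth 0 s k).
  move=> x0; have [iN <-] := idxL k; move: (idx k) iN; elim=> [|m IH] mN.
    by rewrite big_ord0 (grid0 g).
  by rewrite big_ord_recr/= IH ?(ltnW mN)// /increments mN addrC subrK.
have PE h : square_integrable h ->
    P (X h @^-1` A) = P [set w | C' (increments tau N (X h w))].
  move=> hh; apply: ae_measure_eq.
  - by have := measurable_white_noise W n h measurableT mA; rewrite setTI.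
  - have [nu [ib _]] := increments_law BM g.
    have -> : [set w | C' (increments tau N (X h w))] =
        (shifted_increments n tau N h \o seq_of (incr W tau)) @^-1` C'.
      by apply/seteqP; split => w /=; rewrite (increments_white_noise _ _ w g hh).
    have := measurableT_comp (measurable_shifted_increments n tau N h) (measurable_seq_of ib).
    by move=> /(_ measurableT _ mC'); rewrite setTI.
  apply: (@filterS _ _ (ae_filter_ringOfSetsType P) _ _ _ (white_noise0 hh)) => w w0.
  rewrite AE /C' /=; set a := fun k => _; set c := fun k => _.
  by have -> : a = c by apply/funext => k; rewrite /c sumE.
by rewrite !PE//; exact: grid_change.
Qed.

Lemma change_of_signal A f f0 :
  square_integrable f -> square_integrable f0 -> measurable A ->
  fine (P (X f0 @^-1` A)) ^+ 4 <=
    expR (2 / 3 * (n%:R * l2norm (f \- f0) ^+ 2)) * fine (P (X f @^-1` A)).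
Proof.
move=> hf hf0 mA.
set D := n%:R * _; set p0 := fine _; set p1 := fine _.
have fn h : P (X h @^-1` A) \is a fin_num.
  by apply: fin_num_measure; have := measurable_white_noise W n h measurableT mA; rewrite setTI.
have p00 : 0 <= p0 by rewrite fine_ge0.
have p10 : 0 <= p1 by rewrite fine_ge0.
have main y : 0 < y -> p0 <= y ^+ 3 / 4 * p1 + 3 / (4 * y) * expR (2 / 9 * D).
  move=> y0; have y3 : 0 < y ^+ 3 / 4 by rewrite divr_gt0// exprn_gt0.
  have := @monotone_class_le _ (trajectory R) R
    (measure_function_pushforward__canonical__measure_function_Measure P (measurable_white_noise W n f0))
    (measure_function_pushforward__canonical__measure_function_Measure P (measurable_white_noise W n f))
    _ (3 / (4 * y) * expR (2 / 9 * D)) finite_events y3.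
  rewrite /= /pushforward !preimage_setT probability_setT ltry => /(_ isT isT).
  move=> /(_ finite_events_setring finite_events_setT measurable_trajectory_generated finite_events_measurable).
  move=> /(_ (fun B fB => finite_events_change hf hf0 fB y0) A mA).
  by rewrite -(fineK (fn f0)) -(fineK (fn f)) -EFinM -EFinD lee_fin.
move: p00; rewrite le_eqVlt => /orP[/eqP<-|p00].
  by rewrite expr0n/= mulr_ge0// expR_ge0.
set K := expR (2 / 9 * D) in main.
have K0 : 0 < K by rewrite expR_gt0.
have -> : expR (2 / 3 * D) = K ^+ 3 by rewrite /K -expRM_natl; congr expR; field.
(* The optimal parameter: the second term becomes 3 / 4 of [p0], which the left side absorbs. *)
have := main (K / p0); rewrite divr_gt0// => /(_ isT).
have -> : 3 / (4 * (K / p0)) * K = 3 / 4 * p0 by field; rewrite !gt_eqF.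
have -> : (K / p0) ^+ 3 / 4 * p1 = K ^+ 3 * p1 / p0 ^+ 3 / 4 by field; rewrite gt_eqF.
move=> h; have {}h : p0 <= K ^+ 3 * p1 / p0 ^+ 3 by lra.
by move: h; rewrite ler_pdivlMr ?exprn_gt0// -exprS.
Qed.

End likelihood_ratio_bound.

(** * Approximate coefficients computable from finitely many data *)

Section discretized_coefficients.
Variable R : realType.
Implicit Types (f g : R -> R) (c : nat -> R) (i k m J : nat).

Definition equi_grid m i : R := if (i < m)%N then i%:R / m%:R else 1.

Lemma equi_gridP m : (0 < m)%N -> grid (equi_grid m) m /\
  (forall i, equi_grid m i.+1 - equi_grid m i <= m%:R^-1) /\ equi_grid m m = 1.
Proof.
move=> m0; have mR : 0 < (m%:R : R) by rewrite ltr0n.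
have e i : (i <= m)%N -> equi_grid m i = i%:R / m%:R.
  rewrite leq_eqVlt /equi_grid => /orP[/eqP->|->//].
  by rewrite ltnn divff// gt_eqF.
have st i : (i < m)%N -> equi_grid m i.+1 - equi_grid m i = m%:R^-1.
  move=> im; rewrite !e//; last exact: ltnW.
  by rewrite -mulrBl -natrB// subSnn mul1r.
have st0 i : (m <= i)%N -> equi_grid m i.+1 - equi_grid m i = 0.
  by move=> mi; rewrite /equi_grid !ltnNge mi (leq_trans mi)//= subrr.
split; last split.
- split.
  + by rewrite e// mul0r.
  + move=> i; rewrite /equi_grid; case: ifP => im; last by rewrite ler01 lexx.
    by rewrite divr_ge0//= ler_pdivrMr// mul1r ler_nat ltnW.
  + move=> i; rewrite -subr_ge0; have [im|im] := ltnP i m; last by rewrite st0.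
    by rewrite st// invr_ge0 ltW.
  + by move=> i im; rewrite -subr_gt0 st// invr_gt0.
- move=> i; have [im|im] := ltnP i m; first by rewrite st.
  by rewrite st0// invr_ge0 ltW.
- by rewrite /equi_grid ltnn.
Qed.

Lemma l2norm_bounded g (K : R) : measurable_fun setT g -> 0 <= K ->
  (forall x, `|g x| <= K) -> l2norm g <= K.
Proof.
move=> mg K0 bd; have hs := sqi_bounded mg bd.
have hc : square_integrable (fun=> K) by apply: (@sqi_bounded _ _ K) => // x; rewrite ger0_norm.
rewrite -ler_sqr ?nnegrE ?l2norm_ge0// l2norm_sqr// /inner.
apply: (@le_trans _ _ (\int[leb01 R]_x (K * K))%R).
  apply: le_Rintegral => //; [exact: sqi_mul_integrable|exact: (sqi_mul_integrable hc hc)|].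
  by move=> x _; rewrite -!expr2 -[leLHS]real_normK ?num_real// ler_pXn2r ?nnegrE.
by rewrite Rintegral_cst//= leb01_setT/= mulr1.
Qed.

(** A basis function sampled at left endpoints: pairing it with the data needs finitely many
    increments and no stochastic integral. *)
Definition step_trig m k : R -> R :=
  fun x => \sum_(i < m) trig k.+1 (equi_grid m i) * box (equi_grid m) i x.

Lemma sqi_step_trig m k : square_integrable (step_trig m k).
Proof.
apply: (@sqi_sum _ _ (index_enum 'I_m) (fun (i : 'I_m) x => trig k.+1 (equi_grid m i) * box (equi_grid m) i x)) => i.
exact/sqiZ/sqi_box.
Qed.

Lemma sum_box m x : (0 < m)%N ->
  \sum_(i < m) box (equi_grid m) i x = up_to 1 x - up_to 0 x :> R.
Proof.
move=> m0; have [g [_ g1]] := equi_gridP m0.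
have tele N : \sum_(i < N) box (equi_grid m) i x =
    up_to (equi_grid m N) x - up_to (equi_grid m 0) x.
  elim: N => [|j IH]; first by rewrite big_ord0 subrr.
  by rewrite big_ord_recr/= IH /box/=; ring.
by rewrite tele g1 (grid0 g).
Qed.

Lemma l2norm_step_trig_le m k (K : R) : (0 < m)%N ->
  (forall s t : R, `|trig k.+1 s - trig k.+1 t| <= K * `|s - t|) -> 0 <= K ->
  l2norm (step_trig m k \- trig k.+1) <= K / m%:R.
Proof.
move=> m0 hK K0; have [g [gm g1]] := equi_gridP m0.
have mR : 0 < (m%:R : R) by rewrite ltr0n.
have memE (x t : R) : (x \in `[0, t]%classic) = (0 <= x <= t).
  by apply/idP/idP; rewrite inE/= in_itv.
pose S x : R := up_to 1 x - up_to 0 x.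
(* The boxes cover ]0, 1] only. Restricting the basis function to that set changes it on a null set
   and makes the comparison uniform on the line. *)
pose t' x : R := trig k.+1 x * S x.
have mt' : measurable_fun setT t'.
  apply: measurable_funM; first exact: measurable_trig.
  by apply: measurable_funB; apply: sqi_measurable; exact: sqi_up_to.
have ms := sqi_measurable (sqi_step_trig m k).
have -> : l2norm (step_trig m k \- trig k.+1) = l2norm (step_trig m k \- t').
  apply: l2norm_ae; last 2 first.
  - by apply: measurable_funB => //; exact: measurable_trig.
  - exact: measurable_funB.
  exists (~` `]0, 1]%classic); split.
  - exact: measurableC.
  - rewrite leb01E; last exact: measurableC.
    apply/eqP; rewrite eq_le measure_ge0 andbT.
    rewrite -(lebesgue_measure_set1 (0 : R)); apply: le_measure; rewrite ?inE//.
      by apply: measurableI => //; exact: measurableC.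
    move=> x [/= h]; rewrite in_itv/= => /andP[x0 x1].
    apply/eqP; rewrite eq_le x0 andbT leNgt; apply/negP => x0'; apply: h.
    by rewrite in_itv/= x0' x1.
  - move=> x /= h hx; apply: h => _; move: hx; rewrite in_itv/= => /andP[x0 x1].
    by rewrite /t' /S /up_to !indicE !memE (ltW x0) x1 leNgt x0 subr0 mulr1.
have bxE i x : box (equi_grid m) i x =
    (equi_grid m i < x <= equi_grid m i.+1)%R%:R :> R.
  have /andP[t0 _] := grid01 g i.
  rewrite /box /up_to /= !indicE !memE; have := grid_le g i.
  by case: (leP 0 x) => x0; case: (leP x (equi_grid m i)) => h1;
    case: (leP x (equi_grid m i.+1)) => h2 /=; rewrite ?subrr ?subr0//; lra.
have bd x : `|(step_trig m k \- t') x| <= K / m%:R.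
  have -> : (step_trig m k \- t') x =
      \sum_(i < m) (trig k.+1 (equi_grid m i) - trig k.+1 x) * box (equi_grid m) i x.
    by under [RHS]eq_bigr do rewrite mulrBl; rewrite sumrB -mulr_sumr sum_box.
  apply: le_trans (ler_norm_sum _ _ _) _.
  apply: (@le_trans _ _ (\sum_(i < m) K / m%:R * box (equi_grid m) i x)).
    apply: ler_sum => i _; rewrite bxE normrM [X in _ * X]ger0_norm//.
    case: (boolP (_ < x <= _)) => [/andP[h1 h2]|_]; last by rewrite !mulr0.
    rewrite !mulr1; apply: le_trans (hK _ _) _; rewrite ler_wpM2l// ler0_norm; last by rewrite subr_le0 ltW.
    by rewrite opprB; apply: le_trans (gm i); rewrite lerD2r.
  rewrite -mulr_sumr sum_box// ler_piMr ?divr_ge0//.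
  rewrite lerBlDr; apply: (@le_trans _ _ 1); last by rewrite lerDl.
  by rewrite /up_to indicE; case: (_ \in _).
apply: l2norm_bounded bd; first exact: measurable_funB.
by rewrite divr_ge0.
Qed.

Lemma step_trig_close J : exists2 m, (0 < m)%N &
  \sum_(k < J) l2norm (step_trig m k \- trig k.+1) ^+ 2 <= 8^-1.
Proof.
pose K k : R := Num.sqrt 2 * (2 * pi * k.+1./2%:R).
have K0 k : 0 <= K k by rewrite !mulr_ge0// ?sqrtr_ge0 ?pi_ge0.
pose S := \sum_(k < J) K k ^+ 2.
have S0 : 0 <= S by apply: sumr_ge0 => k _; exact: sqr_ge0.
(* The squared errors sum to at most S / m^2, and m >= max(1, 8 S) brings this below 1 / 8. *)
pose m := (Num.truncn (8 * S)).+1.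
have m1 : (1 : R) <= m%:R by rewrite ler1n.
have mS : 8 * S <= m%:R by apply/ltW/truncnS_gt.
exists m => //.
apply: (@le_trans _ _ (\sum_(k < J) (K k / m%:R) ^+ 2)).
  apply: ler_sum => k _; rewrite ler_pXn2r ?nnegrE ?l2norm_ge0 ?divr_ge0//.
  by apply: l2norm_step_trig_le => // s t; exact: trig_lipschitz.
under eq_bigr do rewrite expr_div_n.
rewrite -mulr_suml -/S ler_pdivrMr ?exprn_gt0//.
by have := ler_wpM2l (le_trans ler01 m1) m1; rewrite expr2; lra.
Qed.

Lemma inner_step_trig_le m J g : square_integrable g ->
  \sum_(k < J) l2norm (step_trig m k \- trig k.+1) ^+ 2 <= 8^-1 ->
  \sum_(k < J) coef g k ^+ 2 / 2 - l2norm g ^+ 2 / 8 <= \sum_(k < J) inner g (step_trig m k) ^+ 2.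
Proof.
move=> hg h8.
have hs k := sqiB (sqi_step_trig m k) (sqi_trig R k.+1).
have h (k : 'I_J) : coef g k ^+ 2 / 2 - l2norm g ^+ 2 * l2norm (step_trig m k \- trig k.+1) ^+ 2 <=
    inner g (step_trig m k) ^+ 2.
  have e : coef g k = inner g (step_trig m k) - inner g (step_trig m k \- trig k.+1).
    rewrite !(innerC g) innerBl//; [|exact: sqi_step_trig|exact: sqi_trig].
    by rewrite /coef (innerC g); ring.
  have b : inner g (step_trig m k \- trig k.+1) ^+ 2 <=
      l2norm g ^+ 2 * l2norm (step_trig m k \- trig k.+1) ^+ 2.
    rewrite -exprMn -[leLHS]real_normK ?num_real// ler_pXn2r ?nnegrE ?mulr_ge0 ?l2norm_ge0//.
    exact: inner_le_norm.
  have : 0 <= (inner g (step_trig m k) + inner g (step_trig m k \- trig k.+1)) ^+ 2 by exact: sqr_ge0.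
  rewrite e; nra.
apply: (@le_trans _ _ (\sum_(k < J) (coef g k ^+ 2 / 2 -
    l2norm g ^+ 2 * l2norm (step_trig m k \- trig k.+1) ^+ 2))); last by apply: ler_sum => k _.
rewrite sumrB lerD2l lerN2 -mulr_sumr.
by have := ler_wpM2l (sqr_ge0 (l2norm g)) h8; lra.
Qed.

(** The step functions are a small perturbation of an orthonormal system: the error of a combination
    has squared norm at most 1 / 8 of that of its coefficients. *)
Lemma l2norm_step_sum m J c :
  \sum_(k < J) l2norm (step_trig m k \- trig k.+1) ^+ 2 <= 8^-1 ->
  l2norm (fun x => \sum_(k < J) c k * step_trig m k x) ^+ 2 <= 2 * \sum_(k < J) c k ^+ 2.
Proof.
move=> h8; pose dk k : R -> R := step_trig m k \- trig k.+1.
have hd k : square_integrable (dk k) by apply: sqiB; [exact: sqi_step_trig|exact: sqi_trig].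
pose D x := \sum_(k < J) c k * dk k x.
have hD : square_integrable D.
  by apply: (@sqi_sum _ _ (index_enum 'I_J) (fun (k : 'I_J) x => c k * dk k x)) => k; exact: sqiZ.
set Q := \sum_(k < J) c k ^+ 2.
have D8 : l2norm D ^+ 2 <= Q / 8.
  have e : l2norm D ^+ 2 = \sum_(k < J) c k * inner (dk k) D.
    rewrite l2norm_sqr// {1}/D (@inner_suml _ _ (index_enum 'I_J) (fun (k : 'I_J) x => c k * dk k x))//.
      by apply: eq_bigr => k _; rewrite innerZl.
    by move=> k; exact: sqiZ.
  (* Weighted so that, after summation, the last term is half of the squared norm of [D] and can be
     absorbed. *)
  have b (k : 'I_J) : c k * inner (dk k) D <= c k ^+ 2 / 16 + 4 * (l2norm (dk k) ^+ 2 * l2norm D ^+ 2).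
    have : inner (dk k) D ^+ 2 <= l2norm (dk k) ^+ 2 * l2norm D ^+ 2.
      rewrite -exprMn -[leLHS]real_normK ?num_real// ler_pXn2r ?nnegrE ?mulr_ge0 ?l2norm_ge0//.
      exact: inner_le_norm.
    have : 0 <= (c k / 4 - 2 * inner (dk k) D) ^+ 2 by exact: sqr_ge0.
    nra.
  have : l2norm D ^+ 2 <= Q / 16 + 4 * (8^-1 * l2norm D ^+ 2).
    rewrite {1}e; apply: (@le_trans _ _ (\sum_(k < J) (c k ^+ 2 / 16 +
      4 * (l2norm (dk k) ^+ 2 * l2norm D ^+ 2)))); first by apply: ler_sum => k _.
    rewrite big_split/= -mulr_suml -/Q -mulr_sumr -mulr_suml lerD2l ler_wpM2l// ler_wpM2r ?sqr_ge0//.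
  lra.
have -> : (fun x => \sum_(k < J) c k * step_trig m k x) = trig_sum c J \+ D.
  apply/funext => x /=; rewrite /trig_sum /D -big_split/=; apply: eq_bigr => k _.
  by rewrite /dk/=; ring.
have Qe := l2norm_trig_sum c J.
have := l2norm_triangle (sqi_trig_sum c J) hD.
have := l2norm_ge0 (trig_sum c J \+ D); have := l2norm_ge0 D; have := l2norm_ge0 (trig_sum c J).
move: Qe; set a := l2norm (trig_sum c J); set b := l2norm D in D8 *; set e := l2norm (_ \+ _).
rewrite -/Q => Qe a0 b0 e0 eab; have : 0 <= (a / 2 - b) ^+ 2 by exact: sqr_ge0.
have : e ^+ 2 <= (a + b) ^+ 2 by rewrite ler_pXn2r ?nnegrE ?addr_ge0.
nra.
Qed.

Lemma l2norm_step_sumE m J c : (0 < m)%N ->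
  l2norm (fun x => \sum_(k < J) c k * step_trig m k x) ^+ 2 =
  \sum_(i < m) (\sum_(k < J) c k * trig k.+1 (equi_grid m i)) ^+ 2 *
    (equi_grid m i.+1 - equi_grid m i).
Proof.
move=> m0; have [g _] := equi_gridP m0.
pose v i := \sum_(k < J) c k * trig k.+1 (equi_grid m i).
have -> : (fun x => \sum_(k < J) c k * step_trig m k x) =
    (fun x => \sum_(i < m) v i * box (equi_grid m) i x).
  apply/funext => x; under eq_bigr do rewrite /step_trig mulr_sumr.
  rewrite exchange_big/=; apply: eq_bigr => i _; rewrite /v mulr_suml.
  by apply: eq_bigr => k _; rewrite mulrA.
have hb i : square_integrable (fun x => v i * box (equi_grid m) i x) by apply: sqiZ; exact: sqi_box.
have hS := @sqi_sum _ _ (index_enum 'I_m) (fun (i : 'I_m) x => v i * box (equi_grid m) i x) hb.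
have lin h : square_integrable h -> inner (fun x => \sum_(i < m) v i * box (equi_grid m) i x) h =
    \sum_(i < m) v i * inner (box (equi_grid m) i) h.
  move=> hh; rewrite (@inner_suml _ _ (index_enum 'I_m) (fun (i : 'I_m) x => v i * box (equi_grid m) i x))//.
  by apply: eq_bigr => i _; rewrite innerZl//; exact: sqi_box.
rewrite l2norm_sqr// lin//; apply: eq_bigr => i _.
rewrite innerC lin; last exact: sqi_box.
rewrite (bigD1 i)//= (inner_box _ _ g) eqxx big1 ?addr0; first by rewrite /v; ring.
by move=> j ji; rewrite (inner_box _ _ g) (negbTE ji : (j == i :> nat) = false) mulr0.
Qed.

End discretized_coefficients.

(** * Tests based on the discretized coefficients *)

Section linear_test.
Context d (T : measurableType d) (R : realType) (P : probability T R).
Context d' (T' : measurableType d') (P' : probability T' R).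
Variables (W : R -> {RV P >-> R}) (a : nat -> T' -> R) (n m J : nat).
Hypothesis BM : brownian_motion W.
Hypothesis ia : independent_with_laws P' a (fun=> std_normal R).
Hypotheses (n_gt0 : (0 < n)%N) (m_gt0 : (0 < m)%N).
Hypothesis close : \sum_(k < J) l2norm (step_trig m k \- @trig R k.+1) ^+ 2 <= 8^-1.
Implicit Types (f g : R -> R).
Local Notation X f := (white_noise W n f).
Local Notation sn := (Num.sqrt (n%:R : R)).
Local Notation tau := (@equi_grid R m).

Definition noise_coef k (w : T) : R := \sum_(i < m) trig k.+1 (tau i) * incr W tau i w.

Lemma measurable_noise_coef k : measurable_fun setT (noise_coef k).
Proof.
apply: measurable_sum => i; apply: measurable_funM => //; exact: measurable_incr.
Qed.

Definition noise_energy (w : T) : R := \sum_(k < J) noise_coef k w ^+ 2.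

Lemma measurable_noise_energy : measurable_fun setT noise_energy.
Proof.
by apply: measurable_sum => k; apply: measurable_funX; exact: measurable_noise_coef.
Qed.

(* The exponential of the squared norm is linearized by averaging over an
   auxiliary Gaussian vector. *)
Lemma noise_laplace :
  (\int[P]_w (expR (noise_energy w / 16))%:E <= (expR (J%:R / 2 * ln 2))%:E)%E.
Proof.
have [g _] := equi_gridP R m_gt0.
have [nu [ib nuE]] := increments_law BM g.
(* With t^2 = 1 / 8 the average over the auxiliary vector is exactly the exponential of the energy
   divided by 16. *)
pose t : R := Num.sqrt 8^-1.
have t2 : t ^+ 2 = 8^-1 by rewrite sqr_sqrtr.
pose F (z : T * T') : \bar R := (expR (\sum_(k < J) (t * noise_coef k z.1) * a k z.2))%:E.
have mF : measurable_fun setT F.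
  apply/measurable_EFinP; apply: measurableT_comp => //; apply: measurable_sum => k.
  apply: measurable_funM; last exact: (measurableT_comp (ia.1 k) measurable_snd).
  apply: measurable_funM => //.
  exact: (measurableT_comp (measurable_noise_coef k) measurable_fst).
have F0 z : (0 <= F z)%E by rewrite lee_fin expR_ge0.
have one k : (k < J)%N -> (1 : R) != 0 by move=> _; exact: oner_neq0.
have e1 : (\int[P]_w (expR (noise_energy w / 16))%:E = \int[P]_w \int[P']_y F (w, y))%E.
  apply: eq_integral => w _.
  rewrite (gaussian_expR_sum ia (fun k => t * noise_coef k w) one (fun k _ A _ => erefl)).
  congr (expR _)%:E; rewrite /noise_energy mulr_suml; apply: eq_bigr => k _.
  by rewrite exprMn t2 expr1n; field.
rewrite e1 (fubini_tonelli F mF F0) /=.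
(* Integrating out the noise leaves at most exp(a_k^2 / 8) per coordinate, of mean (3 / 4)^(-1/2) <=
   sqrt 2; this is the origin of J / 2 times ln 2. *)
pose c (k : nat) : R := - 4^-1.
have c1 k : (k < J)%N -> -1 < c k by move=> _; rewrite /c; lra.
apply: (@le_trans _ _ (\int[P']_y (expR (- (\sum_(k < J) c k / 2 * a k y ^+ 2)))%:E)%E).
  apply: ge0_le_integral => //.
  - by move=> y _; apply: integral_ge0 => w _; exact: F0.
  - exact: measurable_fun_fubini_tonelli_G.
  - apply/measurable_EFinP; apply: measurableT_comp => //; apply: measurableT_comp => //.
    apply: measurable_sum => k; apply: measurable_funM => //; apply: measurable_funX.
    exact: ia.1.
  move=> y _.
  pose v i := \sum_(k < J) (t * a k y) * trig k.+1 (tau i).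
  have s0 k : (k < m)%N -> Num.sqrt (tau k.+1 - tau k) != 0.
    by move=> km; rewrite gt_eqF// sqrtr_gt0 subr_gt0 (grid_lt g).
  have -> : (\int[P]_w F (w, y) = \int[P]_w (expR (\sum_(i < m) v i * incr W tau i w))%:E)%E.
    apply: eq_integral => w _; congr (expR _)%:E; rewrite /noise_coef /=.
    under eq_bigr do rewrite mulr_sumr mulr_suml.
    rewrite exchange_big/=; apply: eq_bigr => i _; rewrite /v mulr_suml.
    by apply: eq_bigr => k _; ring.
  rewrite (gaussian_expR_sum ib v s0 nuE) lee_fin ler_expR.
  have -> : \sum_(i < m) v i ^+ 2 * Num.sqrt (tau i.+1 - tau i) ^+ 2 / 2 =
      l2norm (fun x => \sum_(k < J) (t * a k y) * step_trig m k x) ^+ 2 / 2.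
    rewrite (l2norm_step_sumE J (fun k => t * a k y) m_gt0) -mulr_suml; congr (_ / _).
    apply: eq_bigr => i _; rewrite sqr_sqrtr// subr_ge0; exact: grid_le g i.
  have := l2norm_step_sum (fun k => t * a k y) close.
  under eq_bigr do rewrite exprMn t2.
  have -> : - (\sum_(k < J) c k / 2 * a k y ^+ 2) = \sum_(k < J) 8^-1 * a k y ^+ 2.
    by rewrite -sumrN; apply: eq_bigr => k _; rewrite /c; field.
  lra.
rewrite (gaussian_expR_sqr ia (fun k A _ => erefl) c1) lee_fin.
have -> : expR (J%:R / 2 * ln 2) = \prod_(k < J) (expR (ln 2 / 2) : R).
  by rewrite prodr_const card_ord -expRM_natl; congr expR; ring.
apply: ler_prod => k _; rewrite invr_ge0 sqrtr_ge0/=.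
rewrite -(@ler_pXn2r _ 2)// ?nnegrE ?invr_ge0 ?sqrtr_ge0 ?expR_ge0//.
rewrite exprVn sqr_sqrtr; last by rewrite /c; lra.
rewrite -expRM_natl (mulrCA 2) divff ?mulr1 ?pnatr_eq0// lnK ?posrE//.
by rewrite /c -[leRHS]invrK lef_pV2 ?posrE; lra.
Qed.

Lemma noise_bound r :
  (P [set w | r <= noise_energy w]%R <= (expR (J%:R / 2 * ln 2 - r / 16))%:E)%E.
Proof.
have mA : measurable [set w | r <= noise_energy w]%R.
  exact: (measurable_ge_set measurable_noise_energy).
have mE : measurable_fun setT (fun w => (expR (noise_energy w / 16))%:E).
  apply/measurable_EFinP; apply: measurableT_comp => //; apply: measurable_funM => //.
  exact: measurable_noise_energy.
rewrite addrC expRD EFinM.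
apply: (@le_trans _ _ ((expR (- (r / 16)))%:E * \int[P]_w (expR (noise_energy w / 16))%:E)%E); last first.
  by apply: lee_wpmul2l; [rewrite lee_fin expR_ge0|exact: noise_laplace].
rewrite (measure_integral_indic P mA) -ge0_integralZl//.
apply: ge0_le_integral => //.
- by apply/measurable_EFinP; exact: measurable_indic.
- by apply: emeasurable_funM => //; exact: measurable_cst.
move=> w _; rewrite -EFinM lee_fin -expRD indicE.
case: (boolP (_ \in _)) => [/set_mem/= h|_]; last by rewrite expR_ge0.
by rewrite -[leLHS]expR0 ler_expR; lra.
Qed.

Definition data_coef k (x : R -> R) : R :=
  \sum_(i < m) trig k.+1 (tau i) * (x (tau i.+1) - x (tau i)).

Lemma data_coefE f k w : square_integrable f ->
  data_coef k (X f w) = inner f (step_trig m k) + noise_coef k w / sn.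
Proof.
move=> hf; have [g _] := equi_gridP R m_gt0.
have hb (i : 'I_m) := @sqiZ _ (trig k.+1 (tau i)) _ (sqi_box tau i).
rewrite (innerC f) (@inner_suml _ _ (index_enum 'I_m)
  (fun (i : 'I_m) x => trig k.+1 (tau i) * box tau i x))// mulr_suml -big_split/=.
apply: eq_bigr => i _; rewrite (white_noise_incr W n _ w g hf).
by rewrite innerZl//; [rewrite innerC; ring|exact: sqi_box].
Qed.

Definition reject (f0 : R -> R) (r : R) : set (trajectory R) :=
  [set x | r <= \sum_(k < J) (data_coef k x - inner f0 (step_trig m k)) ^+ 2].

Lemma measurable_reject f0 r : measurable (reject f0 r).
Proof.
apply: measurable_ge_set; apply: measurable_sum => k; apply: measurable_funX.
apply: measurable_funB => //; apply: measurable_sum => i; apply: measurable_funM => //.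
have [g _] := equi_gridP R m_gt0.
have ev j : measurable_fun setT (fun x : trajectory R => x (tau j) : measurableTypeR R).
  move=> _ B mB; rewrite setTI; apply: sub_sigma_algebra.
  by exists (tau j), B; split=> //; exact: grid01 g j.
by apply: measurable_funB; exact: ev.
Qed.

Lemma sqrsn : sn ^+ 2 = n%:R. Proof. by rewrite sqr_sqrtr. Qed.

Lemma noise_energy_div w : \sum_(k < J) (noise_coef k w / sn) ^+ 2 = noise_energy w / n%:R.
Proof.
by rewrite /noise_energy mulr_suml; apply: eq_bigr => k _; rewrite expr_div_n sqrsn.
Qed.

Lemma reject_error1 f0 r : square_integrable f0 ->
  (P (X f0 @^-1` reject f0 r) <= (expR (J%:R / 2 * ln 2 - n%:R * r / 16))%:E)%E.
Proof.
move=> hf0; have nR : 0 < (n%:R : R) by rewrite ltr0n.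
apply: le_trans (noise_bound (n%:R * r)); apply: le_measure; rewrite ?inE.
- by have := measurable_white_noise W n f0 measurableT (measurable_reject f0 r); rewrite setTI.
- exact: (measurable_ge_set measurable_noise_energy).
move=> w; rewrite /reject/= mulrC -ler_pdivlMr// -noise_energy_div.
by under eq_bigr do rewrite (data_coefE _ _ hf0) addrAC subrr add0r.
Qed.

(** With 3 / 4 of the energy below the cutoff, the discretized coefficients keep 3 / 8 - 1 / 8 = 1 /
    4 of it, at least 4 r. Accepting means a statistic below [r], so the noise must contribute at
    least [r]. *)
Lemma reject_error2 f f0 r : square_integrable f -> square_integrable f0 ->
  16 * r <= l2norm (f \- f0) ^+ 2 ->
  3 / 4 * l2norm (f \- f0) ^+ 2 <= \sum_(k < J) coef (f \- f0) k ^+ 2 ->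
  (P (X f @^-1` ~` reject f0 r) <= (expR (J%:R / 2 * ln 2 - n%:R * r / 16))%:E)%E.
Proof.
move=> hf hf0 h1 h2; have nR : 0 < (n%:R : R) by rewrite ltr0n.
apply: le_trans (noise_bound (n%:R * r)); apply: le_measure; rewrite ?inE.
- have := measurable_white_noise W n f measurableT (measurableC (measurable_reject f0 r)).
  by rewrite setTI.
- exact: (measurable_ge_set measurable_noise_energy).
move=> w; rewrite /reject/= => /negP; rewrite -ltNge => lt.
rewrite mulrC -ler_pdivlMr// -noise_energy_div.
have hd := sqiB hf hf0; have := inner_step_trig_le hd close.
rewrite -mulr_suml; set A := \sum_(k < J) inner _ _ ^+ 2; set Z := \sum_(k < J) (_ / _) ^+ 2.
set B := \sum_(k < J) _ in lt.
have : A <= 2 * B + 2 * Z.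
  rewrite /A /B /Z !mulr_sumr -big_split/=; apply: ler_sum => k _.
  rewrite (data_coefE _ _ hf) innerBl//; last exact: sqi_step_trig.
  set x := inner f _; set y := inner f0 _; set z := _ / _.
  have : 0 <= ((x - y) + 2 * z) ^+ 2 by exact: sqr_ge0.
  nra.
lra.
Qed.

End linear_test.

Lemma powR_ge1 (R : realType) (y r : R) : 1 <= y -> 0 <= r -> 1 <= y `^ r.
Proof. by move=> y1 r0; rewrite -[leLHS](powRr0 y) ler_powR. Qed.

(** * Growth of the log-determinant *)

Section eigenvalue_sums.
Variables (R : realType) (alpha : R).
Hypothesis alpha_gt0 : 0 < alpha.
Implicit Types (t x : R) (k m N : nat).
Local Notation w := (weight alpha).
Local Notation kappa := ((2 * alpha + 1)^-1).
Local Notation tot := (log_complexity alpha).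

Lemma weight_sqrE k : w k ^+ 2 = k.+1%:R `^ (- (2 * alpha + 1)).
Proof.
by rewrite /weight /prior_weight -powR_mulrn ?powR_ge0// -powRrM; congr (_ `^ _); field.
Qed.

Lemma kappa_gt0 : 0 < kappa. Proof. by rewrite invr_gt0; move: alpha_gt0; lra. Qed.

Lemma powR_kappa t : 0 <= t -> (t `^ kappa) `^ (2 * alpha + 1) = t.
Proof.
by move=> t0; rewrite -powRrM mulVf ?powRr1// gt_eqF//; move: alpha_gt0; lra.
Qed.

Lemma powR_kappa_ge1 t : 1 <= t -> 1 <= t `^ kappa.
Proof. by move=> t1; apply: powR_ge1 => //; exact/ltW/kappa_gt0. Qed.

(** The power of [t] is the effective dimension: scaled eigenvalues are at least 1 exactly for
    indices k + 1 up to it. *)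
Lemma scaled_weightE t k : 0 < t ->
  t * w k ^+ 2 = (t `^ kappa / k.+1%:R) `^ (2 * alpha + 1).
Proof.
move=> t0; rewrite weight_sqrE powRM ?powR_ge0 ?invr_ge0// powR_kappa ?ltW//.
by rewrite -powR_inv1// -powRrM mulN1r.
Qed.

Lemma sum_inv_sqrt m : \sum_(k < m) (Num.sqrt (k.+1%:R : R))^-1 <= 2 * Num.sqrt m%:R.
Proof.
elim: m => [|m IH]; first by rewrite big_ord0 sqrtr0 mulr0.
rewrite big_ord_recr/=; apply: le_trans (lerD IH (lexx _)) _.
set p := Num.sqrt m%:R; set q := Num.sqrt m.+1%:R.
have p0 : 0 <= p by exact: sqrtr_ge0.
have q0 : 0 < q by rewrite sqrtr_gt0 ltr0n.
have e : q ^+ 2 = p ^+ 2 + 1 by rewrite !sqr_sqrtr// -natr1.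
rewrite -lerBrDl -[leLHS]mul1r ler_pdivrMr//.
have : 0 <= (q - p) ^+ 2 by exact: sqr_ge0.
nra.
Qed.

(** Discrete form of comparing the sum with the integral of a power; it follows from - ln(1 - 1 / (k
    + 1)) >= 1 / (k + 1) and exp z >= 1 + z. *)
Lemma powR_telescope k : (0 < k)%N ->
  2 * alpha * k.+1%:R `^ (- (2 * alpha + 1)) <= k%:R `^ (- (2 * alpha)) - k.+1%:R `^ (- (2 * alpha)) :> R.
Proof.
move=> k0; have kR : 0 < (k%:R : R) by rewrite ltr0n.
have k1 : 0 < (k.+1%:R : R) by rewrite ltr0n.
have -> : k.+1%:R `^ (- (2 * alpha + 1)) = k.+1%:R `^ (- (2 * alpha)) / k.+1%:R :> R.
  by rewrite opprD powRD ?powR_inv1// ?(gt_eqF k1) ?implybT.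
set q := k.+1%:R `^ _; have q0 : 0 < q by rewrite powR_gt0.
have -> : k%:R `^ (- (2 * alpha)) = q * expR (2 * alpha * - ln (k%:R / k.+1%:R)).
  rewrite /q /powR !gt_eqF// -expRD ln_div ?posrE//; congr expR; ring.
have h : k.+1%:R^-1 <= - ln (k%:R / k.+1%:R) :> R.
  have -> : k%:R / k.+1%:R = 1 + - k.+1%:R^-1 :> R.
    by rewrite -natr1; field; rewrite natr1 gt_eqF.
  rewrite lerNr; apply: le_ln1Dx; rewrite ltrN2 invf_lt1// ltr1n ltnS.
  exact: k0.
have h2 := expR_ge1Dx (2 * alpha * - ln (k%:R / k.+1%:R)).
have a2 : 0 <= 2 * alpha by move: alpha_gt0; lra.
have h3 : 1 + 2 * alpha * k.+1%:R^-1 <= expR (2 * alpha * - ln (k%:R / k.+1%:R)).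
  by apply: le_trans h2; rewrite lerD2l ler_wpM2l.
have -> : 2 * alpha * (q / k.+1%:R) = q * (1 + 2 * alpha * k.+1%:R^-1) - q by ring.
by rewrite lerD2r ler_wpM2l// ltW.
Qed.

Lemma sum_weight_tail m N : (0 < m)%N ->
  \sum_(m <= k < N) k.+1%:R `^ (- (2 * alpha + 1)) <= m%:R `^ (- (2 * alpha)) / (2 * alpha) :> R.
Proof.
move=> m0; have a2 : 0 < 2 * alpha by move: alpha_gt0; lra.
rewrite ler_pdivlMr// mulrC mulr_sumr.
have [mN|Nm] := leqP m N; last by rewrite big_geq ?powR_ge0// ltnW.
apply: (@le_trans _ _ (\sum_(m <= k < N) - (k.+1%:R `^ (- (2 * alpha)) - k%:R `^ (- (2 * alpha))))).
  rewrite big_nat [leRHS]big_nat; apply: ler_sum => k /andP[mk _]; rewrite opprB.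
  by apply: powR_telescope; exact: leq_trans mk.
by rewrite sumrN telescope_sumr// opprB lerBlDr lerDl powR_ge0.
Qed.

Lemma truncn_ge_half x : 1 <= x -> [/\ (0 < Num.truncn x)%N, (Num.truncn x)%:R <= x &
  x / 2 <= (Num.truncn x)%:R].
Proof.
move=> x1; have /andP[h1 h2] := truncn_itv (le_trans ler01 x1).
have h3 : (0 < Num.truncn x)%N.
  by rewrite -(ltr_nat R); rewrite lt0r; apply/andP; split; last exact: ler0n; apply/eqP => e;
    move: h2; rewrite -natr1 e; lra.
split=> //; have : (1 : R) <= (Num.truncn x)%:R by rewrite ler1n.
by move: h2; rewrite -natr1; lra.
Qed.

(** The sum is cut at the integer part of x = t^(1/(2 alpha + 1)). Below it, ln(1 + y^s) <= ln 2 + s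
    ln y <= 1 + 2 s sqrt y for y = x / (k + 1), and [sum_inv_sqrt] keeps the total linear in x;
    above it, ln(1 + u) <= u and telescoping. *)
Lemma log_complexity_le : exists2 K : R, 2 <= K &
  forall t N, 1 <= t -> tot t N <= K * t `^ kappa.
Proof.
pose B : R := 2 `^ (2 * alpha) / (2 * alpha).
have a2 : 0 < 2 * alpha by move: alpha_gt0; lra.
have B0 : 0 <= B by rewrite divr_ge0 ?powR_ge0// ltW.
exists (1 + 4 * (2 * alpha + 1) + B) => [|t N t1]; first by move: alpha_gt0; lra.
set x := t `^ kappa; have x1 : 1 <= x by exact: powR_kappa_ge1.
have t0 : 0 < t by rewrite (lt_le_trans ltr01).
have [m0 mx xm] := truncn_ge_half x1; set m := Num.truncn x in m0 mx xm.
have x0 : 0 < x by rewrite (lt_le_trans ltr01).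
have u0 k : 0 <= t * w k ^+ 2 by rewrite mulr_ge0 ?(ltW t0)// ltW// weight_sqr_gt0.
have mono M : (N <= M)%N -> tot t N <= tot t M.
  move=> NM; rewrite /log_complexity (big_ord_widen M (fun k => ln (1 + t * w k ^+ 2)))//.
  rewrite big_mkcond/=; apply: ler_sum => k _; case: ifP => // _.
  by rewrite ln_ge0// lerDl.
apply: (le_trans (mono (m + N)%N (leq_addl _ _))).
rewrite /log_complexity -(big_mkord xpredT (fun k => ln (1 + t * w k ^+ 2))).
rewrite [leRHS]mulrDl (big_cat_nat (leq0n m) (leq_addr N m))/=.
apply: lerD.
  rewrite big_mkord.
  apply: (@le_trans _ _ (\sum_(k < m) (1 + 2 * (2 * alpha + 1) * (Num.sqrt x * (Num.sqrt k.+1%:R)^-1)))).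
    apply: ler_sum => k _; have kR : 0 < (k.+1%:R : R) by rewrite ltr0n.
    have y1 : 1 <= x / k.+1%:R.
      rewrite ler_pdivlMr// mul1r; apply: le_trans mx; rewrite ler_nat; exact: ltn_ord.
    rewrite scaled_weightE// -/x -sqrtrV// -sqrtrM ?(ltW x0)//.
    set y := x / _ in y1 *; have y0 : 0 < y by rewrite (lt_le_trans ltr01).
    have z1 : 1 <= y `^ (2 * alpha + 1).
      by apply: powR_ge1 => //; move: alpha_gt0; lra.
    have z0 : 0 < y `^ (2 * alpha + 1) by rewrite (lt_le_trans ltr01).
    apply: (@le_trans _ _ (ln (2 * y `^ (2 * alpha + 1)))).
      by rewrite ler_ln ?posrE ?addr_gt0 ?mulr_gt0//; lra.
    rewrite lnM ?posrE// ln_powR; apply: lerD.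
      have -> : (2 : R) = 1 + 1 by ring.
      by apply: le_ln1Dx; lra.
    rewrite -mulrA (mulrCA 2); apply: ler_wpM2l; first by move: alpha_gt0; lra.
    have sy : 0 < Num.sqrt y by rewrite sqrtr_gt0.
    have e : ln y = 2 * ln (Num.sqrt y).
      by rewrite -{1}(sqr_sqrtr (ltW y0)) lnXn// mulr_natl.
    have : ln (1 + (Num.sqrt y - 1)) <= Num.sqrt y - 1 by apply: le_ln1Dx; lra.
    by rewrite addrC subrK e; lra.
  rewrite big_split/= sumr_const card_ord -mulr_sumr -mulr_sumr.
  have h := sum_inv_sqrt m.
  have sx := sqrtr_ge0 x; have sm : Num.sqrt m%:R <= Num.sqrt x by rewrite ler_wsqrtr.
  have e : Num.sqrt x * \sum_(k < m) (Num.sqrt (k.+1%:R : R))^-1 <= 2 * x.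
    apply: (@le_trans _ _ (Num.sqrt x * (2 * Num.sqrt x))).
      by rewrite ler_wpM2l//; apply: (le_trans h); rewrite ler_wpM2l.
    by rewrite mulrCA -expr2 sqr_sqrtr// ltW.
  have a1 : 0 <= 2 * (2 * alpha + 1) by move: alpha_gt0; lra.
  have := ler_wpM2l a1 e; lra.
apply: (@le_trans _ _ (\sum_(m <= k < m + N) t * k.+1%:R `^ (- (2 * alpha + 1)))).
  apply: ler_sum => k _; rewrite -weight_sqrE; apply: le_ln1Dx.
  by apply: lt_le_trans (u0 k); rewrite ltrN10.
rewrite -mulr_sumr.
apply: (le_trans (ler_wpM2l (ltW t0) (sum_weight_tail _ m0))).
have -> : B * x = t * ((x / 2) `^ (- (2 * alpha)) / (2 * alpha)).
  rewrite -[in RHS](powR_kappa (ltW t0)) -/x powRM ?(ltW x0)// -powR_inv1// -powRrM mulN1r opprK.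
  rewrite powRD; last by rewrite (gt_eqF x0) implybT.
  rewrite powRr1 ?(ltW x0)// powRN /B.
  by field; rewrite !gt_eqF// powR_gt0.
rewrite ler_wpM2l ?(ltW t0)// ler_wpM2r ?invr_ge0 ?(ltW a2)//.
rewrite !powRN lef_pV2 ?posrE ?powR_gt0 ?divr_gt0 ?ltr0n//.
by rewrite ge0_ler_powR ?nnegrE ?(ltW a2)// divr_ge0// ltW.
Qed.

Lemma log_complexity_ge t : 1 <= t -> exists N, ln 2 / 2 * t `^ kappa <= tot t N.
Proof.
move=> t1; set x := t `^ kappa; have x1 : 1 <= x by exact: powR_kappa_ge1.
have [m0 mx xm] := truncn_ge_half x1; set m := Num.truncn x in m0 mx xm.
have t0 : 0 < t by rewrite (lt_le_trans ltr01).
have l2 : 0 <= ln (2 : R) by rewrite ln_ge0// ler1n.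
exists m; apply: (@le_trans _ _ (\sum_(k < m) ln (2 : R))).
  rewrite sumr_const card_ord -[leRHS]mulr_natl (mulrC _ (ln 2)).
  by apply: le_trans (ler_wpM2l l2 xm); rewrite mulrAC -mulrA lexx.
apply: ler_sum => k _; rewrite scaled_weightE// -/x.
have kR : 0 < (k.+1%:R : R) by rewrite ltr0n.
have y1 : 1 <= x / k.+1%:R.
  rewrite ler_pdivlMr// mul1r; apply: le_trans mx; rewrite ler_nat; exact: ltn_ord.
have z1 : 1 <= (x / k.+1%:R) `^ (2 * alpha + 1).
  by apply: powR_ge1 => //; move: alpha_gt0; lra.
by rewrite ler_ln ?posrE//; lra.
Qed.

End eigenvalue_sums.

(** * The concentration function and prior masses *)

Section concentration_bounds.
Context d (Omega : measurableType d) (R : realType) (P : probability Omega R).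
Variables (alpha : R) (Pi : probability (L2 R) R) (b : nat -> Omega -> R).
Hypothesis alpha_gt0 : 0 < alpha.
Hypothesis pc : prior_coordinates P alpha Pi b.
Implicit Types (f g : R -> R) (c u x : nat -> R) (e t K : R).
Local Notation w := (weight alpha).
Local Notation kappa := ((2 * alpha + 1)^-1).
Local Notation tot := (log_complexity alpha).
Local Notation ball e := [set f : L2 R | l2norm f < e].

Definition small_ball_cost e : R := - ln (fine (Pi (ball e))).

Lemma concentrationE (f0 : L2 R) e :
  concentration alpha Pi f0 e = approx_cost alpha f0 e + small_ball_cost e.
Proof. by []. Qed.

Lemma measurable_ball e : measurable (ball e).
Proof.
have -> : ball e = [set f : L2 R | l2norm (f \- (fun=> 0)) < e].
  by apply/seteqP; split => f /=; have -> : f \- (fun=> 0) = f by apply/funext => t /=; rewrite subr0.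
exact: measurable_L2_ball (sqi0 R).
Qed.

Lemma ball_fin_num e : Pi (ball e) \is a fin_num.
Proof. by apply: fin_num_measure; exact: measurable_ball. Qed.

Lemma small_ball_prob_ge K t e : 2 <= K -> (forall t N, 1 <= t -> tot t N <= K * t `^ kappa) ->
  1 <= t -> 0 < e -> 2 * K * t `^ kappa < t * e ^+ 2 ->
  expR (- (K * t `^ kappa)) <= fine (Pi (ball e)).
Proof.
move=> K2 hK t1 e0 te; rewrite -lee_fin fineK ?ball_fin_num// (centered_prior_ball pc e0).
apply: (small_ball_ge pc (t := t)) => [||N|]; first exact: le_trans t1.
- by have := powR_kappa_ge1 alpha_gt0 t1; nra.
- exact: hK.
- by rewrite mulrA.
Qed.

(** Positivity is what makes the logarithm in the concentration function invertible by [expR]. *)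
Lemma small_ball_gt0 e : 0 < e -> 0 < fine (Pi (ball e)).
Proof.
move=> e0; have [K K2 hK] := log_complexity_le alpha_gt0.
(* This [t] has t^(1 - kappa) = y, larger than 2 K / e^2, which is the condition of the small ball
   bound. *)
pose y := 1 + 2 * K / e ^+ 2; pose t := y `^ ((1 - kappa)^-1).
have k0 := kappa_gt0 alpha_gt0.
have k1 : 0 < 1 - kappa by rewrite subr_gt0 invf_lt1; move: alpha_gt0; lra.
have e2 : 0 < e ^+ 2 by rewrite exprn_gt0.
have y1 : 1 <= y by rewrite lerDl divr_ge0 ?(ltW e2)//; lra.
have t1 : 1 <= t by rewrite powR_ge1// invr_ge0 ltW.
have t0 : 0 < t by rewrite (lt_le_trans ltr01).
apply: lt_le_trans (small_ball_prob_ge K2 hK t1 e0 _); first exact: expR_gt0.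
have {2}-> : t = t `^ kappa * y.
  have -> : y = t `^ (1 - kappa).
    by rewrite /t -powRrM mulVf ?gt_eqF// powRr1//; lra.
  by rewrite -powRD ?subrKC ?powRr1 ?(ltW t0)// (gt_eqF t0) implybT.
rewrite mulrC -mulrA ltr_pM2l ?powR_gt0//.
have -> : y * e ^+ 2 = e ^+ 2 + 2 * K by rewrite /y; field; rewrite gt_eqF.
  by rewrite ltrDr.
exact: lt_le_trans y1.
Qed.

Lemma small_ball_expR e : 0 < e -> Pi (ball e) = (expR (- small_ball_cost e))%:E.
Proof.
by move=> e0; rewrite opprK lnK ?posrE ?small_ball_gt0// fineK// ball_fin_num.
Qed.

Lemma small_ball_cost_le K t e : 2 <= K -> (forall t N, 1 <= t -> tot t N <= K * t `^ kappa) ->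
  1 <= t -> 0 < e -> 2 * K * t `^ kappa < t * e ^+ 2 ->
  small_ball_cost e <= K * t `^ kappa.
Proof.
move=> K2 hK t1 e0 te; have := small_ball_prob_ge K2 hK t1 e0 te.
rewrite -lee_fin fineK ?ball_fin_num// small_ball_expR// lee_fin ler_expR; lra.
Qed.

Lemma small_ball_cost_ge0 e : 0 < e -> 0 <= small_ball_cost e.
Proof.
move=> e0; rewrite -oppr_le0 -expR_le1 -lee_fin -small_ball_expR//.
exact: probability_le1 (measurable_ball e).
Qed.

(** Chernoff's bound read backwards: a small ball that is not too unlikely limits the eigenvalues.
    This extracts the cutoff and the growth of n eps^2 from the hypothesis on eps. *)
Lemma log_complexity_le_cost t N e : 0 <= t -> 0 < e ->
  tot t N <= t * e ^+ 2 + 2 * small_ball_cost e.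
Proof.
move=> t0 e0; have := chernoff_sqdist pc (e ^+ 2) N t0.
rewrite -(centered_prior_ball pc e0) small_ball_expR// lee_fin ler_expR; lra.
Qed.

(** One [e] is spent on approximating [f0] by a finite sum, the other on the ball around that sum.
    The slack [dl] in the infimum is then sent to 0. *)
Lemma prior_ball_ge (f0 : L2 R) e : expandable f0 -> 0 < e ->
  expR (- concentration alpha Pi f0 e) <= fine (Pi [set f : L2 R | l2norm (f \- f0) < 2 * e]).
Proof.
move=> ef0 e0; set I := approx_cost alpha f0 e; set S := small_ball_cost e.
have mB : measurable [set f : L2 R | l2norm (f \- f0) < 2 * e].
  by apply: measurable_L2_ball; exact: L2_sqi.
have main (dl : R) : 0 < dl -> expR (- ((I + dl) / 2) - S) <= fine (Pi [set f : L2 R | l2norm (f \- f0) < 2 * e]).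
  move=> d0; have [N [u [hu su]]] := approx_cost_adherent alpha ef0 e0 d0.
  have et := expandable_trig_sum (fun k => w k * u k) N.
  rewrite -lee_fin fineK; last exact: fin_num_measure.
  apply: (@le_trans _ _ (Pi [set f : L2 R | l2norm (f \- trig_sum (fun k => w k * u k) N) < e])); last first.
    apply: le_measure; rewrite ?inE//; first by apply: measurable_L2_ball; exact: et.1.
    move=> f /= h; apply: le_lt_trans (l2norm_distD (L2_sqi f) et.1 (L2_sqi f0)) _.
    by rewrite mulr_natl mulr2n ltrD.
  rewrite (prior_ball pc et e0).
  have -> : coef (trig_sum (fun k => w k * u k) N) = finite_coef alpha u N.
    by apply/funext => k; rewrite coef_trig_sum.
  apply: le_trans (prior_ball_shift_ge pc u N _).
  rewrite -(centered_prior_ball pc e0) small_ball_expR// -EFinM lee_fin -expRD ler_expR.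
  by move: su; rewrite -/I -/S; lra.
have h0 : expR (- (I / 2) - S) <= fine (Pi [set f : L2 R | l2norm (f \- f0) < 2 * e]).
  apply/ler_addgt0Pr => dl d0.
  have := main _ d0; have := expR_ge1Dx (- (dl / 2)).
  have -> : - ((I + dl) / 2) - S = - (I / 2) - S + - (dl / 2) by ring.
  rewrite expRD; set E := expR (_ - S); set F := expR (- (dl / 2)); move=> h1 h2.
  have E1 : E <= 1.
    rewrite expR_le1; have := approx_cost_ge0 alpha ef0 e0; have := small_ball_cost_ge0 e0.
    by rewrite -/I -/S; lra.
  have E0 : 0 <= E by exact: expR_ge0.
  nra.
apply: le_trans h0; rewrite concentrationE ler_expR -/I -/S.
by have := approx_cost_ge0 alpha ef0 e0; rewrite -/I; lra.
Qed.

Lemma prior_ball_le_expR (f0 : L2 R) e : expandable f0 -> 0 < e ->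
  fine (Pi [set f : L2 R | l2norm (f \- f0) < e]) <= expR (- (concentration alpha Pi f0 e / 2)).
Proof.
move=> ef0 e0.
have mB : measurable [set f : L2 R | l2norm (f \- f0) < e].
  by apply: measurable_L2_ball; exact: L2_sqi.
rewrite -lee_fin fineK; last exact: fin_num_measure.
apply: le_trans (prior_ball_le pc ef0 e0) _.
rewrite small_ball_expR// -EFinM lee_fin -expRD ler_expR concentrationE.
by have := small_ball_cost_ge0 e0; lra.
Qed.

Lemma approx_cost_anti (f0 : L2 R) e e' : expandable f0 -> 0 < e -> e <= e' ->
  approx_cost alpha f0 e' <= approx_cost alpha f0 e.
Proof.
move=> ef0 e0 ee; apply/ler_addgt0Pr => dl d0.
have [N [u [hu su]]] := approx_cost_adherent alpha ef0 e0 d0.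
apply: le_trans (ltW su); apply: approx_cost_le.
exact: lt_le_trans ee.
Qed.

Lemma small_ball_cost_anti e e' : 0 < e -> e <= e' -> small_ball_cost e' <= small_ball_cost e.
Proof.
move=> e0 ee; have e'0 : 0 < e' by exact: lt_le_trans ee.
rewrite -[leLHS]opprK lerNl -ler_expR -lee_fin -!small_ball_expR//.
apply: le_measure; rewrite ?inE; [exact: measurable_ball|exact: measurable_ball|].
by move=> f /=; move/lt_le_trans; apply.
Qed.

Lemma concentration_anti (f0 : L2 R) e e' : expandable f0 -> 0 < e -> e <= e' ->
  concentration alpha Pi f0 e' <= concentration alpha Pi f0 e.
Proof.
by move=> ef0 e0 ee; rewrite !concentrationE lerD ?approx_cost_anti ?small_ball_cost_anti.
Qed.

(** Write [f0] as a cheap approximant plus an error of norm below [e]; at high frequencies the small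
    weights bound the energy of the approximant by [rho] times its cost. *)
Lemma signal_tail_le (f0 : L2 R) e dl (J N : nat) (rho : R) : expandable f0 -> 0 < e -> 0 < dl ->
  (forall k, (J <= k)%N -> w k ^+ 2 <= rho) ->
  \sum_(k < N | (J <= k)%N) coef f0 k ^+ 2 <= 2 * e ^+ 2 + 2 * (rho * (approx_cost alpha f0 e + dl)).
Proof.
move=> ef0 e0 d0 hJ; have [M [u [hu su]]] := approx_cost_adherent alpha ef0 e0 d0.
set h := trig_sum _ M in hu.
have et : expandable h by exact: expandable_trig_sum.
have hd := sqiB et.1 (L2_sqi f0).
have rho0 : 0 <= rho by apply: le_trans (hJ J (leqnn J)); exact: sqr_ge0.
have hc k : coef f0 k ^+ 2 <= 2 * coef (h \- f0) k ^+ 2 + 2 * coef h k ^+ 2.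
  rewrite trig_coefB; [|exact: et.1|exact: L2_sqi].
  have : 0 <= (coef f0 k - 2 * coef h k) ^+ 2 by exact: sqr_ge0.
  nra.
apply: (@le_trans _ _ (\sum_(k < N | (J <= k)%N) (2 * coef (h \- f0) k ^+ 2 + 2 * coef h k ^+ 2))).
  by apply: ler_sum => k _.
rewrite big_split/= -!mulr_sumr; apply: lerD; apply: ler_wpM2l => //.
  apply: (@le_trans _ _ (l2norm (h \- f0) ^+ 2)); last first.
    by rewrite ler_pXn2r ?nnegrE ?l2norm_ge0 ?(ltW e0)// ltW.
  apply: le_trans (sum_coef_le N hd); rewrite big_mkcond/=; apply: ler_sum => k _.
  by case: ifP => // _; exact: sqr_ge0.
apply: (@le_trans _ _ (\sum_(k < N) rho * (if (k < M)%N then u k ^+ 2 else 0))).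
  rewrite big_mkcond/=; apply: ler_sum => k _; rewrite coef_trig_sum.
  case: ifP => [/hJ hk|_]; last by rewrite mulr_ge0//; case: ifP => // _; exact: sqr_ge0.
  by case: ifP => _; rewrite ?expr0n/= ?mulr0// exprMn ler_wpM2r ?sqr_ge0.
rewrite -mulr_sumr ler_wpM2l//; apply: le_trans (ltW su).
apply: le_trans (sum_support_le (N := M) (v := fun k => if (k < M)%N then u k ^+ 2 else 0) N _ _) _.
- by move=> k; case: ifP => // _; exact: sqr_ge0.
- by move=> k /negbTE->.
- by apply: ler_sum => k _; rewrite ltn_ord.
Qed.

End concentration_bounds.

(** * Bayes' formula for a dominated family *)

Section bayes_formula.
Context d1 d2 (Th : measurableType d1) (X : measurableType d2) (R : realType).
Variables (Pi : probability Th R) (mu0 : probability X R) (law : Th -> probability X R).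
Variables (p : Th * X -> R) (th0 : Th).
Hypothesis mp : measurable_fun setT p.
Hypothesis p0 : forall z, 0 <= p z.
Hypothesis lawE : forall th A, measurable A ->
  law th A = (\int[mu0]_(x in A) (p (th, x))%:E)%E.
Implicit Types (S : set Th) (A D : set X).

Definition restricted_evidence S (x : X) : \bar R := (\int[Pi]_(th in S) (p (th, x))%:E)%E.
Local Notation num := restricted_evidence.
Local Notation q := (fun x => p (th0, x)).

Definition posterior_mass S (x : X) : R := fine (num S x) / fine (num setT x).

Let F S D (z : Th * X) : \bar R := (p z * \1_S z.1 * \1_D z.2)%:E.

Let F0 S D z : (0 <= F S D z)%E.
Proof. by rewrite lee_fin !mulr_ge0. Qed.

Let mF S D : measurable S -> measurable D -> measurable_fun setT (F S D).
Proof.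
move=> mS mD; apply/measurable_EFinP; apply: measurable_funM; first apply: measurable_funM => //.
- apply: (measurableT_comp (f := \1_S : Th -> R)); first exact: measurable_indic.
  exact: measurable_fst.
- apply: (measurableT_comp (f := \1_D : X -> R)); first exact: measurable_indic.
  exact: measurable_snd.
Qed.

Let mp1 (x : X) : measurable_fun setT (fun th => p (th, x)).
Proof. exact: measurableT_comp mp (pair2_measurable x). Qed.

Let mp2 (th : Th) : measurable_fun setT (fun x => p (th, x)).
Proof. exact: measurableT_comp mp (pair1_measurable th). Qed.

Lemma restricted_evidence_indic S x :
  num S x = (\int[Pi]_th (p (th, x) * \1_S th)%:E)%E.
Proof.
rewrite /restricted_evidence integral_mkcond; apply: eq_integral => th _.
by rewrite epatch_indic EFinM.
Qed.

Let mpS S x : measurable S -> measurable_fun setT (fun th => (p (th, x) * \1_S th)%:E).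
Proof. by move=> mS; apply/measurable_EFinP; apply: measurable_funM. Qed.

Lemma restricted_evidenceE S D x : measurable S ->
  (\int[Pi]_th F S D (th, x) = num S x * (\1_D x)%:E)%E.
Proof.
move=> mS; rewrite restricted_evidence_indic -ge0_integralZr//; last 2 first.
- exact: mpS.
- by move=> th _; rewrite lee_fin mulr_ge0.

Qed.

Lemma restricted_evidence_ge0 S x : (0 <= num S x)%E.
Proof. by apply: integral_ge0 => th _; rewrite lee_fin. Qed.

Lemma measurable_restricted_evidence S : measurable S -> measurable_fun setT (num S).
Proof.
move=> mS; have -> : num S = (fun x => \int[Pi]_th F S setT (th, x))%E.
  by apply/funext => x; rewrite restricted_evidenceE// indicT mule1.
by apply: (@measurable_fun_fubini_tonelli_G _ _ _ _ _ Pi (F S setT)) => [|z]; [exact: mF|exact: F0].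
Qed.

Lemma integral_restricted_evidence S D : measurable S -> measurable D ->
  (\int[mu0]_x (num S x * (\1_D x)%:E) = \int[Pi]_(th in S) law th D)%E.
Proof.
move=> mS mD.
transitivity (\int[mu0]_x \int[Pi]_th F S D (th, x))%E.
  by apply: eq_integral => x _; rewrite restricted_evidenceE.
rewrite -(fubini_tonelli (F S D) (mF mS mD) (F0 S D)) [RHS]integral_mkcond.
apply: eq_integral => th _; rewrite epatch_indic (lawE th mD) [in RHS]integral_mkcond.
rewrite -ge0_integralZr//.
- by apply: eq_integral => x _; rewrite epatch_indic /F /= !EFinM muleAC.
- apply/(measurable_restrictT _ mD); apply: measurable_funTS; exact/measurable_EFinP.
- by move=> x _; rewrite epatch_indic mule_ge0// lee_fin.
- by rewrite lee_fin.
Qed.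

Lemma change_of_law (u : X -> \bar R) : measurable_fun setT u -> (forall x, 0 <= u x)%E ->
  (\int[law th0]_x u x = \int[mu0]_x (u x * (q x)%:E))%E.
Proof.
by move=> mu u0; apply: ge0_integral_density => // A mA; exact: lawE.
Qed.

Lemma restricted_evidence_le S S' x : measurable S -> measurable S' -> S `<=` S' ->
  (num S x <= num S' x)%E.
Proof.
move=> mS mS' SS; rewrite !restricted_evidence_indic; apply: ge0_le_integral => //.
- by move=> th _; rewrite lee_fin mulr_ge0.
- exact: mpS.
- exact: mpS.
move=> th _; rewrite lee_fin ler_wpM2l// !indicE.
have [/set_mem/SS h|_] := boolP (th \in S); last by [].
by rewrite mem_set.
Qed.

Lemma restricted_evidenceU S S' x : measurable S -> measurable S' ->
  (num (S `|` S') x <= num S x + num S' x)%E.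
Proof.
move=> mS mS'; rewrite !restricted_evidence_indic -ge0_integralD//.
- apply: ge0_le_integral => //.
  + by move=> th _; rewrite lee_fin mulr_ge0.
  + by apply: mpS; exact: measurableU.
  + by apply: emeasurable_funD; exact: mpS.
  move=> th _; rewrite -EFinD lee_fin -mulrDr ler_wpM2l// !indicE in_setU.
  by case: (_ \in S); case: (_ \in S'); rewrite //= ?addr0 ?add0r// lerDl.
- by move=> th _; rewrite lee_fin mulr_ge0.
- exact: mpS.
- by move=> th _; rewrite lee_fin mulr_ge0.
- exact: mpS.
Qed.

Lemma measurable_posterior_mass S : measurable S -> measurable_fun setT (posterior_mass S).
Proof.
move=> mS; rewrite /posterior_mass.
have h S' : measurable S' -> measurable_fun setT (fun x => fine (num S' x)).
  by move=> mS'; apply: measurableT_comp => //; exact: measurable_restricted_evidence.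
apply: measurable_funM; first exact: h.
have -> : (fun x => (fine (num setT x))^-1) = (fun x => fine (num setT x) `^ (-1)).
  by apply/funext => x; rewrite powR_inv1// fine_ge0// restricted_evidence_ge0.
by apply: (measurableT_comp (measurable_powR _)); exact: h.
Qed.

Lemma posterior_mass_ge0 S x : 0 <= posterior_mass S x.
Proof. by rewrite divr_ge0// fine_ge0// restricted_evidence_ge0. Qed.

Lemma posterior_mass_le1 S x : measurable S -> posterior_mass S x <= 1.
Proof.
move=> mS; rewrite /posterior_mass.
have h := restricted_evidence_le x mS measurableT (@subsetT _ S).
have := restricted_evidence_ge0 S x; move: h.
(* An infinite evidence has [fine] value 0, hence inverse 0, and the posterior mass is then 0. *)
case: (num setT x) => [r| |]; last by move=> h1 h2; have := le_trans h2 h1.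
- case: (num S x) => [s| |]//; rewrite !lee_fin => sr s0 /=.
  have := le_trans s0 sr; rewrite le_eqVlt => /orP[/eqP r0|r0].
    by rewrite -r0 invr0 mulr0.
  by rewrite ler_pdivrMr// mul1r.
- by rewrite invr0 mulr0.
Qed.

Lemma measurable_law A : measurable A -> measurable_fun setT (fun th => law th A).
Proof.
move=> mA; have -> : (fun th => law th A) = (fun th => \int[mu0]_x F setT A (th, x))%E.
  apply/funext => th; rewrite (lawE th mA) integral_mkcond; apply: eq_integral => x _.
  by rewrite epatch_indic /F /= indicT mulr1 EFinM.
by apply: (@measurable_fun_fubini_tonelli_F _ _ _ _ _ mu0 (F setT A)) => [|z]; [exact: mF|exact: F0].
Qed.

(** Evidence relative to the density at the truth; the product avoids dividing by a density that may
    vanish. *)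
Definition low_evidence (k : R) : set X := [set x | num setT x < (k * q x)%:E]%E.

Lemma measurable_low_evidence k : measurable (low_evidence k).
Proof.
rewrite -[X in measurable X]setTI; apply: measurable_lte => //.
  exact: measurable_restricted_evidence.
by apply/measurable_EFinP; exact: measurable_funM.
Qed.

(** Average the fourth power bound over [B]. By Tonelli the average of the laws of the event is its
    integrated evidence, at most [k] times its probability under the truth; one factor cancels. *)
Lemma low_evidence_law (k c : R) (B : set Th) : 0 <= k -> measurable B -> 0 <= c ->
  (forall th, B th -> fine (law th0 (low_evidence k)) ^+ 4 <= c * fine (law th (low_evidence k))) ->
  fine (law th0 (low_evidence k)) ^+ 3 * fine (Pi B) <= c * k.
Proof.
set A := low_evidence k => k0 mB c0 hB.
have mA : measurable A by exact: measurable_low_evidence.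
have fA th : law th A \is a fin_num by exact: fin_num_measure.
have fB : Pi B \is a fin_num by exact: fin_num_measure.
set a := fine (law th0 A) in hB *; have a0 : 0 <= a by exact: fine_ge0.
have e1 : ((a ^+ 4 * fine (Pi B))%:E <= c%:E * \int[Pi]_(th in B) law th A)%E.
  rewrite EFinM fineK// -integral_cst// -ge0_integralZl//.
  - apply: ge0_le_integral => //.
    + by move=> th _; rewrite /= lee_fin exprn_ge0.
    + apply: emeasurable_funM; first exact: measurable_cst.
      exact/measurable_funTS/measurable_law.
    move=> th Bth /=; rewrite -(fineK (fA th)) -EFinM lee_fin; exact: hB.
  - exact/measurable_funTS/measurable_law.
have e2 : (\int[Pi]_(th in B) law th A <= k%:E * law th0 A)%E.
  rewrite -(integral_restricted_evidence mB mA) (lawE th0 mA).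
  rewrite [X in (_ <= _ * X)%E]integral_mkcond.
  have mqA : measurable_fun setT ((fun x => (q x)%:E) \_ A).
    by apply/(measurable_restrictT _ mA); apply: measurable_funTS; exact/measurable_EFinP.
  have qA0 x : setT x -> (0 <= ((fun x => (q x)%:E) \_ A) x)%E.
    by move=> _; rewrite epatch_indic mule_ge0// lee_fin.
  have k0' : (0 <= k%:E)%E by rewrite lee_fin.
  rewrite -ge0_integralZl//.
  have mA1 : measurable_fun setT (fun x => (\1_A x : R)%:E).
    by apply/measurable_EFinP; exact: measurable_indic.
  apply: ge0_le_integral => //.
  - by move=> x _; rewrite mule_ge0 ?restricted_evidence_ge0// lee_fin.
  - by apply: emeasurable_funM => //; exact: measurable_restricted_evidence.
  - by apply: emeasurable_funM; first exact: measurable_cst.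
  move=> x _; rewrite epatch_indic /= !indicE.
  case: (boolP (x \in A)) => [/set_mem h|_]; last by rewrite !mule0.
  rewrite !mule1 -EFinM; apply: le_trans (ltW h).
  exact: restricted_evidence_le.
have : ((a ^+ 4 * fine (Pi B))%:E <= (c * (k * a))%:E)%E.
  apply: (le_trans e1); rewrite EFinM lee_wpmul2l ?lee_fin//.
  by apply: (le_trans e2); rewrite EFinM fineK.
rewrite lee_fin; move: a0; rewrite le_eqVlt => /orP[/eqP<-|a0] h.
  by rewrite expr0n/= mul0r mulr_ge0.
by rewrite -(ler_pM2l a0) mulrA -exprS; apply: (le_trans h); rewrite mulrA mulrC.
Qed.

Lemma law_null (A : set X) : measurable A -> mu0 A = 0%E -> law th0 A = 0%E.
Proof.
move=> mA A0; rewrite (lawE th0 mA); apply: null_set_integral => //.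
by apply: measurable_funTS; exact/measurable_EFinP.
Qed.

(** By Tonelli the evidence has integral 1 under [mu0], so it is finite almost everywhere, and the
    law of the truth is dominated by [mu0]. *)
Lemma evidence_finite : law th0 [set x | num setT x = +oo%E] = 0%E.
Proof.
have mN := measurable_restricted_evidence measurableT.
have mI : measurable [set x | num setT x = +oo%E].
  have := mN measurableT [set +oo%E] (emeasurable_set1 _); rewrite setTI.
  by congr (measurable _).
have iN : mu0.-integrable setT (num setT).
  apply/integrableP; split=> //.
  have -> : (\int[mu0]_x `|num setT x| = \int[mu0]_x (num setT x * (\1_setT x)%:E))%E.
    by apply: eq_integral => x _; rewrite gee0_abs ?restricted_evidence_ge0// indicT mule1.
  rewrite integral_restricted_evidence//.
  under eq_integral do rewrite probability_setT.
  by rewrite integral_cst//= probability_setT mule1 ltry.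
apply: law_null => //.
have [N [mNN N0 sub]] := integrable_ae measurableT iN.
apply/eqP; rewrite eq_le measure_ge0 andbT -N0; apply: le_measure; rewrite ?inE//.
move=> x /= xoo; apply: sub => /= /(_ I); by rewrite xoo.
Qed.

Lemma density_positive : law th0 [set x | q x = 0] = 0%E.
Proof.
have mZ : measurable [set x | q x = 0].
  have := mp2 th0 measurableT (measurable_set1 (0 : R)); rewrite setTI.
  by congr (measurable _).
rewrite (lawE th0 mZ) integral_mkcond integral0_eq// => x _.
rewrite epatch_indic /= !indicE; case: (boolP (x \in _)) => [/set_mem/= ->|_].
  by rewrite mul0e.
by rewrite mule0.
Qed.

(** Outside the bad events the evidence is finite and at least k q, so the posterior mass of the
    complement of [S] times q is at most 1 / k times an unnormalized integral, whose mean under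
    [mu0] is explicit. *)
Lemma posterior_bound (k : R) S N1 N2 N3 (psi : set X) : 0 < k ->
  measurable S -> measurable N1 -> measurable N2 -> measurable N3 -> measurable psi ->
  (forall th, S th \/ N1 th \/ N2 th \/ N3 th) ->
  (1 <= \int[law th0]_x (posterior_mass S x)%:E + (law th0 (low_evidence k) + law th0 psi) +
    (k^-1)%:E * (Pi N1 + Pi N2 + \int[Pi]_(th in N3) law th (~` psi)))%E.
Proof.
move=> k0 mS mN1 mN2 mN3 mpsi cov.
have mA := measurable_low_evidence k; set A := low_evidence k in mA *.
pose Z := [set x | q x = 0]; pose Inf := [set x | num setT x = +oo%E].
have mN := measurable_restricted_evidence measurableT.
have mI : measurable Inf.
  have := mN measurableT [set +oo%E] (emeasurable_set1 _); rewrite setTI.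
  by congr (measurable _).
have mZ : measurable Z.
  have := mp2 th0 measurableT (measurable_set1 (0 : R)); rewrite setTI.
  by congr (measurable _).
pose Bad := (A `|` psi) `|` (Z `|` Inf).
have mBad : measurable Bad by apply: measurableU; apply: measurableU.
pose G := ~` Bad; have mG : measurable G by exact: measurableC.
have bad_le : (law th0 Bad <= law th0 A + law th0 psi)%E.
  have u1 : (law th0 Bad <= law th0 (A `|` psi) + law th0 (Z `|` Inf))%E.
    by apply: measureU2; exact: measurableU.
  have u2 : (law th0 (A `|` psi) <= law th0 A + law th0 psi)%E by exact: measureU2.
  have u3 : (law th0 (Z `|` Inf) <= law th0 Z + law th0 Inf)%E by exact: measureU2.
  by rewrite density_positive evidence_finite adde0 in u3; apply: (le_trans u1); rewrite -[leRHS]adde0 leeD.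
have one : (1 <= law th0 G + law th0 Bad)%E.
  rewrite -(@probability_setT _ _ _ (law th0)) -(setvU Bad).
  by apply: measureU2.
(* [N1] and [N2] are charged by their prior mass alone; [N3] is charged only where the test [psi]
   accepts, which brings in its error under the alternatives. *)
pose V x : \bar R := (num N1 x + num N2 x + num N3 x * (\1_(~` psi) x)%:E)%E.
have V0 x : (0 <= V x)%E.
  have h S' := restricted_evidence_ge0 S' x.
  by apply: adde_ge0; [exact: adde_ge0|apply: mule_ge0 => //; rewrite lee_fin].
have m1psi : measurable_fun setT (fun x => (\1_(~` psi) x : R)%:E).
  by apply/measurable_EFinP; apply: measurable_indic; exact: measurableC.
have mV : measurable_fun setT V.
  apply: emeasurable_funD; first by apply: emeasurable_funD; exact: measurable_restricted_evidence.
  by apply: emeasurable_funM => //; exact: measurable_restricted_evidence.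
have mq : measurable_fun setT (fun x => (q x)%:E) by exact/measurable_EFinP.
have mpost : measurable_fun setT (fun x => (posterior_mass S x)%:E).
  by apply/measurable_EFinP; exact: measurable_posterior_mass.
have post0 x : (0 <= (posterior_mass S x)%:E)%E by rewrite lee_fin posterior_mass_ge0.
have key : (law th0 G <= \int[mu0]_x ((posterior_mass S x)%:E * (q x)%:E + (k^-1)%:E * V x))%E.
  rewrite (measure_integral_indic (law th0) mG) change_of_law; last 2 first.
  - by apply/measurable_EFinP; exact: measurable_indic.
  - by move=> x; rewrite lee_fin.
  have m1G : measurable_fun setT (fun x => (\1_G x : R)%:E).
    by apply/measurable_EFinP; exact: measurable_indic.
  apply: ge0_le_integral => //.
  - by move=> x _; rewrite -EFinM lee_fin mulr_ge0.
  - exact: emeasurable_funM.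
  - apply: emeasurable_funD; first exact: emeasurable_funM.
    by apply: emeasurable_funM => //; exact: measurable_cst.
  move=> x _; rewrite indicE; case: (boolP (x \in G)) => [/set_mem xG|_]; last first.
    rewrite mul0e adde_ge0 ?mule_ge0 ?V0//; rewrite lee_fin//.
    by rewrite invr_ge0 ltW.
  rewrite mul1e.
  have nA : ~ A x by move=> h; apply: xG; left; left.
  have npsi : ~ psi x by move=> h; apply: xG; left; right.
  have q0 : 0 < q x by rewrite lt0r p0 andbT; apply/eqP => h; apply: xG; right; left.
  have nInf : num setT x <> +oo%E by move=> h; apply: xG; right; right.
  have T0 := restricted_evidence_ge0 setT x.
  have fT : num setT x \is a fin_num by rewrite ge0_fin_numE// ltey; apply/eqP.
  have kT : (k * q x <= fine (num setT x))%R.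
    by rewrite leNgt; apply/negP => h; apply: nA; rewrite /A /low_evidence /= -(fineK fT) lte_fin.
  have fin S' : measurable S' -> num S' x \is a fin_num.
    move=> mS'; rewrite ge0_fin_numE ?restricted_evidence_ge0//.
    by apply: le_lt_trans (restricted_evidence_le x mS' measurableT (@subsetT _ _)) _; rewrite -ge0_fin_numE.
  have cover : (num setT x <= num S x + (num N1 x + num N2 x + num N3 x))%E.
    have -> : setT = S `|` ((N1 `|` N2) `|` N3).
      by apply/seteqP; split => // th _; have [?|[?|[?|?]]] := cov th;
        [left|right; left; left|right; left; right|right; right].
    apply: le_trans (restricted_evidenceU _ _ _) _ => //.
      by apply: measurableU => //; exact: measurableU.
    apply: leeD2l; apply: le_trans (restricted_evidenceU _ _ _) _ => //; first exact: measurableU.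
    by apply: leeD2r; exact: restricted_evidenceU.
  have psi1 : \1_(~` psi) x = 1 :> R by rewrite indicE mem_set.
  rewrite /V psi1 mule1 /posterior_mass.
  have T1 : 0 < fine (num setT x) by apply: lt_le_trans kT; rewrite mulr_gt0.
  move: cover kT T1; rewrite -(fineK (fin _ mS)) -(fineK (fin _ mN1)) -(fineK (fin _ mN2)) -(fineK (fin _ mN3)) -(fineK fT) /=.
  set t := fine (num setT x); set s := fine (num S x).
  rewrite -!EFinD lee_fin; set n1 := _ + _ + _ => cover kT t0.
  have n0 : 0 <= n1 by rewrite !addr_ge0// fine_ge0// restricted_evidence_ge0.
  have h1 : q x / t <= k^-1 by rewrite ler_pdivrMr// ler_pdivlMl.
  have e : q x = s / t * q x + (q x / t) * (t - s) by field; rewrite gt_eqF.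
  have {}e : q x <= s / t * q x + k^-1 * n1.
    rewrite {1}e lerD2l; apply: (@le_trans _ _ (q x / t * n1)); last by rewrite ler_wpM2r.
    by rewrite ler_wpM2l ?divr_ge0 ?(ltW t0) ?(ltW q0)//; lra.
  by move: e; rewrite -lee_fin EFinD (EFinM (s / t)) (EFinM k^-1).
apply: (le_trans one).
have -> : (\int[law th0]_x (posterior_mass S x)%:E = \int[mu0]_x ((posterior_mass S x)%:E * (q x)%:E))%E.
  exact: change_of_law.
have intV : (\int[mu0]_x V x <= Pi N1 + Pi N2 + \int[Pi]_(th in N3) law th (~` psi))%E.
  have tot S' : measurable S' -> (\int[mu0]_x num S' x = Pi S')%E.
    move=> mS'; transitivity (\int[mu0]_x (num S' x * (\1_setT x)%:E))%E.
      by apply: eq_integral => x _; rewrite indicT mule1.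
    rewrite integral_restricted_evidence//.
    under eq_integral do rewrite probability_setT.
    by rewrite integral_cst// mul1e.
  rewrite /V ge0_integralD//.
  - rewrite ge0_integralD//.
    + rewrite !tot// integral_restricted_evidence//; exact: measurableC.
    + by move=> x _; exact: restricted_evidence_ge0.
    + exact: measurable_restricted_evidence.
    + by move=> x _; exact: restricted_evidence_ge0.
    + exact: measurable_restricted_evidence.
  - by move=> x _; rewrite adde_ge0 ?restricted_evidence_ge0.
  - by apply: emeasurable_funD; exact: measurable_restricted_evidence.
  - by move=> x _; rewrite mule_ge0 ?restricted_evidence_ge0// lee_fin.
  - by apply: emeasurable_funM => //; exact: measurable_restricted_evidence.
have k1 : (0 <= (k^-1)%:E)%E by rewrite lee_fin invr_ge0 ltW.
have split_int : (\int[mu0]_x ((posterior_mass S x)%:E * (q x)%:E + (k^-1)%:E * V x) =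
    \int[mu0]_x ((posterior_mass S x)%:E * (q x)%:E) + (k^-1)%:E * \int[mu0]_x V x)%E.
  rewrite ge0_integralD//.
  - by rewrite ge0_integralZl.
  - by move=> x _; rewrite mule_ge0// lee_fin.
  - exact: emeasurable_funM.
  - by move=> x _; rewrite mule_ge0.
  - by apply: emeasurable_funM => //; exact: measurable_cst.
apply: (le_trans (leeD key bad_le)); rewrite split_int [leLHS]addeAC.
by apply: leeD2l; exact: lee_wpmul2l.
Qed.

End bayes_formula.

(** * Cutoff frequency and energy beyond it *)

Section prior_sieve.
Context d' (T' : measurableType d') (R : realType) (P' : probability T' R).
Variables (alpha : R) (Pi : probability (L2 R) R) (b : nat -> T' -> R).
Hypothesis alpha_gt0 : 0 < alpha.
Hypothesis pc : prior_coordinates P' alpha Pi b.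
Variable n : nat.
Hypothesis n_gt0 : (0 < n)%N.
Variables (f0 : L2 R) (eps : R).
Hypothesis ef0 : expandable f0.
Hypothesis eps_gt0 : 0 < eps.
Hypothesis cost : concentration alpha Pi f0 eps <= n%:R * eps ^+ 2.
Local Notation w := (weight alpha).
Local Notation v := (n%:R * eps ^+ 2 : R).

Let nR : 0 < (n%:R : R). Proof. by rewrite ltr0n. Qed.
Let ac0 := approx_cost_ge0 alpha ef0 eps_gt0.
Let sb0 := small_ball_cost_ge0 alpha_gt0 pc eps_gt0.

Lemma small_ball_cost_le_v : small_ball_cost Pi eps <= v.
Proof. by move: cost; rewrite concentrationE; move: ac0; lra. Qed.

Lemma approx_cost_le_v : approx_cost alpha f0 eps <= v.
Proof. by move: cost; rewrite concentrationE; move: sb0; lra. Qed.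

Lemma log_complexity_le_v N : log_complexity alpha n%:R N <= 3 * v.
Proof.
have := log_complexity_le_cost alpha_gt0 pc N (ltW nR) eps_gt0.
by move: small_ball_cost_le_v; lra.
Qed.

Lemma weight_sqr_anti k l : (k <= l)%N -> w l ^+ 2 <= w k ^+ 2.
Proof.
move=> kl; rewrite !weight_sqrE !powRN lef_pV2 ?posrE ?powR_gt0//.
rewrite ge0_ler_powR ?nnegrE ?ler_nat//; move: alpha_gt0; lra.
Qed.

(** [J] is the first index whose eigenvalue times n is at most 1. Each earlier index contributes at
    least ln 2 to the log-determinant, and later ones satisfy u <= 2 ln(1 + u), so the bound 3 v on
    the log-determinant controls both. *)
Lemma cutoff_exists : exists J : nat, [/\ J%:R * ln 2 <= 3 * v,
  forall k, (J <= k)%N -> n%:R * w k ^+ 2 <= 1 &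
  forall N, n%:R * \sum_(k < N | (J <= k)%N) w k ^+ 2 <= 6 * v].
Proof.
have ex : exists k, n%:R * w k ^+ 2 <= 1.
  (* Index n works because (n + 1)^(2 alpha + 1) >= n. *)
  exists n; rewrite weight_sqrE powRN ler_pdivrMr ?powR_gt0// mul1r.
  apply: (@le_trans _ _ n.+1%:R); first by rewrite ler_nat.
  by apply: le1r_powR; [rewrite ler1n|move: alpha_gt0; lra].
case: (ex_minnP ex) => J hJ minJ; exists J.
have hk k : (J <= k)%N -> n%:R * w k ^+ 2 <= 1.
  by move=> /weight_sqr_anti h; apply: le_trans hJ; rewrite ler_pM2l.
split=> // [|N].
  apply: le_trans (log_complexity_le_v J).
  rewrite mulr_natl -{1}(card_ord J) -sumr_const; apply: ler_sum => k _.
  have : 1 < n%:R * w k ^+ 2 by rewrite ltNge; apply/negP => /minJ; rewrite leqNgt ltn_ord.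
  by move=> h; rewrite ler_ln ?posrE; lra.
have := log_complexity_le_v N => h; apply: (@le_trans _ _ (2 * log_complexity alpha n%:R N)); last lra.
rewrite /log_complexity big_mkcond/= !mulr_sumr; apply: ler_sum => k _.
have u0 : 0 <= n%:R * w k ^+ 2 by rewrite mulr_ge0// ltW// weight_sqr_gt0.
case: ifP => [/hk u1|_]; last by rewrite mulr0 mulr_ge0// ln_ge0// lerDl.
set u := n%:R * w k ^+ 2 in u0 u1 *.
(* It remains that exp(u / 2) <= 1 + u on [0, 1]: the left side times 1 - u / 2 is at most 1, which
   is at most (1 + u)(1 - u / 2). *)
rewrite -ler_pdivrMl// -ler_expR lnK ?posrE; last lra.
have e0 := expR_gt0 (2^-1 * u); have := expR_ge1Dx (- (2^-1 * u)).
rewrite expRN => hh.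
have e1 : expR (2^-1 * u) * (1 - 2^-1 * u) <= 1.
  by rewrite mulrC -ler_pdivlMr// mul1r.
have : expR (2^-1 * u) * (1 - 2^-1 * u) <= (1 + u) * (1 - 2^-1 * u) by nra.
by rewrite ler_pM2r//; lra.
Qed.

(** Polarization expresses the inner product through distances, whose sublevel sets are open
    balls. *)
Lemma measurable_inner (g : R -> R) : square_integrable g ->
  measurable_fun setT (fun f : L2 R => inner f g).
Proof.
move=> hg; pose g' x : R := -1 * g x.
have hg' : square_integrable g' by exact: sqiZ.
have -> : (fun f : L2 R => inner f g) =
    (fun f : L2 R => (l2norm (f \- g') ^+ 2 - l2norm (f \- g) ^+ 2) / 4).
  apply/funext => f; have hf := L2_sqi f.
  rewrite !l2norm_sqr; [|exact: sqiB..].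
  rewrite !innerBl ?(innerC _ (_ \- _)) ?innerBl//; try exact: sqiB.
  have e h : square_integrable h -> inner g' h = - inner g h.
    by move=> hh; rewrite innerZl// mulN1r.
  by rewrite (innerC f g') !e// (innerC g g') e// (innerC f g); field.
by apply: measurable_funM => //; apply: measurable_funB; apply: measurable_funX; exact: measurable_l2dist.
Qed.

Lemma measurable_coef k : measurable_fun setT (fun f : L2 R => coef f k).
Proof. by apply: measurable_inner; exact: sqi_trig. Qed.

(** The functions whose difference from [f0] lies too much beyond the cutoff to be seen by the
    test. *)
Definition low_energy J : set (L2 R) :=
  [set f | \sum_(k < J) coef (f \- f0) k ^+ 2 < 3 / 4 * l2norm (f \- f0) ^+ 2].

Lemma measurable_dist : measurable_fun setT (fun f : L2 R => l2norm (f \- f0)).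
Proof. exact: measurable_l2dist (L2_sqi f0). Qed.

Lemma measurable_low_energy J : measurable (low_energy J).
Proof.
have m1 : measurable_fun setT (fun f : L2 R => \sum_(k < J) coef (f \- f0) k ^+ 2).
  have -> : (fun f : L2 R => \sum_(k < J) coef (f \- f0) k ^+ 2) =
      (fun f : L2 R => \sum_(k < J) (coef f k - coef f0 k) ^+ 2).
    by apply/funext => f; apply: eq_bigr => k _; rewrite trig_coefB//; exact: L2_sqi.
  apply: measurable_sum => k; apply: measurable_funX; apply: measurable_funB => //.
  exact: measurable_coef.
have m2 : measurable_fun setT (fun f : L2 R => \sum_(k < J) coef (f \- f0) k ^+ 2 - 3 / 4 * l2norm (f \- f0) ^+ 2).
  apply: measurable_funB => //; apply: measurable_funM => //; apply: measurable_funX.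
  exact: measurable_dist.
have := measurable_lt_set m2 0; congr measurable; apply/seteqP; split => f /=;
  by rewrite /low_energy/= subr_lt0.
Qed.

Definition far (r : R) : set (L2 R) := [set f | r < l2norm (f \- f0)].

Lemma measurable_far r : measurable (far r).
Proof. by apply: measurable_gt_set; exact: measurable_dist. Qed.

Lemma low_energy_far_prior J r : J%:R * ln 2 <= 3 * v ->
  (forall k, (J <= k)%N -> n%:R * w k ^+ 2 <= 1) ->
  (forall N, n%:R * \sum_(k < N | (J <= k)%N) w k ^+ 2 <= 6 * v) ->
  0 <= r -> 304 * eps ^+ 2 <= r ^+ 2 ->
  (Pi (low_energy J `&` far r) <= (expR (- 5 * v))%:E)%E.
Proof.
(* In [tail_bound] this gives the exponent 6 v / 2 - 32 v / 4 = - 5 v. *)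
move=> hJ hk hN r0 hr; pose rho := 32 * eps ^+ 2.
pose Tl := [set f : L2 R | exists N, rho < \sum_(k < N | (J <= k)%N) coef f k ^+ 2].
have mTl : measurable Tl.
  have -> : Tl = \bigcup_N [set f : L2 R | rho < \sum_(k < N | (J <= k)%N) coef f k ^+ 2].
    by apply/seteqP; split => f; [move=> [N h]; exists N|move=> [N _ h]; exists N].
  apply: bigcupT_measurable => N; apply: measurable_gt_set.
  have -> : (fun f : L2 R => \sum_(k < N | (J <= k)%N) coef f k ^+ 2) =
      (fun f : L2 R => \sum_(k < N) (if (J <= k)%N then coef f k ^+ 2 else 0)).
    by apply/funext => f; rewrite big_mkcond.
  apply: measurable_sum => k; case: (J <= k)%N => //.
  by apply: measurable_funX; exact: measurable_coef.
have mB : measurable (low_energy J `&` far r).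
  by apply: measurableI; [exact: measurable_low_energy|exact: measurable_far].
have PT : (Pi Tl <= (expR (- 5 * v))%:E)%E.
  have -> : Pi Tl = P' (seq_of b @^-1` tail_gt alpha J rho).
    apply: pc.2 => //; first exact: measurable_tail_gt.
    move=> f _ x cx.
    have E N : \sum_(k < N | (J <= k)%N) coef f k ^+ 2 = \sum_(k < N | (J <= k)%N) (w k * x k) ^+ 2.
      by apply: eq_bigr => k _; rewrite cx.
    by split=> -[N h]; exists N; rewrite ?E// -E.
  apply: le_trans (tail_bound pc rho (ltW nR) hk hN) _.
  by rewrite lee_fin ler_expR /rho; lra.
(* No expandable function lies in this set, so it corresponds to the empty event on sequences. *)
have null : Pi ((low_energy J `&` far r) `\` Tl) = 0%E.
  have -> : Pi ((low_energy J `&` far r) `\` Tl) = P' (seq_of b @^-1` set0).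
    apply: pc.2 => //; first exact: measurableD.
    move=> f ef x _; split=> // -[[hlow hfar] hT].
    have efd := expandableB ef ef0; have hd := efd.1.
    have tf N : \sum_(k < N | (J <= k)%N) coef f k ^+ 2 <= rho.
      by rewrite leNgt; apply/negP => h; apply: hT; exists N.
    have v0 : 0 < v by rewrite mulr_gt0// exprn_gt0.
    have wn k : (J <= k)%N -> w k ^+ 2 <= n%:R^-1.
      by move=> /hk; rewrite -ler_pdivlMl// mulr1.
    have t0 N : \sum_(k < N | (J <= k)%N) coef f0 k ^+ 2 <= 6 * eps ^+ 2.
      apply: le_trans (signal_tail_le N ef0 eps_gt0 v0 wn) _.
      have h : n%:R^-1 * (approx_cost alpha f0 eps + v) <= 2 * eps ^+ 2.
        by rewrite ler_pdivrMl//; move: approx_cost_le_v; lra.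
      lra.
    (* Here 76 = 2 * 32 + 2 * 6 bounds the tails of [f] and [f0]. With less than 3 / 4 of the energy
       below the cutoff, the squared distance stays below 4 * 76 = 304 times eps^2, contrary to
       [far]. *)
    have : l2norm (f \- f0) ^+ 2 <= \sum_(k < J) coef (f \- f0) k ^+ 2 + 76 * eps ^+ 2.
      apply: l2norm_sqr_le => // N.
      apply: (@le_trans _ _ (\sum_(k < J + N) coef (f \- f0) k ^+ 2)).
        rewrite (big_ord_widen (J + N) (fun k => coef (f \- f0) k ^+ 2)) ?leq_addl//.
        by rewrite big_mkcond/=; apply: ler_sum => k _; case: ifP => // _; exact: sqr_ge0.
      rewrite big_split_ord/= lerD2l.
      apply: (@le_trans _ _ (\sum_(k < J + N | (J <= k)%N) (2 * coef f k ^+ 2 + 2 * coef f0 k ^+ 2))).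
        rewrite [leRHS]big_mkcond big_split_ord/= [X in _ <= X + _]big1 ?add0r; last first.
          by move=> k _; rewrite leqNgt ltn_ord.
        apply: ler_sum => k _; rewrite leq_addr trig_coefB; [|exact: L2_sqi|exact: L2_sqi].
        have : 0 <= (coef f (J + k) + coef f0 (J + k)) ^+ 2 by exact: sqr_ge0.
        nra.
      rewrite big_split/= -!mulr_sumr; have := tf (J + N)%N; have := t0 (J + N)%N; rewrite /rho; lra.
    move: hlow hfar; rewrite /low_energy /far /= => hlow hfar.
    have : r ^+ 2 < l2norm (f \- f0) ^+ 2 by rewrite ltr_pXn2r ?nnegrE ?l2norm_ge0.
    lra.
  by rewrite preimage_set0 measure0.
apply: le_trans PT; rewrite -[leRHS]adde0 -null.
apply: (@le_trans _ _ (Pi (Tl `|` ((low_energy J `&` far r) `\` Tl)))).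
  apply: le_measure; rewrite ?inE//; first by apply: measurableU => //; exact: measurableD.
  by move=> f hf; have [?|?] := pselect (Tl f); [left|right].
by apply: measureU2 => //; exact: measurableD.
Qed.

End prior_sieve.

(** * The posterior mass of an annulus for fixed n *)

Section posterior_core.
Context d (T : measurableType d) (R : realType) (P : probability T R).
Context d' (T' : measurableType d') (P' : probability T' R).
Variables (alpha : R) (Pi : probability (L2 R) R) (b : nat -> T' -> R).
Hypothesis alpha_gt0 : 0 < alpha.
Hypothesis pc : prior_coordinates P' alpha Pi b.
Variables (W : R -> {RV P >-> R}) (n : nat) (p : L2 R * trajectory R -> R).
Hypothesis BM : brownian_motion W.
Hypothesis n_gt0 : (0 < n)%N.
Hypothesis lik : likelihood W n p.
Variables (f0 : L2 R).
Hypothesis ef0 : expandable f0.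

Definition data (f : R -> R) : {mfun T >-> trajectory R} :=
  HB.pack (white_noise W n f) (isMeasurableFun.Build _ _ T (trajectory R)
    (white_noise W n f) (measurable_white_noise W n f)).

Definition data_law (f : R -> R) : probability (trajectory R) R := distribution P (data f).

Lemma data_lawE (f : R -> R) A : data_law f A = P (white_noise W n f @^-1` A).
Proof. by []. Qed.

Lemma data_law_density (f : L2 R) A : measurable A ->
  data_law f A = (\int[data_law (cst 0%R)]_(x in A) (p (f, x))%:E)%E.
Proof.
have [mp p0 pE] := lik; move=> mA; rewrite data_lawE (pE f A mA).
rewrite /data_law /distribution.
rewrite (@ge0_integral_pushforward _ _ _ _ _ _ (measurable_white_noise W n (cst 0%R)) P A (fun x => (p (f, x))%:E) mA)//.
- by apply: measurable_funTS; apply/measurable_EFinP; exact: measurableT_comp mp (pair1_measurable f).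
- by move=> x _; rewrite lee_fin.
Qed.

Lemma measurable_posterior S : measurable S -> measurable_fun setT (posterior Pi p S : trajectory R -> R).
Proof.
have [mp p0 pE] := lik; move=> mS.
exact: (@measurable_posterior_mass _ _ _ _ R Pi p mp p0 S mS).
Qed.

Lemma posterior_expectationE S : measurable S ->
  ('E_P[fun t => posterior Pi p S (white_noise W n f0 t)] =
   \int[data_law f0]_x (posterior Pi p S x)%:E)%E.
Proof.
have [mp p0 pE] := lik; move=> mS; rewrite unlock.
rewrite /data_law /distribution.
rewrite (@ge0_integral_pushforward _ _ _ _ _ _ (measurable_white_noise W n f0) P setT
  (fun x => (posterior Pi p S x)%:E) measurableT)//.
- by apply/measurable_EFinP; exact: measurable_posterior.
- by move=> x _; rewrite lee_fin; exact: (posterior_mass_ge0 Pi p0).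
Qed.

Lemma measurable_annulus a c : measurable (annulus f0 a c).
Proof.
have md : measurable_fun setT (fun f : L2 R => l2norm (f \- f0)) by exact: measurable_l2dist (L2_sqi f0).
have -> : annulus f0 a c = [set f | a <= l2norm (f \- f0)] `&` [set f | l2norm (f \- f0) <= c].
  by apply/seteqP; split => f /=; rewrite /annulus /=; [move=> /andP[]|move=> [-> ->]].
by apply: measurableI; [exact: (measurable_ge_set md)|exact: (measurable_le_set md)].
Qed.

Lemma posterior_expectation_le1 S : measurable S ->
  ('E_P[fun t => posterior Pi p S (white_noise W n f0 t)] <= 1)%E.
Proof.
have [mp p0 pE] := lik; move=> mS; rewrite posterior_expectationE//.
rewrite -(@probability_setT _ _ _ (data_law f0)) -[leRHS]mul1e -integral_cst//.
apply: ge0_le_integral => //.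
- by move=> x _; rewrite lee_fin; exact: (posterior_mass_ge0 Pi p0).
- by apply/measurable_EFinP; exact: measurable_posterior.
- by move=> x _; rewrite lee_fin; exact: (posterior_mass_le1 Pi mp p0).
Qed.

Variables (eps zeta r : R).
Hypotheses (eps_gt0 : 0 < eps) (zeta_gt0 : 0 < zeta) (r_gt0 : 0 < r).
Hypothesis cost : concentration alpha Pi f0 eps <= n%:R * eps ^+ 2.
Hypothesis cost_zeta : 9 * (n%:R * eps ^+ 2) <= concentration alpha Pi f0 zeta.
Hypothesis rE : 1664 * eps ^+ 2 <= r ^+ 2.
Local Notation v := (n%:R * eps ^+ 2 : R).

Let v_gt0 : 0 < v. Proof. by rewrite mulr_gt0 ?exprn_gt0// ltr0n. Qed.

(** The exponents are 8 / 3 from the change of signal over radius 2 eps, - 4 from the threshold and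
    1 from the prior mass of the ball: the cube of the probability is at most exp(- v / 3). *)
Lemma low_evidence_unlikely :
  fine (data_law f0 (low_evidence Pi p f0 (expR (- 4 * v)))) <= expR (- (v / 9)).
Proof.
have [mp p0 pE] := lik.
set k := expR _; set A := low_evidence _ _ _ _; set a := fine _.
have mA : measurable A.
  exact: (@measurable_low_evidence _ _ _ _ R Pi p f0 mp p0).
pose B := [set f : L2 R | l2norm (f \- f0) < 2 * eps].
have mB : measurable B by apply: measurable_L2_ball; exact: L2_sqi.
have a0 : 0 <= a by exact: fine_ge0.
have := @low_evidence_law _ _ _ _ R Pi (data_law (cst 0%R)) (fun f : L2 R => data_law f) p f0 mp p0 data_law_density
  k (expR (8 / 3 * v)) B (expR_ge0 _) mB (expR_ge0 _).
rewrite -/A -/a => /(_ _)/wrap[].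
  move=> f Bf; apply: le_trans (change_of_signal BM n_gt0 (L2_sqi f) (L2_sqi f0) mA) _.
  rewrite ler_wpM2r ?fine_ge0// ler_expR.
  have : l2norm (f \- f0) ^+ 2 <= (2 * eps) ^+ 2.
    by rewrite ler_pXn2r ?nnegrE ?l2norm_ge0 ?mulr_ge0 ?(ltW eps_gt0)// ltW.
  rewrite exprMn => h; have := ler_wpM2l (ler0n R n) h; lra.
move=> h; have pB := prior_ball_ge alpha_gt0 pc ef0 eps_gt0.
rewrite -/B in pB.
have Bv : expR (- v) <= fine (Pi B).
  by apply: le_trans pB; rewrite ler_expR lerN2.
have h2 : a ^+ 3 * expR (- v) <= expR (8 / 3 * v) * k.
  by apply: le_trans h; rewrite ler_wpM2l// exprn_ge0.
have h3 : a ^+ 3 <= expR (- (v / 9)) ^+ 3.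
  rewrite -expRM_natl -(ler_pM2r (expR_gt0 (- v))); apply: (le_trans h2).
  by rewrite /k -!expRD ler_expR; lra.
by rewrite -(@ler_pXn2r _ 3)// nnegrE ?expR_ge0.
Qed.

Lemma posterior_core :
  (1 - (5 * expR (- (v / 9)))%:E <=
   'E_P[fun t => posterior Pi p (annulus f0 zeta r) (white_noise W n f0 t)])%E.
Proof.
have [mp p0 pE] := lik.
have [J [hJ hk hN]] := cutoff_exists alpha_gt0 pc n_gt0 ef0 eps_gt0 cost.
have [m m0 close] := step_trig_close R J.
(* The test errors have exponent 3 v / 2 - 104 v / 16 = - 5 v, and 1664 = 16 * 104 is the separation
   that the second error requires. *)
pose psi := reject m J f0 (104 * eps ^+ 2).
have mpsi : measurable psi by exact: measurable_reject.
pose N1 := [set f : L2 R | l2norm (f \- f0) < zeta].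
pose N2 := low_energy f0 J `&` far f0 r.
pose N3 := ~` low_energy f0 J `&` far f0 r.
have mN1 : measurable N1 by apply: measurable_L2_ball; exact: L2_sqi.
have mN2 : measurable N2 by apply: measurableI; [exact: measurable_low_energy|exact: measurable_far].
have mN3 : measurable N3.
  by apply: measurableI; [apply: measurableC; exact: measurable_low_energy|exact: measurable_far].
pose k := expR (- 4 * v).
have cov f : annulus f0 zeta r f \/ N1 f \/ N2 f \/ N3 f.
  rewrite /annulus /N1 /N2 /N3 /far /=.
  have [h1|h1] := ltP (l2norm (f \- f0)) zeta; first by right; left.
  have [h2|h2] := leP (l2norm (f \- f0)) r; first by left.
  by right; right; have [?|?] := pselect (low_energy f0 J f); [left|right].
have := @posterior_bound _ _ _ _ R Pi (data_law (cst 0%R)) (fun f : L2 R => data_law f) p f0 mp p0 data_law_density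
  k _ N1 N2 N3 psi (expR_gt0 _) (measurable_annulus zeta r) mN1 mN2 mN3 mpsi cov.
rewrite -(posterior_expectationE (measurable_annulus zeta r)).
set A := low_evidence _ _ _ _; set E := ('E_P[_])%E.
have mA : measurable A.
  exact: (@measurable_low_evidence _ _ _ _ R Pi p f0 mp p0).
have hA : (data_law f0 A <= (expR (- (v / 9)))%:E)%E.
  by rewrite -[leLHS]fineK ?fin_num_measure// lee_fin; exact: low_evidence_unlikely.
have e5 : J%:R / 2 * ln 2 - n%:R * (104 * eps ^+ 2) / 16 <= - 5 * v by lra.
have hpsi : (data_law f0 psi <= (expR (- 5 * v))%:E)%E.
  rewrite data_lawE.
  apply: le_trans (reject_error1 BM pc.1 n_gt0 m0 close _ (L2_sqi f0)) _.
  by rewrite lee_fin ler_expR.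
have h1 : (Pi N1 <= (expR (- (9 / 2 * v)))%:E)%E.
  rewrite -[leLHS]fineK ?fin_num_measure// lee_fin.
  apply: le_trans (prior_ball_le_expR alpha_gt0 pc ef0 zeta_gt0) _.
  by rewrite ler_expR; move: cost_zeta; lra.
have e2 : 0 <= eps ^+ 2 by exact: sqr_ge0.
have h2 : (Pi N2 <= (expR (- 5 * v))%:E)%E.
  by apply: (low_energy_far_prior alpha_gt0 pc n_gt0 ef0 eps_gt0 cost hJ hk hN (ltW r_gt0)); move: rE; lra.
have h3 : (\int[Pi]_(f in N3) data_law f (~` psi) <= (expR (- 5 * v))%:E)%E.
  apply: (@le_trans _ _ (\int[Pi]_(f in N3) (expR (- 5 * v))%:E)%E).
    apply: ge0_le_integral => //.
    - apply: measurable_funTS.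
      exact: (@measurable_law _ _ _ _ R (data_law (cst 0%R)) (fun f : L2 R => data_law f) p mp p0 data_law_density _ (measurableC mpsi)).
    move=> f [hlow hfar]; rewrite data_lawE.
    apply: le_trans (reject_error2 BM pc.1 n_gt0 m0 close (L2_sqi f) (L2_sqi f0) _ _) _.
    - have : r ^+ 2 < l2norm (f \- f0) ^+ 2 by rewrite ltr_pXn2r ?nnegrE ?l2norm_ge0// ltW.
      by move: rE; lra.
    - by rewrite leNgt; apply/negP.
    - by rewrite lee_fin ler_expR.
  rewrite integral_cst// -[leRHS]mule1 lee_wpmul2l ?lee_fin ?expR_ge0//.
  exact: probability_le1.
have ki : k^-1 = expR (4 * v) by rewrite /k -expRN; congr expR; ring.
rewrite ki => hh; rewrite leeBlDr//; apply: (le_trans hh).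
rewrite -addeA; apply: leeD2l.
apply: (@le_trans _ _ ((expR (- (v / 9)))%:E + (expR (- 5 * v))%:E +
  (expR (4 * v))%:E * ((expR (- (9 / 2 * v)))%:E + (expR (- 5 * v))%:E + (expR (- 5 * v))%:E))%E).
  apply: leeD; first exact: leeD.
  by apply: lee_wpmul2l; [rewrite lee_fin expR_ge0|apply: leeD => //; exact: leeD].
have fold (x1 x2 y z1 z2 z3 : R) : (x1%:E + x2%:E + y%:E * (z1%:E + z2%:E + z3%:E))%E =
  (x1 + x2 + y * (z1 + z2 + z3))%:E by [].
rewrite fold lee_fin !mulrDr -!expRD.
have l y : y <= - (v / 9) -> expR y <= expR (- (v / 9)) by rewrite ler_expR.
have := l (- 5 * v); have := l (4 * v + - (9 / 2 * v)); have := l (4 * v + - 5 * v).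
have i1 : - 5 * v <= - (v / 9) by move: v_gt0; lra.
have i2 : 4 * v + - (9 / 2 * v) <= - (v / 9) by move: v_gt0; lra.
have i3 : 4 * v + - 5 * v <= - (v / 9) by move: v_gt0; lra.
move=> /(_ i3) j3 /(_ i2) j2 /(_ i1) j1; lra.
Qed.

(** The first weight is 1, so ln(1 + n) is a term of the log-determinant at t = n, which is at most
    3 v. *)
Lemma noise_level_ge : ln (1 + n%:R) / 3 <= v.
Proof.
have := log_complexity_le_v alpha_gt0 pc n_gt0 ef0 eps_gt0 cost 1.
rewrite /log_complexity big_ord_recl big_ord0 addr0.
have -> : weight alpha (@ord0 0) ^+ 2 = 1 :> R by rewrite weight_sqrE powR1.
by rewrite mulr1; lra.
Qed.

End posterior_core.

Lemma expR_log_vanishes (R : realType) (c : R) : 0 < c ->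
  expR (- (ln (1 + n%:R) * c)) @[n --> \oo] --> (0 : R).
Proof.
move=> c0; apply/cvgrPdist_lt => e e0.
exists (Num.truncn (expR (- ln e / c))).+1 => // n /= hn.
rewrite sub0r normrN ger0_norm ?expR_ge0// -[ltRHS]lnK ?posrE// ltr_expR.
rewrite ltrNl -ltr_pdivrMr// -ltr_expR lnK; last by rewrite posrE ltr_wpDr.
apply: lt_le_trans (truncnS_gt _) _; apply: (@le_trans _ _ n%:R); last by rewrite lerDr.
by rewrite ler_nat.
Qed.

Lemma sobolev_ball_expandable (R : realType) (beta L : R) (f0 : L2 R) :
  sobolev_ball beta L f0 -> expandable f0 /\
  forall N, \sum_(k < N) k.+1%:R `^ (2 * beta) * coef f0 k ^+ 2 <= L ^+ 2.
Proof.
move=> [c /trig_expansionP[ef cf] hc]; split=> // N.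
have h0 k : 0 <= k%:R `^ (2 * beta) * c k ^+ 2 by rewrite mulr_ge0 ?powR_ge0 ?sqr_ge0.
have := (eseries1_le (L ^+ 2) h0).1 hc N.
by under eq_bigr do rewrite -cf.
Qed.

(** Off the range of the concentration function the inverse takes the default value 0, which the
    positivity of [zeta] excludes. *)
Lemma concentration_inv_dflt (R : realType) (alpha : R) (Pi : probability (L2 R) R) (f0 : L2 R) (y : R) :
  ~ (concentration alpha Pi f0 @` `]0, +oo[) y -> concentration_inv alpha Pi f0 y = 0.
Proof.
move=> h; rewrite /concentration_inv /pinv_ splitV.
by rewrite oinv_surj; case: pselect.
Qed.

Lemma concentration_inv_image (R : realType) (alpha : R) (Pi : probability (L2 R) R) (f0 : L2 R) (y : R) :
  (concentration alpha Pi f0 @` `]0, +oo[) y -> 0 < concentration_inv alpha Pi f0 y /\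
  concentration alpha Pi f0 (concentration_inv alpha Pi f0 y) = y.
Proof.
move=> h; split; last by apply: pinvK; exact/mem_set.
have hs : set_surj `]0, +oo[ (concentration alpha Pi f0 @` `]0, +oo[) (concentration alpha Pi f0) by [].
have /(_ (concentration_inv alpha Pi f0 y)) := @surjpinv_image_sub _ _ (fun=> 0) _ _ _ hs.
by move=> /(_ (ex_intro2 _ _ y h erefl)) /=; rewrite in_itv/= andbT.
Qed.

(** * Part (i): convergence of the posterior mass *)

Section theorem_part1.
Context d (T : measurableType d) (R : realType) (P : probability T R).
Variables (alpha : R) (Pi : probability (L2 R) R).
Hypotheses (alpha_gt0 : 0 < alpha) (prior : series_prior alpha Pi).
Variables (W : R -> {RV P >-> R}) (p : nat -> L2 R * trajectory R -> R).
Hypothesis BM : brownian_motion W.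
Hypothesis lik : forall n, (0 < n)%N -> likelihood W n (p n).
Variable f0 : L2 R.
Hypothesis ef0 : expandable f0.

(** The conditions are asked for large n only, with a free outer radius, so that part (iii) can use
    sequences that are admissible only eventually. *)
Lemma posterior_concentrates_eventually (eps zeta r : nat -> R) :
  (\forall n \near \oo, [/\ 0 < eps n, 0 < zeta n, 0 < r n,
     concentration alpha Pi f0 (eps n) <= n%:R * eps n ^+ 2 &
     9 * (n%:R * eps n ^+ 2) <= concentration alpha Pi f0 (zeta n) /\
     1664 * eps n ^+ 2 <= r n ^+ 2]) ->
  posterior_concentrates Pi W p f0 (fun n => annulus f0 (zeta n) (r n)).
Proof.
move=> ev; have [d' [T' [P' [b pc]]]] := series_prior_coordinates prior.
rewrite /posterior_concentrates.
(* The error exponent v / 9 combined with v >= ln(1 + n) / 3 gives 27. *)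
apply: (@squeeze_cvge _ _ _ _ (fun n : nat => (1 - 5 * expR (- (ln (1 + n%:R) * 27^-1)))%:E) _ (fun=> 1%E)).
- near=> n; have n0 : (0 < n)%N by near: n; exists 1%N.
  have [e0 z0 r0 c1 [c2 c3]] : [/\ 0 < eps n, 0 < zeta n, 0 < r n,
     concentration alpha Pi f0 (eps n) <= n%:R * eps n ^+ 2 &
     9 * (n%:R * eps n ^+ 2) <= concentration alpha Pi f0 (zeta n) /\
     1664 * eps n ^+ 2 <= r n ^+ 2] by near: n.
  apply/andP; split; last first.
    by apply: posterior_expectation_le1; [exact: lik|exact: measurable_annulus].
  apply: le_trans (posterior_core alpha_gt0 pc BM n0 (lik n0) ef0 e0 z0 r0 c1 c2 c3).
  rewrite -EFinB lee_fin lerD2l lerN2 ler_wpM2l// ler_expR lerN2.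
  have := noise_level_ge alpha_gt0 pc n0 ef0 e0 c1.
  by set l := ln _; lra.
- apply: cvg_EFin; first exact: nearW.
  have h : (1 - 5 * expR (- (ln (1 + n%:R) * 27^-1))) @[n --> \oo] --> (1 - 5 * 0 : R).
    apply: cvgB; first exact: cvg_cst.
    by apply: cvgM; [exact: cvg_cst|exact: expR_log_vanishes].
  by rewrite mulr0 subr0 in h.
- exact: cvg_cst.
Unshelve. all: by end_near.
Qed.

Lemma posterior_concentrates_annulus (eps zeta : nat -> R) :
  upper_rate alpha Pi f0 eps -> lower_rate alpha Pi f0 eps zeta ->
  exists M0 : R, forall M : R, M0 <= M ->
    posterior_concentrates Pi W p f0 (fun n => annulus f0 (zeta n) (M * eps n)).
Proof.
move=> [e0 _ c1] lr; have [d' [T' [P' [b pc]]]] := series_prior_coordinates prior.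
(* 41^2 = 1681 exceeds the required 1664. *)
exists 41 => M M41.
apply: (@posterior_concentrates_eventually eps zeta (fun n => M * eps n)).
exists 1%N => // n /= n0; have /andP[z0 zle] := lr n n0.
have en := e0 n n0.
have im : (concentration alpha Pi f0 @` `]0, +oo[) (9 * n%:R * eps n ^+ 2).
  apply: contrapT => h; move: zle; rewrite concentration_inv_dflt// => zle.
  by have := lt_le_trans z0 zle; rewrite ltxx.
have [x0 xE] := concentration_inv_image im.
split=> //.
- by rewrite mulr_gt0//; lra.
- exact: c1.
split; first by rewrite mulrA -xE; exact: (concentration_anti alpha_gt0 pc ef0 z0 zle).
rewrite exprMn ler_wpM2r ?sqr_ge0//.
have : 41 ^+ 2 <= M ^+ 2 by rewrite ler_pXn2r ?nnegrE//; lra.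
by rewrite expr2; lra.
Qed.

End theorem_part1.

(** * Rates of the concentration function on the Sobolev ball *)

Section approximation_cost_by_truncation.
Variables (R : realType) (alpha : R).

Local Notation w := (weight alpha).

Lemma approx_cost_le_truncation (f : L2 R) (N : nat) (e rho : R) : expandable f -> 0 < e ->
  (forall M, \sum_(k < M | (N <= k)%N) coef f k ^+ 2 <= rho) -> rho < e ^+ 2 ->
  approx_cost alpha f e <= \sum_(k < N) coef f k ^+ 2 / w k ^+ 2.
Proof.
move=> ef e0 hrho re.
have -> : \sum_(k < N) coef f k ^+ 2 / w k ^+ 2 = \sum_(k < N) (coef f k / w k) ^+ 2.
  by apply: eq_bigr => k _; rewrite expr_div_n.
apply: (@approx_cost_le _ alpha f e (fun k => coef f k / w k)); rewrite l2norm_distC.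
have -> : trig_sum (fun k => w k * (coef f k / w k)) N = trig_sum (coef f) N.
  by apply: trig_sum_ext => k _; rewrite mulrC divfK// gt_eqF// weight_gt0.
rewrite -(@ltr_pXn2r _ 2)// ?nnegrE ?l2norm_ge0 ?(ltW e0)//; apply: le_lt_trans re.
rewrite bessel; last exact: ef.1.
rewrite lerBlDr; apply: l2norm_sqr_le => // M.
apply: le_trans (_ : \sum_(k < N + M) coef f k ^+ 2 <= _).
  rewrite (big_ord_widen (N + M) (fun k => coef f k ^+ 2)) ?leq_addl//.
  by rewrite big_mkcond/=; apply: ler_sum => k _; case: ifP => // _; exact: sqr_ge0.
rewrite big_split_ord/= addrC lerD2r; apply: le_trans (hrho (N + M)%N).
rewrite [leRHS]big_mkcond big_split_ord/= [X in _ <= X + _]big1 ?add0r; last first.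
  by move=> k _; rewrite leqNgt ltn_ord.
by apply: ler_sum => k _; rewrite leq_addr.
Qed.

End approximation_cost_by_truncation.

Section concentration_rates.
Variables (R : realType) (alpha beta L : R).
Hypotheses (alpha_gt0 : 0 < alpha) (beta_gt0 : 0 < beta) (L_gt0 : 0 < L).
Local Notation w := (weight alpha).
Local Notation kappa := ((2 * alpha + 1)^-1).
Implicit Types (x c : R) (n : nat).

Lemma powR_sqr x (r : R) : (x `^ r) ^+ 2 = x `^ (r * 2).
Proof. by rewrite -powR_mulrn ?powR_ge0// -powRrM. Qed.

Lemma powR_cancel x (r : R) : 0 < x -> x `^ r * x `^ (- r) = 1.
Proof. by move=> x0; rewrite -powRD ?subrr ?powRr0// (gt_eqF x0) implybT. Qed.

(** Truncate at a multiple of x: the tail is at most L^2 N^(- 2 mu), and the cost of the head grows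
    like N^(2 alpha + 1 - 2 mu). *)
Lemma sobolev_approx_cost (mu c : R) : 0 < mu -> mu <= alpha -> mu <= beta -> 0 < c ->
  exists A, forall x (f : L2 R), 1 <= x -> sobolev_ball beta L f ->
    approx_cost alpha f (c * x `^ (- mu)) <= A * x `^ (2 * alpha + 1 - 2 * mu).
Proof.
(* Chosen so that c a^mu = c + L exceeds L, which puts the tail strictly inside the required
   radius. *)
move=> m0 ma mb c0; pose a := (1 + L / c) `^ mu^-1.
have Lc : 0 < L / c by exact: divr_gt0.
have a1 : 1 <= a by rewrite powR_ge1 ?invr_ge0 ?(ltW m0)// lerDl ltW.
have am : a `^ mu = 1 + L / c.
  by rewrite /a -powRrM mulVf ?gt_eqF// powRr1// addr_ge0// ltW.
pose ga := 2 * alpha + 1 - 2 * mu.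
have ga1 : 1 <= ga by rewrite /ga; lra.
exists ((2 * a) `^ ga * L ^+ 2) => x f x1 sf; have [ef hf] := sobolev_ball_expandable sf.
have x0 : 0 < x by rewrite (lt_le_trans ltr01).
have a0 : 0 < a by rewrite (lt_le_trans ltr01).
have ax1 : 1 <= a * x by rewrite -[leLHS]mul1r ler_pM.
pose N := (Num.truncn (a * x)).+1.
have axN : a * x <= N%:R by apply/ltW/truncnS_gt.
have Nax : N%:R <= 2 * a * x.
  have /andP[h _] := truncn_itv (le_trans ler01 ax1).
  by rewrite /N -natr1; lra.
have e0 : 0 < c * x `^ (- mu) by rewrite mulr_gt0// powR_gt0.
have N1 : 1 <= N%:R :> R by rewrite ler1n.
have N0 : 0 < N%:R :> R by rewrite ltr0n.
pose rho := L ^+ 2 / N%:R `^ (2 * mu).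
have sm M (p : pred nat) : \sum_(k < M | p k) k.+1%:R `^ (2 * beta) * coef f k ^+ 2 <= L ^+ 2.
  apply: le_trans (hf M); rewrite big_mkcond/=; apply: ler_sum => k _; case: ifP => // _.
  by rewrite mulr_ge0 ?powR_ge0 ?sqr_ge0.
apply: (@le_trans _ _ (\sum_(k < N) coef f k ^+ 2 / w k ^+ 2)).
  apply: (@approx_cost_le_truncation _ alpha f N _ rho ef e0).
- move=> M; rewrite /rho ler_pdivlMr ?powR_gt0// mulr_suml.
  apply: le_trans (sm M (fun k => N <= k)%N); apply: ler_sum => k Nk.
  rewrite mulrC ler_wpM2r ?sqr_ge0//.
  have k1 : N%:R <= k.+1%:R :> R by rewrite ler_nat ltnW.
  apply: (@le_trans _ _ (k.+1%:R `^ (2 * mu))).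
    by rewrite ge0_ler_powR ?nnegrE// mulr_ge0// ltW.
  by rewrite ler_powR ?ler1n//; lra.
- rewrite /rho exprMn powR_sqr ltr_pdivrMr ?powR_gt0//.
  have q : (a * x) `^ (2 * mu) <= N%:R `^ (2 * mu).
    by rewrite ge0_ler_powR ?nnegrE// ?mulr_ge0 ?(ltW a0) ?(ltW x0)// ltW.
  have e1 : (a * x) `^ (2 * mu) = (1 + L / c) ^+ 2 * x `^ (2 * mu).
    by rewrite powRM ?(ltW a0) ?(ltW x0)// (mulrC 2) powRrM am powR_mulrn// addr_ge0// ltW.
  apply: (@lt_le_trans _ _ (c ^+ 2 * x `^ (- mu * 2) * (a * x) `^ (2 * mu))); last first.
    by rewrite ler_wpM2l// mulr_ge0 ?powR_ge0 ?sqr_ge0.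
  rewrite e1 mulrACA -[- mu * 2](_ : - (2 * mu) = _); last by ring.
  rewrite [X in _ < _ * X]mulrC powR_cancel// mulr1 -exprMn.
  rewrite ltr_pXn2r ?nnegrE ?(ltW L_gt0)//; last first.
    by rewrite mulr_ge0 ?(ltW c0)// addr_ge0// ltW.
  by rewrite mulrDr mulr1 mulrCA divff ?gt_eqF// mulr1 ltrDr.
apply: (@le_trans _ _ (\sum_(k < N) N%:R `^ ga * (k.+1%:R `^ (2 * beta) * coef f k ^+ 2))).
  apply: ler_sum => k _; have k0 : 0 < k.+1%:R :> R by rewrite ltr0n.
  rewrite weight_sqrE powRN invrK [leLHS]mulrC mulrA ler_wpM2r ?sqr_ge0//.
  (* The first exponent may be negative when beta is large; bounding it by [ga] >= 1 restores a
     power that increases with the index. *)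
  have -> : 2 * alpha + 1 = (2 * alpha + 1 - 2 * beta) + 2 * beta by ring.
  rewrite powRD; last by rewrite (gt_eqF k0) implybT.
  rewrite ler_wpM2r ?powR_ge0//; apply: (@le_trans _ _ (k.+1%:R `^ ga)).
    by rewrite ler_powR ?ler1n// /ga; lra.
  by rewrite ge0_ler_powR ?nnegrE ?ler_nat//; lra.
rewrite -mulr_sumr mulrAC; apply: ler_pM; rewrite ?powR_ge0//.
  by apply: sumr_ge0 => k _; rewrite mulr_ge0 ?powR_ge0 ?sqr_ge0.
rewrite -powRM ?mulr_ge0 ?(ltW a0) ?(ltW x0)//.
by rewrite ge0_ler_powR ?nnegrE// ?mulr_ge0 ?(ltW a0) ?(ltW x0)//; lra.
Qed.

Lemma scaled_kappa (s x : R) : 0 <= s -> 0 <= x -> (s * x `^ (2 * alpha + 1)) `^ kappa = s `^ kappa * x.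
Proof.
move=> s0 x0; rewrite powRM ?powR_ge0// -powRrM divff ?powRr1//.
by rewrite gt_eqF//; move: alpha_gt0; lra.
Qed.

(** The Laplace parameter is t = s x^(2 alpha + 1), for which the complexity is linear in x; the
    constant [s] is large enough for radius c x^(- mu). The bound is chosen before the prior and its
    coordinates, hence uniform in them. *)
Lemma small_ball_cost_upper (mu c : R) : mu <= alpha -> 0 < c ->
  exists2 B, 0 <= B & forall d' (T' : measurableType d') (P' : probability T' R)
    (Pi : probability (L2 R) R) (b : nat -> T' -> R), prior_coordinates P' alpha Pi b ->
  forall x, 1 <= x -> small_ball_cost Pi (c * x `^ (- mu)) <= B * x `^ (2 * alpha + 1 - 2 * mu).
Proof.
move=> ma c0; have [K K2 hK] := log_complexity_le alpha_gt0.
pose y := 1 + 2 * K / c ^+ 2; pose s := y `^ ((1 - kappa)^-1).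
have k0 := kappa_gt0 alpha_gt0.
have k1 : 0 < 1 - kappa by rewrite subr_gt0 invf_lt1; move: alpha_gt0; lra.
have c2 : 0 < c ^+ 2 by rewrite exprn_gt0.
have y1 : 1 <= y by rewrite lerDl divr_ge0 ?(ltW c2)//; lra.
have s1 : 1 <= s by rewrite powR_ge1// invr_ge0 ltW.
have s0 : 0 < s by rewrite (lt_le_trans ltr01).
have sE : s = s `^ kappa * y.
  have -> : y = s `^ (1 - kappa).
    by rewrite /s -powRrM mulVf ?gt_eqF// powRr1//; lra.
  by rewrite -powRD ?subrKC ?powRr1 ?(ltW s0)// (gt_eqF s0) implybT.
exists (K * s `^ kappa); first by rewrite mulr_ge0 ?powR_ge0//; lra.
move=> d' T' P' Pi b pc x x1.
have x0 : 0 < x by rewrite (lt_le_trans ltr01).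
pose t := s * x `^ (2 * alpha + 1).
have t1 : 1 <= t.
  by rewrite -[leLHS]mul1r ler_pM// powR_ge1//; move: alpha_gt0; lra.
have tk : t `^ kappa = s `^ kappa * x by rewrite scaled_kappa// ltW.
have xg : x <= x `^ (2 * alpha + 1 - 2 * mu) by apply: le1r_powR => //; lra.
have e0 : 0 < c * x `^ (- mu) by rewrite mulr_gt0// powR_gt0.
apply: le_trans (small_ball_cost_le alpha_gt0 pc K2 hK t1 e0 _) _; last first.
  by rewrite tk mulrA ler_wpM2l// mulr_ge0 ?powR_ge0//; lra.
have -> : t * (c * x `^ (- mu)) ^+ 2 = s * c ^+ 2 * x `^ (2 * alpha + 1 - 2 * mu).
  rewrite /t exprMn powR_sqr.
  have -> : 2 * alpha + 1 - 2 * mu = (2 * alpha + 1) + (- mu * 2) by ring.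
  rewrite [X in _ = _ * X]powRD; last by rewrite (gt_eqF x0) implybT.
  ring.
rewrite tk; apply: (@lt_le_trans _ _ (s * c ^+ 2 * x)); last first.
  by rewrite ler_wpM2l// mulr_ge0 ?(ltW s0) ?(ltW c2).
rewrite mulrA ltr_pM2r// {2}sE -[ltRHS]mulrA mulrC ltr_pM2l ?powR_gt0//.
have -> : y * c ^+ 2 = c ^+ 2 + 2 * K by rewrite /y; field; rewrite gt_eqF.
  by rewrite ltrDr.
exact: lt_le_trans y1.
Qed.

Lemma small_ball_cost_lower (B : R) : 0 <= B ->
  exists2 c, 0 < c & forall d' (T' : measurableType d') (P' : probability T' R)
    (Pi : probability (L2 R) R) (b : nat -> T' -> R), prior_coordinates P' alpha Pi b ->
  forall x, 1 <= x -> B * x <= small_ball_cost Pi (c * x `^ (- alpha)).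
Proof.
move=> B0; have l2 : 0 < ln (2 : R) by rewrite ln_gt0// ltr1n.
(* The complexity is then at least (2 B + 1) x. The radius is tuned to make t e^2 = x, so twice the
   cost is at least 2 B x. *)
pose z := 1 + (2 * B + 1) * (2 / ln 2).
have z0 : 1 <= z by rewrite lerDl mulr_ge0 ?divr_ge0 ?(ltW l2)//; lra.
pose s := z `^ (2 * alpha + 1).
have s1 : 1 <= s by rewrite powR_ge1//; move: alpha_gt0; lra.
have s0 : 0 < s by rewrite (lt_le_trans ltr01).
have sk : s `^ kappa = z.
  rewrite /s -powRrM divff ?powRr1//; first by lra.
  by rewrite gt_eqF//; move: alpha_gt0; lra.
have sq0 : 0 < Num.sqrt s by rewrite sqrtr_gt0.
exists (Num.sqrt s)^-1; first by rewrite invr_gt0.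
move=> d' T' P' Pi b pc x x1; have x0 : 0 < x by rewrite (lt_le_trans ltr01).
pose t := s * x `^ (2 * alpha + 1).
have t1 : 1 <= t.
  by rewrite -[leLHS]mul1r ler_pM// powR_ge1//; move: alpha_gt0; lra.
have [N hN] := log_complexity_ge alpha_gt0 t1.
have e0 : 0 < (Num.sqrt s)^-1 * x `^ (- alpha) by rewrite mulr_gt0 ?invr_gt0// powR_gt0.
have := log_complexity_le_cost alpha_gt0 pc N (le_trans ler01 t1) e0.
move=> /(le_trans hN); rewrite scaled_kappa ?(ltW s0) ?(ltW x0)// sk.
have -> : t * ((Num.sqrt s)^-1 * x `^ (- alpha)) ^+ 2 = x.
  rewrite /t exprMn powR_sqr exprVn sqr_sqrtr ?(ltW s0)//.
  rewrite mulrACA divff ?gt_eqF// mul1r -powRD; last by rewrite (gt_eqF x0) implybT.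
  by rewrite [X in _ `^ X](_ : _ = 1) ?powRr1 ?(ltW x0)//; ring.
have -> : ln 2 / 2 * (z * x) = ln 2 / 2 * x + (2 * B + 1) * x.
  by rewrite /z; field; rewrite gt_eqF.
have : 0 <= ln 2 / 2 * x by rewrite mulr_ge0 ?divr_ge0 ?(ltW l2) ?(ltW x0).
set l := ln 2 / 2 * x; lra.
Qed.

End concentration_rates.

Lemma powR_vanishes (R : realType) (th : R) : 0 < th ->
  n%:R `^ (- th) @[n --> \oo] --> (0 : R).
Proof.
move=> th0; apply/cvgrPdist_lt => e e0.
exists (Num.truncn (e^-1 `^ th^-1)).+1 => // n /= hn.
have n0 : 0 < n%:R :> R by rewrite ltr0n (leq_trans _ hn).
rewrite sub0r normrN ger0_norm ?powR_ge0// powRN invf_plt ?posrE ?powR_gt0//.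
have e1 : 0 <= e^-1 by rewrite invr_ge0 ltW.
have -> : e^-1 = (e^-1 `^ th^-1) `^ th by rewrite -powRrM mulVf ?powRr1// gt_eqF.
rewrite gt0_ltr_powR ?nnegrE ?powR_ge0 ?(ltW n0)//.
by apply: lt_le_trans (truncnS_gt _) _; rewrite ler_nat.
Qed.

(** * Part (ii): choice of eps and zeta *)

Section theorem_part2.
Variables (R : realType) (alpha beta L : R).
Hypotheses (alpha_gt0 : 0 < alpha) (beta_gt0 : 0 < beta) (L_gt0 : 0 < L).
Local Notation kappa := ((2 * alpha + 1)^-1).
Local Notation mu := (Num.min alpha beta).

(** The effective dimension at sample size n; the rate and n times its square are powers of it. *)
Definition root_rate (n : nat) : R := n%:R `^ kappa.

Lemma root_rate_ge1 n : (0 < n)%N -> 1 <= root_rate n.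
Proof. by move=> n0; apply: powR_kappa_ge1 => //; rewrite ler1n. Qed.

Lemma rateE n : rate alpha beta n = root_rate n `^ (- mu).
Proof. by rewrite /rate /root_rate -powRrM; congr (_ `^ _); ring. Qed.

Lemma root_rateE n : n%:R = root_rate n `^ (2 * alpha + 1) :> R.
Proof. by rewrite powR_kappa. Qed.

Lemma mu_gt0 : 0 < mu. Proof. by rewrite lt_min alpha_gt0. Qed.

Lemma rate_vanishes : rate alpha beta n @[n --> \oo] --> 0.
Proof. by apply: powR_vanishes; rewrite divr_gt0 ?mu_gt0//; move: alpha_gt0; lra. Qed.

Lemma rate_sqrM n : (0 < n)%N ->
  n%:R * rate alpha beta n ^+ 2 = root_rate n `^ (2 * alpha + 1 - 2 * mu).
Proof.
move=> n0; have x0 : 0 < root_rate n by rewrite (lt_le_trans ltr01)// root_rate_ge1.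
rewrite rateE {1}root_rateE powR_sqr -powRD; last by rewrite (gt_eqF x0) implybT.
by congr (_ `^ _); ring.
Qed.

Lemma concentration_upper (c : R) : 0 < c -> exists K, forall Pi, series_prior alpha Pi ->
  forall f0 : L2 R, sobolev_ball beta L f0 -> forall n, (0 < n)%N ->
    concentration alpha Pi f0 (c * rate alpha beta n) <= K * (n%:R * rate alpha beta n ^+ 2).
Proof.
move=> c0; have ma : mu <= alpha by rewrite ge_min lexx.
have mb : mu <= beta by rewrite ge_min lexx orbT.
have [A hA] := sobolev_approx_cost L_gt0 mu_gt0 ma mb c0.
have [B _ hB] := small_ball_cost_upper alpha_gt0 ma c0.
exists (A + B) => Pi prior f0 sf n n0.
have [d' [T' [P' [b pc]]]] := series_prior_coordinates prior.
have x1 := root_rate_ge1 n0.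
rewrite rate_sqrM// rateE concentrationE mulrDl lerD//; first exact: hA.
exact: hB pc _ x1.
Qed.

Lemma rates_rough : beta < alpha -> exists C : R, 0 < C /\
  forall (Pi : probability (L2 R) R), series_prior alpha Pi ->
  forall f0 : L2 R, sobolev_ball beta L f0 ->
  upper_rate alpha Pi f0 (fun n => C * rate alpha beta n).
Proof.
move=> ba; have [K hK] := concentration_upper ltr01.
(* Enlarging the radius by C >= 1 lowers the concentration function and multiplies n eps^2 by C^2 >=
   K. *)
pose C := 1 + `|K|; have C1 : 1 <= C by rewrite lerDl.
have C0 : 0 < C by rewrite (lt_le_trans ltr01).
exists C; split=> // Pi prior f0 sf; have [ef _] := sobolev_ball_expandable sf.
have [d' [T' [P' [b pc]]]] := series_prior_coordinates prior.
have r0 n : (0 < n)%N -> 0 < rate alpha beta n by move=> n0; rewrite powR_gt0// ltr0n.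
split=> [n n0||n n0].
- by rewrite mulr_gt0// r0.
- by rewrite -[X in _ --> X](mulr0 C); apply: cvgM; [exact: cvg_cst|exact: rate_vanishes].
have rn := r0 n n0.
apply: (@le_trans _ _ (concentration alpha Pi f0 (1 * rate alpha beta n))).
  by apply: (concentration_anti alpha_gt0 pc ef); rewrite mul1r// ler_peMl// ltW.
apply: le_trans (hK Pi prior f0 sf n n0) _.
rewrite exprMn [leRHS]mulrCA; apply: ler_wpM2r; first by apply: mulr_ge0 => //; exact: sqr_ge0.
apply: (@le_trans _ _ C); first by apply: (le_trans (ler_norm K)); rewrite /C lerDr.
by rewrite expr2 ler_peMl// ltW.
Qed.

(** For alpha <= beta the small ball term alone has the order of n rate^2, so the concentration
    function is bounded above and below by multiples of it at radii proportional to the rate. *)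
Lemma rates_smooth : alpha <= beta -> exists C C' : R, [/\ 0 < C, 0 < C' &
  forall (Pi : probability (L2 R) R), series_prior alpha Pi ->
  forall f0 : L2 R, sobolev_ball beta L f0 ->
  exists eps zeta : nat -> R,
    [/\ upper_rate alpha Pi f0 eps, forall n, (0 < n)%N -> eps n <= C * rate alpha beta n,
        lower_rate alpha Pi f0 eps zeta &
        forall n, (0 < n)%N -> rate alpha beta n <= C' * zeta n]].
Proof.
move=> ab; have muE : mu = alpha by rewrite min_l.
have [K0 hK0] := concentration_upper ltr01.
(* The radius c r is so small that its concentration value is at least 9 (|K0| + 1) n r^2; this
   makes eps >= r, and K0 n r^2 at most n eps^2. *)
pose B := 9 * (`|K0| + 1); have B9 : 9 <= B by rewrite /B; have := normr_ge0 K0; lra.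
have B0 : 0 <= B by lra.
have [c c0 hc] := small_ball_cost_lower alpha_gt0 B0.
have [K1 hK1] := concentration_upper c0.
(* Strictly above the constant bounding the value at c r, so that the inverse of that value cannot
   lie below c' r. *)
have K1' : 0 <= `|K1| + 1 + 1 by rewrite !addr_ge0.
have [c' c'0 hc'] := small_ball_cost_lower alpha_gt0 K1'.
exists (Num.sqrt (`|K1| + 1)), c'^-1; split; first by rewrite sqrtr_gt0 ltr_wpDl.
  by rewrite invr_gt0.
move=> Pi prior f0 sf; have [ef _] := sobolev_ball_expandable sf.
have [d' [T' [P' [b pc]]]] := series_prior_coordinates prior.
pose r n := rate alpha beta n; pose x n := root_rate n.
have r0 n : (0 < n)%N -> 0 < r n by move=> n0; rewrite powR_gt0// ltr0n.
have nr n : (0 < n)%N -> n%:R * r n ^+ 2 = x n.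
  move=> n0; rewrite rate_sqrM// muE [X in _ `^ X](_ : _ = 1); last by ring.
  by rewrite powRr1// powR_ge0.
pose y n := concentration alpha Pi f0 (c * r n).
have lowS (B' c1 : R) n : 0 < c1 -> (0 < n)%N ->
    B' * x n <= small_ball_cost Pi (c1 * x n `^ (- alpha)) ->
    B' * x n <= concentration alpha Pi f0 (c1 * r n).
  move=> c10 n0; rewrite concentrationE /r rateE muE => /le_trans; apply.
  rewrite lerDr; apply: approx_cost_ge0 => //.
  by rewrite mulr_gt0// powR_gt0// (lt_le_trans ltr01)// root_rate_ge1.
have x1 n : (0 < n)%N -> 1 <= x n by exact: root_rate_ge1.
have yB n : (0 < n)%N -> B * x n <= y n.
  by move=> n0; apply: lowS => //; apply: (hc _ _ _ _ _ pc); exact: x1.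
have y0 n : (0 < n)%N -> 0 < y n.
  by move=> n0; apply: lt_le_trans (yB n n0); rewrite mulr_gt0//; [lra|rewrite (lt_le_trans ltr01)// x1].
have yK n : (0 < n)%N -> y n <= (`|K1| + 1) * x n.
  move=> n0; apply: le_trans (hK1 Pi prior f0 sf n n0) _; rewrite nr//.
  by rewrite ler_wpM2r ?(le_trans ler01 (x1 n n0))// (le_trans (ler_norm K1))// lerDl.
(* Defined by 9 n eps^2 = y n, a value attained at c r, so the inverse is evaluated inside the range
   of the concentration function. *)
pose eps n := Num.sqrt (y n / (9 * n%:R)).
have n9 n : (0 < n)%N -> 0 < 9 * n%:R :> R by move=> n0; rewrite mulr_gt0// ltr0n.
have e2 n : (0 < n)%N -> 9 * n%:R * eps n ^+ 2 = y n.
  move=> n0; rewrite sqr_sqrtr; last by rewrite divr_ge0 ?(ltW (y0 n n0)) ?(ltW (n9 n n0)).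
  by rewrite mulrC divfK// gt_eqF// n9.
have eps_ge n : (0 < n)%N -> r n <= eps n.
  move=> n0; rewrite -(@ler_pXn2r _ 2)// ?nnegrE ?sqrtr_ge0 ?(ltW (r0 n n0))//.
  rewrite -(ler_pM2l (n9 n n0)) e2// -mulrA nr//; apply: le_trans (yB n n0).
  by rewrite ler_wpM2r// (le_trans ler01)// x1.
have eps_le n : (0 < n)%N -> eps n <= Num.sqrt (`|K1| + 1) * r n.
  move=> n0; rewrite -(@ler_pXn2r _ 2)// ?nnegrE ?mulr_ge0 ?sqrtr_ge0 ?(ltW (r0 n n0))//.
  rewrite -(ler_pM2l (n9 n n0)) e2// exprMn sqr_sqrtr//.
  have -> : 9 * n%:R * ((`|K1| + 1) * r n ^+ 2) = 9 * ((`|K1| + 1) * (n%:R * r n ^+ 2)) by ring.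
  rewrite nr//; apply: le_trans (yK n n0) _.
  by rewrite ler_peMl ?ler1n// mulr_ge0// (le_trans ler01)// x1.
exists eps, (fun n => concentration_inv alpha Pi f0 (9 * n%:R * eps n ^+ 2)).
have inv n : (0 < n)%N -> 0 < concentration_inv alpha Pi f0 (9 * n%:R * eps n ^+ 2) /\
    concentration alpha Pi f0 (concentration_inv alpha Pi f0 (9 * n%:R * eps n ^+ 2)) = y n.
  move=> n0; rewrite e2//; apply: concentration_inv_image; exists (c * r n) => //=.
  by rewrite in_itv/= andbT mulr_gt0// r0.
split=> //.
- split=> [n n0||n n0].
  + by apply: lt_le_trans (eps_ge n n0); exact: r0.
  + apply: (@squeeze_cvgr _ _ _ _ (fun=> 0) (fun n => Num.sqrt (`|K1| + 1) * r n)).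
    * by exists 1%N => // n /= n0; rewrite sqrtr_ge0 eps_le.
    * exact: cvg_cst.
    * rewrite -[X in _ --> X](mulr0 (Num.sqrt (`|K1| + 1))).
      by apply: cvgM; [exact: cvg_cst|exact: rate_vanishes].
  + apply: (@le_trans _ _ (concentration alpha Pi f0 (1 * r n))).
      by apply: (concentration_anti alpha_gt0 pc ef); rewrite mul1r; [exact: r0|exact: eps_ge].
    apply: le_trans (hK0 Pi prior f0 sf n n0) _; rewrite nr//.
    have h9 : 0 < 9 :> R by [].
    rewrite -(ler_pM2l h9) [leRHS]mulrA e2//; apply: le_trans (yB n n0).
    have X0 := le_trans ler01 (x1 n n0).
    rewrite /B -mulrA ler_wpM2l// ler_wpM2r//.
    by apply: (le_trans (ler_norm K0)); rewrite lerDl.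
- by move=> n n0; have [z0 _] := inv n n0; rewrite z0 lexx.
- move=> n n0; have [z0 zE] := inv n n0.
  rewrite mulrC ler_pdivlMr// mulrC leNgt; apply/negP => lt.
  have := concentration_anti alpha_gt0 pc ef z0 (ltW lt); rewrite zE.
  have h : (`|K1| + 1 + 1) * x n <= y n -> False.
    by move=> /le_trans/(_ (yK n n0)); rewrite ler_pM2r ?(lt_le_trans ltr01 (x1 n n0))//; lra.
  move=> hy; apply: h; apply: le_trans hy.
  by apply: lowS => //; apply: (hc' _ _ _ _ _ pc); exact: x1.
Qed.

End theorem_part2.

(** * Absolutely convergent and lacunary series *)

Section uniformly_convergent_series.
Variable R : realType.
Implicit Types (c : nat -> R) (t B : R) (n m : nat).

(** The basis is bounded, so absolute summability makes the series converge uniformly; the limit is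
    bounded and measurable, and uniform errors bound L^2 errors. *)
Lemma uniform_series_class c B : (forall n, \sum_(k < n) `|c k| <= B) ->
  exists f : L2 R, expandable f /\ forall k, coef f k = c k.
Proof.
move=> hB; pose sg n : R := \sum_(k < n) `|c k|.
pose q : R := Num.sqrt 2; have q0 : 0 <= q by exact: sqrtr_ge0.
have sg_mono n m : (n <= m)%N -> sg n <= sg m.
  move=> nm; rewrite /sg (big_ord_widen m (fun k => `|c k|))// big_mkcond/=.
  by apply: ler_sum => k _; case: ifP.
have sg_cvg : cvgn sg.
  apply: nondecreasing_is_cvgn; first by move=> n m; exact: sg_mono.
  by exists B => _ [n _ <-]; exact: hB.
have sg_le n : sg n <= limn sg by apply: nondecreasing_cvgn_le => // a b; exact: sg_mono.
have dist n m t : (n <= m)%N -> `|trig_sum c m t - trig_sum c n t| <= q * (sg m - sg n).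
  move=> nm; rewrite -(subnKC nm) /trig_sum /sg !big_split_ord/= !(addrC (\sum_(i < n) _)) !addrK.
  apply: le_trans (ler_norm_sum _ _ _) _; rewrite mulr_sumr; apply: ler_sum => k _.
  by rewrite normrM mulrC ler_wpM2r// trig_bounded.
have S_cvg t : cvgn (fun n => trig_sum c n t).
  have -> : (fun n => trig_sum c n t) = series (fun k => c k * trig k.+1 t).
    by apply/funext => n; rewrite /series/= big_mkord.
  apply: normed_cvg; apply: nondecreasing_is_cvgn.
    by move=> n m nm; apply: nondecreasing_series => //= k _ _; rewrite normr_ge0.
  exists (q * B) => _ [n _ <-].
  have -> : [normed series (fun k => c k * trig k.+1 t)] n = \sum_(k < n) `|c k * trig k.+1 t|.
    by rewrite -(big_mkord xpredT (fun k => `|c k * trig k.+1 t|)).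
  apply: (@le_trans _ _ (q * sg n)); last by rewrite ler_wpM2l//; exact: hB.
  by rewrite mulr_sumr; apply: ler_sum => k _; rewrite normrM mulrC ler_wpM2r// trig_bounded.
pose g t := limn (fun n => trig_sum c n t).
have g_dist n t : `|(g \- trig_sum c n) t| <= q * (limn sg - sg n).
  have cv : (fun m => `|trig_sum c m t - trig_sum c n t|) m @[m --> \oo] --> `|g t - trig_sum c n t|.
    by apply: cvg_norm; apply: cvgB; [exact: S_cvg|exact: cvg_cst].
  apply: (cvgr_to_le cv); exists n => // m /= nm; apply: (le_trans (dist n m t nm)).
  by rewrite ler_wpM2l// lerD2r.
have mS n := sqi_measurable (sqi_trig_sum c n).
have mg : measurable_fun setT g.
  by apply: (@measurable_fun_cvg _ _ _ setT (fun n => trig_sum c n)) => // t _; exact: S_cvg.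
have hg : square_integrable g.
  apply: (@sqi_bounded _ g (q * limn sg)) => // t; have := g_dist 0%N t.
  by rewrite /= {1}/trig_sum /sg !big_ord0 !subr0.
have cg : l2norm (g \- trig_sum c n) @[n --> \oo] --> 0.
  apply: (@squeeze0 _ _ (fun n => q * (limn sg - sg n))).
    move=> n; rewrite l2norm_ge0/=; apply: (l2norm_bounded _ _ (g_dist n)).
      exact: measurable_funB.
    by rewrite mulr_ge0// subr_ge0.
  rewrite -[X in _ --> X](mulr0 q) -(subrr (limn sg)).
  by apply: cvgM; [exact: cvg_cst|apply: cvgB; [exact: cvg_cst|exact: sg_cvg]].
have [eg coefg] := expandableP hg cg.
have [F FE] := L2_class hg.
have [eF cF] := expandable_ae FE (L2_sqi F) eg.
by exists F; split=> // k; rewrite cF.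
Qed.

(** Places v j at the basis function of index 2^j, that is, at position 2^j - 1. *)
Definition dyadic (v : nat -> R) (k : nat) : R :=
  if (2 ^ trunc_log 2 k.+1 == k.+1)%N then v (trunc_log 2 k.+1) else 0.

Lemma dyadicE v j : dyadic v (2 ^ j).-1 = v j.
Proof. by rewrite /dyadic prednK ?expn_gt0// trunc_expnK// eqxx. Qed.

Lemma dyadic_sum (v : nat -> R) (g : nat -> R -> R) J : (forall k, g k 0 = 0) ->
  \sum_(k < 2 ^ J) g k (dyadic v k) = \sum_(j < J.+1) g (2 ^ j).-1 (v j).
Proof.
move=> g0; elim: J => [|J IH].
  by rewrite expn0 !big_ord1 -[in RHS](dyadicE v).
rewrite [RHS]big_ord_recr/= -IH expnS mul2n -addnn big_split_ord/=; congr (_ + _).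
have p : (0 < 2 ^ J)%N by rewrite expn_gt0.
pose h i := g (2 ^ J + i)%N (dyadic v (2 ^ J + i)).
have -> : \sum_(i < 2 ^ J) g (2 ^ J + i)%N (dyadic v (2 ^ J + i)) = \sum_(i < (2 ^ J).-1.+1) h i.
  by rewrite prednK.
have e : (2 ^ J + (2 ^ J).-1)%N = (2 ^ J.+1).-1.
  rewrite expnS mul2n -addnn; move: (2 ^ J)%N p => [//|l] _.
  by rewrite addnS.
rewrite big_ord_recr/= big1 ?add0r; first by rewrite /h e dyadicE expnS mul2n -addnn.
rewrite /h.
move=> i _; suff -> : dyadic v (2 ^ J + i) = 0 by rewrite g0.
have iJ : (i.+1 < 2 ^ J)%N by have := ltn_ord i; rewrite ltn_predRL.
rewrite /dyadic (@trunc_log_eq 2 J)//; last first.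
  by rewrite -addnS leq_addr expnS mul2n -addnn ltn_add2l.
by rewrite -addnS -[X in X == _]addn0 eqn_add2l.
Qed.

Lemma dyadic_sum_le (v : nat -> R) (g : nat -> R -> R) n : (forall k, g k 0 = 0) ->
  (forall k y, 0 <= g k y) ->
  \sum_(k < n) g k (dyadic v k) <= \sum_(j < n.+1) g (2 ^ j).-1 (v j).
Proof.
move=> g0 gp; rewrite -(dyadic_sum v n g0) (big_ord_widen (2 ^ n) (fun k => g k (dyadic v k))); last first.
  exact/ltnW/ltn_expl.
by rewrite big_mkcond/=; apply: ler_sum => k _; case: ifP.
Qed.

Lemma geometric_sum_le (y : R) n : 0 <= y -> y < 1 -> \sum_(i < n) y ^+ i <= (1 - y)^-1.
Proof.
move=> y0 y1; have p : 0 < 1 - y by rewrite subr_gt0.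
rewrite -[leRHS]mul1r ler_pdivlMr// mulr_suml.
suff -> : \sum_(i < n) y ^+ i * (1 - y) = 1 - y ^+ n by rewrite gerBl exprn_ge0.
elim: n => [|n IH]; first by rewrite big_ord0 expr0 subrr.
by rewrite big_ord_recr/= IH exprS; ring.
Qed.

End uniformly_convergent_series.

(** A function within [z] of [f] must carry at least half of a coefficient that is at least 2 z, and
    this alone has the stated cost. *)
Lemma approx_cost_ge_coef (R : realType) (alpha : R) (f : L2 R) (k : nat) (z : R) :
  expandable f -> 0 < z -> 2 * z <= coef f k ->
  coef f k ^+ 2 / (4 * weight alpha k ^+ 2) <= approx_cost alpha f z.
Proof.
move=> ef z0 hk; apply/ler_addgt0Pr => dl d0.
have [N [u [hu su]]] := approx_cost_adherent alpha ef z0 d0.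
apply: le_trans (ltW su); have eh := expandable_trig_sum (fun k => weight alpha k * u k) N.
set h := trig_sum _ N in hu eh.
have hd : (coef h k - coef f k) ^+ 2 < z ^+ 2.
  apply: (@le_lt_trans _ _ (l2norm (h \- f) ^+ 2)); last by rewrite ltr_pXn2r ?nnegrE ?l2norm_ge0// ltW.
  apply: le_trans (sum_coef_le k.+1 (sqiB eh.1 ef.1)).
  rewrite big_ord_recr/= -(trig_coefB k eh.1 ef.1) lerDr.
  by apply: sumr_ge0 => i _; exact: sqr_ge0.
have hh : coef f k / 2 <= coef h k.
  rewrite leNgt; apply/negP => lt.
  have : z <= coef f k - coef h k by lra.
  move=> hz; have : z ^+ 2 <= (coef f k - coef h k) ^+ 2 by rewrite ler_pXn2r ?nnegrE//; lra.
  by rewrite -(sqrrN (_ - _)) opprB leNgt hd.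
have kN : (k < N)%N.
  by rewrite ltnNge; apply/negP => Nk; move: hh; rewrite coef_trig_sum ltnNge Nk/=; lra.
have hE : coef h k = weight alpha k * u k by rewrite coef_trig_sum kN.
have w0 := weight_sqr_gt0 alpha k.
apply: (@le_trans _ _ (u k ^+ 2)); last first.
  rewrite (bigD1 (Ordinal kN))//= lerDl; apply: sumr_ge0 => i _; exact: sqr_ge0.
have w4 : 0 < 4 * weight alpha k ^+ 2 by rewrite pmulr_rgt0.
rewrite ler_pdivrMr//.
have : (coef f k / 2) ^+ 2 <= coef h k ^+ 2 by rewrite ler_pXn2r ?nnegrE//; lra.
by rewrite hE expr_div_n exprMn; lra.
Qed.

(** * A signal at the border of the Sobolev ball *)

Section critical_signal.
Variables (R : realType) (alpha beta L : R).
Hypotheses (beta_gt0 : 0 < beta) (L_gt0 : 0 < L) (beta_lt : beta < alpha).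
Local Notation ga := (2 * alpha + 1 - 2 * beta).
Local Notation y j := ((2 ^ j)%N%:R : R).

(** The power of 2^j is borderline for the Sobolev ball, and the denominator makes the squares
    summable at the price of a logarithm. The shift 7 is the least integer with 4 z^2 >= 3 (z + 1)^2
    for all z beyond it. *)
Definition critical_coef j : R := L * y j `^ (- beta) / (j + 7)%:R.
Local Notation v := critical_coef.

Let alpha_gt0 : 0 < alpha. Proof. exact: lt_trans beta_lt. Qed.
Let ga1 : 1 <= ga. Proof. by move: beta_lt; lra. Qed.

Let y0 j : 0 < y j. Proof. by rewrite ltr0n expn_gt0. Qed.
Let y1 j : 1 <= y j. Proof. by rewrite ler1n expn_gt0. Qed.
Let j7 j : 0 < (j + 7)%:R :> R. Proof. by rewrite ltr0n addn_gt0 orbT. Qed.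
Let j71 j : 1 <= (j + 7)%:R :> R. Proof. by rewrite ler1n addn_gt0 orbT. Qed.
Let yS j : y j.+1 = 2 * y j. Proof. by rewrite expnS natrM. Qed.

Let powy (s : R) j : y j `^ s = (2 `^ s) ^+ j.
Proof. by rewrite natrX -powR_mulrn// -powRrM -powR_mulrn ?powR_ge0// -powRrM mulrC. Qed.

Lemma critical_coef_ge0 j : 0 <= v j.
Proof. by rewrite divr_ge0// mulr_ge0 ?powR_ge0// ltW. Qed.

Let thlt (s : R) : 0 < s -> 2 `^ (- s) < 1.
Proof.
move=> s0; rewrite powRN invf_lt1 ?powR_gt0//.
by rewrite /powR gt_eqF// expR_gt1 mulr_gt0// ln_gt0// ltr1n.
Qed.

Lemma critical_coef_summable n : \sum_(k < n) `|dyadic v k| <= L / (1 - 2 `^ (- beta)).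
Proof.
have t1 := thlt beta_gt0; set th := 2 `^ _ in t1 *; have t0 : 0 <= th by exact: powR_ge0.
apply: le_trans (@dyadic_sum_le _ v (fun _ y => `|y|) n _ _) _ => //.
  by move=> _; exact: normr0.
apply: (@le_trans _ _ (\sum_(j < n.+1) L * th ^+ j)).
  apply: ler_sum => j _; rewrite ger0_norm ?critical_coef_ge0// /v powy -/th.
  by rewrite ler_pdivrMr// ler_peMr// mulr_ge0 ?exprn_ge0// ltW.
by rewrite -mulr_sumr ler_wpM2l ?(ltW L_gt0)// geometric_sum_le.
Qed.

Lemma powR_pair j (s : R) : y j `^ s * y j `^ (- s) = 1.
Proof. exact: powR_cancel. Qed.

Lemma critical_coef_sqr j : v j ^+ 2 = L ^+ 2 * y j `^ (- (2 * beta)) / (j + 7)%:R ^+ 2.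
Proof.
rewrite /v expr_div_n exprMn powR_sqr; congr (_ * _ `^ _ / _); ring.
Qed.

Lemma critical_sobolev n : \sum_(k < n) k.+1%:R `^ (2 * beta) * dyadic v k ^+ 2 <= L ^+ 2.
Proof.
apply: le_trans (@dyadic_sum_le _ v (fun k y => k.+1%:R `^ (2 * beta) * y ^+ 2) n _ _) _ => //.
- by move=> k; rewrite expr0n/= mulr0.
- by move=> k z; rewrite mulr_ge0 ?powR_ge0 ?sqr_ge0.
have e j : (2 ^ j).-1.+1%:R `^ (2 * beta) * v j ^+ 2 = L ^+ 2 / (j + 7)%:R ^+ 2.
  rewrite prednK ?expn_gt0// critical_coef_sqr.
  have := powR_pair j (2 * beta); set a := _ `^ _; set b := _ `^ _ => ab.
  have -> : a * (L ^+ 2 * b / (j + 7)%:R ^+ 2) = (a * b) * (L ^+ 2 / (j + 7)%:R ^+ 2) by ring.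
  by rewrite ab mul1r.
under eq_bigr do rewrite e.
rewrite -mulr_sumr -[leRHS]mulr1 ler_wpM2l ?sqr_ge0//.
(* Telescoping with 1 / (z + 1)^2 <= 1 / z - 1 / (z + 1), starting at z = 6. *)
apply: (@le_trans _ _ (6^-1 - (n.+1 + 6)%:R^-1)); last first.
  by rewrite lerBlDr; have : 0 <= (n.+1 + 6)%:R^-1 :> R by []; lra.
elim: (n.+1) => [|m IH]; first by rewrite big_ord0 add0n subrr.
rewrite big_ord_recr/=; apply: (le_trans (lerD IH (lexx _))).
rewrite -addrA lerD2l.
have -> : (m.+1 + 6)%:R = (m + 7)%:R :> R by rewrite addSnnS.
have -> : (m + 7)%:R = (m + 6)%:R + 1 :> R by rewrite natr1 addnS.
have z0 : 0 < (m + 6)%:R :> R by rewrite ltr0n addn_gt0 orbT.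
set z := (m + 6)%:R in z0 *; have z1 : 0 < z + 1 by rewrite ltr_wpDr.
have -> : ((z + 1) ^+ 2)^-1 = z^-1 - (z + 1)^-1 - (z * (z + 1) ^+ 2)^-1.
  by field; rewrite !gt_eqF.
have : 0 <= (z * (z + 1) ^+ 2)^-1 by rewrite invr_ge0 mulr_ge0 ?sqr_ge0// ltW.
lra.
Qed.

Lemma critical_signal_exists : exists f : L2 R,
  [/\ expandable f, forall k, coef f k = dyadic v k & sobolev_ball beta L f].
Proof.
have [f [ef cf]] := uniform_series_class critical_coef_summable.
exists f; split=> //; exists (fun k => coef f k.-1); first by apply/trig_expansionP.
apply/(@eseries1_le _ (fun k => k%:R `^ (2 * beta) * coef f k.-1 ^+ 2)).
  by move=> k; rewrite mulr_ge0 ?powR_ge0 ?sqr_ge0.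
by move=> N; under eq_bigr do rewrite /= cf; exact: critical_sobolev.
Qed.

Variable f : L2 R.
Hypotheses (ef : expandable f) (cf : forall k, coef f k = dyadic v k).

Lemma critical_tail J M : \sum_(k < M | (2 ^ J <= k)%N) coef f k ^+ 2 <=
  L ^+ 2 / (1 - 2 `^ (- (2 * beta))) * (y J `^ (- (2 * beta)) / (J + 7)%:R ^+ 2).
Proof.
have b2 : 0 < 2 * beta by rewrite mulr_gt0.
have t1 := thlt b2; set th := 2 `^ _ in t1 *; have t0 : 0 <= th by exact: powR_ge0.
pose g k (z : R) := if (2 ^ J <= k)%N then z ^+ 2 else 0.
have -> : \sum_(k < M | (2 ^ J <= k)%N) coef f k ^+ 2 = \sum_(k < M) g k (dyadic v k).
  by rewrite big_mkcond; apply: eq_bigr => k _; rewrite /g cf.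
have g0 k z : 0 <= g k z by rewrite /g; case: ifP => // _; exact: sqr_ge0.
apply: le_trans (@dyadic_sum_le _ v g M _ _) _ => //.
  by move=> k; rewrite /g expr0n/=; case: ifP.
apply: (@le_trans _ _ (\sum_(j < J + M.+1) g (2 ^ j).-1 (v j))).
  rewrite (big_ord_widen (J + M.+1) (fun j => g (2 ^ j).-1 (v j))) ?leq_addl//.
  by rewrite big_mkcond/=; apply: ler_sum => k _; case: ifP.
rewrite big_split_ord/= big1 ?add0r; last first.
  move=> j _; rewrite /g ifF//; apply/negbTE; rewrite -ltnNge prednK ?expn_gt0//.
  by rewrite leq_exp2l// ltnW.
apply: (@le_trans _ _ (\sum_(i < M.+1) L ^+ 2 * (y J `^ (- (2 * beta)) / (J + 7)%:R ^+ 2) * th ^+ i)).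
  apply: ler_sum => i _; apply: (@le_trans _ _ (v (J + i) ^+ 2)).
    by rewrite /g; case: ifP => // _; exact: sqr_ge0.
  rewrite critical_coef_sqr !powy -/th exprD.
  have h : ((J + i + 7)%:R ^+ 2)^-1 <= ((J + 7)%:R ^+ 2)^-1 :> R.
    rewrite lef_pV2 ?posrE ?exprn_gt0// ler_pXn2r ?nnegrE// ler_nat leq_add2r leq_addr.
    by [].
  have := ler_wpM2l (_ : 0 <= L ^+ 2 * (th ^+ J * th ^+ i)) h.
  rewrite mulr_ge0 ?sqr_ge0 ?mulr_ge0 ?exprn_ge0// => /(_ isT) hh.
  by apply: (le_trans hh); rewrite le_eqVlt; apply/orP; left; apply/eqP; ring.
rewrite -mulr_sumr; have := geometric_sum_le M.+1 t0 t1 => hh.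
have p : 0 <= L ^+ 2 * (y J `^ (- (2 * beta)) / (J + 7)%:R ^+ 2).
  by rewrite mulr_ge0 ?sqr_ge0// divr_ge0 ?powR_ge0// sqr_ge0.
by apply: (le_trans (ler_wpM2l p hh)); rewrite le_eqVlt; apply/orP; left; apply/eqP; ring.
Qed.

Lemma critical_head J : \sum_(k < 2 ^ J) coef f k ^+ 2 / weight alpha k ^+ 2 <=
  3 * L ^+ 2 * (y J `^ ga / (J + 7)%:R ^+ 2).
Proof.
pose a j : R := y j `^ ga / (j + 7)%:R ^+ 2.
have -> : \sum_(k < 2 ^ J) coef f k ^+ 2 / weight alpha k ^+ 2 = \sum_(j < J.+1) L ^+ 2 * a j.
  transitivity (\sum_(k < 2 ^ J) (fun k z => z ^+ 2 / weight alpha k ^+ 2) (val k) (dyadic v k)).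
    by apply: eq_bigr => k _; rewrite cf.
  rewrite (dyadic_sum v J (g := fun k z => z ^+ 2 / weight alpha k ^+ 2)); last first.
    by move=> k; rewrite expr0n/= mul0r.
  apply: eq_bigr => j _; rewrite weight_sqrE prednK ?expn_gt0// powRN invrK critical_coef_sqr /a.
  have -> : y j `^ ga = y j `^ (2 * alpha + 1) * y j `^ (- (2 * beta)).
    by rewrite -powRD ?(gt_eqF (y0 j)) ?implybT.
  by ring.
have -> : 3 * L ^+ 2 * (y J `^ ga / (J + 7)%:R ^+ 2) = L ^+ 2 * (3 * a J) by rewrite /a; ring.
rewrite -mulr_sumr; apply: ler_wpM2l; first exact: sqr_ge0.
have a0 j : 0 <= a j by rewrite divr_ge0 ?powR_ge0// sqr_ge0.
(* Growth by at least 3 / 2 per block makes the last block dominate: the sum is at most three times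
   its last term. *)
have aS j : 3 * a j <= 2 * a j.+1.
  have g2 : 2 <= 2 `^ ga :> R by apply: le1r_powR => //; rewrite ler1n.
  rewrite /a yS powRM// ; set b := y j `^ ga; have b0 : 0 <= b by exact: powR_ge0.
  have -> : (j.+1 + 7)%:R = (j + 7)%:R + 1 :> R by rewrite natr1 addSn.
  have z7 : 7 <= (j + 7)%:R :> R by rewrite ler_nat leq_addl.
  set z := (j + 7)%:R in z7 *.
  have zp : 0 < z by lra.
  have zp1 : 0 < z + 1 by lra.
  apply: (@le_trans _ _ (2 * (2 * b / (z + 1) ^+ 2))); last first.
    by rewrite ler_wpM2l// ler_wpM2r ?invr_ge0 ?sqr_ge0// ler_wpM2r.
  rewrite -subr_ge0.
  have -> : 2 * (2 * b / (z + 1) ^+ 2) - 3 * (b / z ^+ 2) =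
      b * (4 * z ^+ 2 - 3 * (z + 1) ^+ 2) / (z ^+ 2 * (z + 1) ^+ 2).
    by field; rewrite !gt_eqF.
  rewrite divr_ge0 ?mulr_ge0 ?sqr_ge0//; nra.
elim: J => [|J IH]; first by rewrite big_ord1; have := a0 0%N; rewrite /a; lra.
by rewrite big_ord_recr/=; have := aS J; move: IH; rewrite -/(a J) -/(a J.+1); lra.
Qed.

Lemma critical_cost_upper : exists2 D, 0 < D & forall J e, 0 < e ->
  D * (y J `^ (- (2 * beta)) / (J + 7)%:R ^+ 2) < e ^+ 2 ->
  approx_cost alpha f e <= D * (y J `^ ga / (J + 7)%:R ^+ 2).
Proof.
have b2 : 0 < 2 * beta by rewrite mulr_gt0.
have t1 := thlt b2; set th := 2 `^ _ in t1 *.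
pose D1 := L ^+ 2 / (1 - th); pose D2 := 3 * L ^+ 2.
have L2 : 0 < L ^+ 2 by rewrite exprn_gt0.
have D10 : 0 < D1 by rewrite divr_gt0// subr_gt0.
have D20 : 0 < D2 by rewrite mulr_gt0.
exists (D1 + D2); first exact: addr_gt0.
move=> J e e0 he.
have p (s : R) : 0 <= y J `^ s / (J + 7)%:R ^+ 2 by rewrite divr_ge0 ?powR_ge0 ?sqr_ge0.
apply: (@le_trans _ _ (\sum_(k < 2 ^ J) coef f k ^+ 2 / weight alpha k ^+ 2)).
  apply: (@approx_cost_le_truncation _ alpha f _ _ _ ef e0 (critical_tail J)).
  apply: le_lt_trans he; rewrite ler_wpM2r// -/th -/D1 lerDl; exact: ltW.
apply: le_trans (critical_head J) _; rewrite ler_wpM2r// -/D2 lerDr; exact: ltW.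
Qed.

Lemma critical_cost_lower J z : 0 < z -> 2 * z <= v J ->
  L ^+ 2 / 4 * (y J `^ ga / (J + 7)%:R ^+ 2) <= approx_cost alpha f z.
Proof.
move=> z0 hz; have e : coef f (2 ^ J).-1 = v J by rewrite cf dyadicE.
rewrite -e in hz; apply: le_trans (approx_cost_ge_coef alpha ef z0 hz).
rewrite e weight_sqrE prednK ?expn_gt0// critical_coef_sqr (powRN _ (2 * alpha + 1)).
have -> : y J `^ ga = y J `^ (2 * alpha + 1) * y J `^ (- (2 * beta)).
  by rewrite -powRD ?(gt_eqF (y0 J)) ?implybT.
rewrite le_eqVlt; apply/orP; left; apply/eqP.
have p0 : 0 < y J `^ (2 * alpha + 1) by rewrite powR_gt0.
have l0 := j7 J; move: (y J `^ (2 * alpha + 1)) (y J `^ (- (2 * beta))) ((J + 7)%:R) p0 l0 => p q l p0 l0.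
by field; rewrite !gt_eqF.
Qed.

End critical_signal.

Lemma ln_large (R : realType) (A : R) : \forall n \near \oo, A <= ln n%:R.
Proof.
exists (Num.truncn (expR A)).+1 => // n /= hn.
have n0 : 0 < n%:R :> R by rewrite ltr0n (leq_trans _ hn).
rewrite -ler_expR lnK ?posrE//; apply/ltW/(lt_le_trans (truncnS_gt _)).
by rewrite ler_nat.
Qed.

Lemma dyadic_scale (R : realType) (x : R) : 1 <= x ->
  exists J, x <= (2 ^ J)%N%:R <= 2 * x.
Proof.
move=> x1; have [m0 mx _] := truncn_ge_half x1.
have /andP[_ xm] := truncn_itv (le_trans ler01 x1).
set m := Num.truncn x in m0 mx xm.
have /andP[h1 h2] := trunc_log_bounds (ltnSn 1) m0.
exists (trunc_log 2 m).+1; apply/andP; split.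
  by apply: (le_trans (ltW xm)); rewrite ler_nat.
rewrite expnS natrM ler_wpM2l//; apply: le_trans mx; by rewrite ler_nat.
Qed.

(** * Part (iii): slow contraction at the critical signal *)

Section theorem_part3.
Variables (R : realType) (alpha beta L : R).
Hypotheses (beta_gt0 : 0 < beta) (L_gt0 : 0 < L) (beta_lt : beta < alpha).
Local Notation kappa := ((2 * alpha + 1)^-1).
Local Notation ga := (2 * alpha + 1 - 2 * beta).
Local Notation r := (rate alpha beta).
Local Notation x := (root_rate alpha).
Local Notation y j := ((2 ^ j)%N%:R : R).
Variable f : L2 R.
Hypotheses (ef : expandable f) (cf : forall k, coef f k = dyadic (critical_coef beta L) k).
Variable Pi : probability (L2 R) R.
Hypothesis prior : series_prior alpha Pi.

Let alpha_gt0 : 0 < alpha. Proof. exact: lt_trans beta_lt. Qed.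
Let ga1 : 1 <= ga. Proof. by move: beta_lt; lra. Qed.
Let k0 : 0 < kappa. Proof. exact: kappa_gt0. Qed.
Let k1 : kappa < 1. Proof. by rewrite invf_lt1; move: alpha_gt0; lra. Qed.
Let muE : Num.min alpha beta = beta. Proof. by rewrite min_r// ltW. Qed.
Let x1 n : (0 < n)%N -> 1 <= x n. Proof. exact: root_rate_ge1. Qed.
Let rE n : r n = x n `^ (- beta). Proof. by rewrite rateE muE. Qed.
Let nr n : (0 < n)%N -> n%:R * r n ^+ 2 = x n `^ ga.
Proof. by move=> n0; rewrite rate_sqrM// muE. Qed.
Let lnx n : ln (x n) = kappa * ln n%:R. Proof. by rewrite ln_powR. Qed.

Let ln_y j : ln (y j) = j%:R * ln 2. Proof. by rewrite natrX lnXn// mulr_natl. Qed.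

Let ln2_le1 : ln (2 : R) <= 1.
Proof. by apply: (@le_ln1Dx R 1); lra. Qed.

Let ln2_ge : 2^-1 <= ln (2 : R).
Proof.
rewrite -ler_expR lnK ?posrE// -[leRHS]invrK -[leLHS]invrK -expRN lef_pV2 ?posrE ?invr_gt0 ?expR_gt0//.
by apply: le_trans (expR_ge1Dx _); lra.
Qed.

(** Truncation near the effective dimension leaves a tail of order r / ln n, since the coefficients
    carry an extra 1 / (j + 7). Keeping this logarithm in eps makes n eps^2 comparable with the cost
    of a single coefficient, as [critical_zeta] needs. *)
Lemma critical_eps : exists2 C, 1 <= C & \forall n \near \oo,
  concentration alpha Pi f (C * r n / ln n%:R) <= n%:R * (C * r n / ln n%:R) ^+ 2.
Proof.
have [d' [T' [P' [b pc]]]] := series_prior_coordinates prior.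
have [D D0 hD] := critical_cost_upper beta_gt0 L_gt0 beta_lt ef cf.
have [K K2 hK] := log_complexity_le alpha_gt0.
have kk : 0 < kappa ^+ 2 by rewrite exprn_gt0.
pose E1 := D / kappa ^+ 2; pose E2 := D * 2 `^ ga / kappa ^+ 2.
have E10 : 0 < E1 by exact: divr_gt0.
have E20 : 0 < E2 by rewrite divr_gt0// mulr_gt0// powR_gt0.
(* [E1] serves the tail condition and [E2] the cost of the head, which may use only half of C^2; the
   small ball term takes the other half. *)
pose C := 1 + E1 + 2 * E2; have C1 : 1 <= C by rewrite /C; lra.
have C0 : 0 < C by lra.
have CC : C <= C ^+ 2 by rewrite expr2 ler_peMl// ltW.
pose dl := (alpha - beta) * kappa.
have dl0 : 0 < dl by rewrite mulr_gt0// subr_gt0.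
exists C => //; near=> n.
have n0 : (0 < n)%N by near: n; exists 1%N.
have l1 : 1 <= ln n%:R :> R by near: n; exact: ln_large.
have l2 : 2 * K * (3 / (2 * dl)) ^+ 3 + 1 <= ln n%:R by near: n; exact: ln_large.
have hnk : n%:R `^ kappa = x n by [].
move: (x n) (x1 n0) (lnx n) (nr n0) (rE n) hnk => X X1 hlX hnr hr hnk.
have X0 : 0 < X by exact: lt_le_trans X1.
set l := ln n%:R in l1 l2 hlX *; have l0 : 0 < l by exact: lt_le_trans l1.
set e := C * r n / l; have r0 : 0 < r n by rewrite powR_gt0// ltr0n.
have e0 : 0 < e by rewrite divr_gt0// mulr_gt0.
have ll : 0 < l ^+ 2 by rewrite exprn_gt0.
have ne : n%:R * e ^+ 2 = C ^+ 2 * (X `^ ga / l ^+ 2).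
  by rewrite /e expr_div_n exprMn -hnr; ring.
rewrite ne concentrationE.
have [J /andP[J1 J2]] := dyadic_scale X1.
have yJ0 : 0 < y J by exact: lt_le_trans J1.
have Jl : kappa * l <= (J + 7)%:R.
  rewrite -hlX; apply: (@le_trans _ _ (ln (y J))); first by rewrite ler_ln ?posrE.
  rewrite ln_y; apply: (@le_trans _ _ (J%:R * 1)); first by rewrite ler_wpM2l.
  by rewrite mulr1 ler_nat leq_addr.
have Jl2 : ((J + 7)%:R ^+ 2)^-1 <= (kappa ^+ 2)^-1 / l ^+ 2 :> R.
  rewrite -invfM -exprMn lef_pV2 ?posrE ?exprn_gt0 ?mulr_gt0 ?(ltr0n _ (J + 7)) ?addn_gt0 ?orbT//.
  by rewrite ler_pXn2r ?nnegrE ?(ltW (mulr_gt0 _ _))// mulr_ge0// ltW.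
have hI : approx_cost alpha f e <= C ^+ 2 / 2 * (X `^ ga / l ^+ 2).
  apply: (@le_trans _ _ (D * (y J `^ ga / (J + 7)%:R ^+ 2))).
    apply: hD => //.
    have -> : e ^+ 2 = C ^+ 2 * (X `^ (- (2 * beta)) / l ^+ 2).
      rewrite /e expr_div_n exprMn hr powR_sqr (_ : - beta * 2 = - (2 * beta)); last by ring.
      by ring.
    have q0 : 0 < X `^ (- (2 * beta)) / l ^+ 2 by rewrite divr_gt0// powR_gt0.
    apply: (@le_lt_trans _ _ (E1 * (X `^ (- (2 * beta)) / l ^+ 2))); last first.
      by rewrite ltr_pM2r//; apply: lt_le_trans CC; rewrite /C; lra.
    have -> : E1 * (X `^ (- (2 * beta)) / l ^+ 2) = D * (X `^ (- (2 * beta)) * ((kappa ^+ 2)^-1 / l ^+ 2)).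
      by rewrite /E1; ring.
    rewrite ler_wpM2l ?(ltW D0)//; apply: ler_pM => //; rewrite ?powR_ge0 ?invr_ge0 ?sqr_ge0//.
    rewrite !powRN lef_pV2 ?posrE ?powR_gt0//.
    by rewrite ge0_ler_powR ?nnegrE ?(ltW X0) ?(ltW yJ0)// mulr_ge0// ltW.
  apply: (@le_trans _ _ (E2 * (X `^ ga / l ^+ 2))); last first.
    by rewrite ler_wpM2r ?divr_ge0 ?powR_ge0 ?(ltW ll)//; move: CC; rewrite {1}/C; lra.
  have -> : E2 * (X `^ ga / l ^+ 2) = D * ((2 * X) `^ ga * ((kappa ^+ 2)^-1 / l ^+ 2)).
    by rewrite /E2 powRM ?(ltW X0)//; ring.
  rewrite ler_wpM2l ?(ltW D0)//; apply: ler_pM => //; rewrite ?powR_ge0 ?invr_ge0 ?sqr_ge0//.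
  rewrite ge0_ler_powR ?nnegrE ?(ltW yJ0) ?mulr_ge0 ?(ltW X0)//; move: ga1; lra.
(* The power X^(ga - 1) is exp(2 dl l) with dl > 0 because beta < alpha, and exp z >= (z / 3)^3
   beats l^2. *)
have big : 2 * K * X < X `^ ga / l ^+ 2.
  rewrite ltr_pdivlMr//.
  have -> : X `^ ga = X * expR (2 * dl * l).
    rewrite /powR gt_eqF// -{2}(lnK (X0 : X \is Num.pos)) -expRD hlX; congr expR.
    by rewrite /dl; field; rewrite gt_eqF//; move: alpha_gt0; lra.
  have -> : 2 * K * X * l ^+ 2 = X * (2 * K * l ^+ 2) by ring.
  rewrite ltr_pM2l//.
  have hz : (2 * dl * l / 3) ^+ 3 <= expR (2 * dl * l).
    have z0 : 0 <= 2 * dl * l / 3 by rewrite divr_ge0// mulr_ge0// ?(ltW l0)// mulr_ge0// ltW.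
    have -> : expR (2 * dl * l) = expR (2 * dl * l / 3) ^+ 3 by rewrite -expRM_natl; congr expR; field.
    by rewrite ler_pXn2r ?nnegrE ?expR_ge0//; have := expR_ge1Dx (2 * dl * l / 3); lra.
  apply: lt_le_trans hz.
  have -> : (2 * dl * l / 3) ^+ 3 = l ^+ 2 * (l / (3 / (2 * dl)) ^+ 3) by field; rewrite gt_eqF.
  rewrite (mulrC (2 * K)) ltr_pM2l// ltr_pdivlMr; first by move: l2; lra.
  by rewrite exprn_gt0// divr_gt0// mulr_gt0.
have q1 : 0 < X `^ ga / l ^+ 2 by rewrite divr_gt0// powR_gt0.
have hS : small_ball_cost Pi e <= K * X.
  rewrite -hnk; apply: (small_ball_cost_le alpha_gt0 pc K2 hK) => //; first by rewrite ler1n.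
  rewrite ne hnk; apply: lt_le_trans big _; rewrite ler_peMl ?(ltW q1)//; lra.
have : X `^ ga / l ^+ 2 <= C ^+ 2 * (X `^ ga / l ^+ 2) by rewrite ler_peMl ?(ltW q1)//; lra.
move: hI hS big; set Q := X `^ ga / l ^+ 2; lra.
Unshelve. all: by end_near.
Qed.

(** At a frequency 2^J comparable with the effective dimension the coefficient is of order r / ln n,
    more than twice the radius since q > 1; approximating it alone already costs 9 n eps^2. *)
Lemma critical_zeta (C q : R) : 1 < q -> \forall n \near \oo,
  9 * (n%:R * (C * r n / ln n%:R) ^+ 2) <= concentration alpha Pi f (r n * ln n%:R `^ (- q)).
Proof.
move=> q1; have [d' [T' [P' [b pc]]]] := series_prior_coordinates prior.
have Lsq : 0 < L ^+ 2 by rewrite exprn_gt0.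
(* Here 324 = 9 * 36, where 36 = 4 * 3^2 comes from the factor L^2 / 4 and from J + 7 <= 3 ln n. *)
pose B := 1 + 324 * C ^+ 2 / L ^+ 2.
have B1 : 1 <= B.
  rewrite lerDl; apply: divr_ge0; last exact: sqr_ge0.
  by apply: mulr_ge0; [exact: ler0n|exact: sqr_ge0].
have B0 : 0 < B by exact: lt_le_trans B1.
(* The coefficient exceeds L (2 B)^(- beta) r / (3 l), which is at least 2 r l^(- q) once l^(q - 1)
   >= G. *)
pose G := 6 * (2 * B) `^ beta / L.
have G0 : 0 < G by rewrite divr_gt0// mulr_gt0// powR_gt0// mulr_gt0.
near=> n.
have n0 : (0 < n)%N by near: n; exists 1%N.
have l1 : 1 <= ln n%:R :> R by near: n; exact: ln_large.
have l2 : 7 + 2 * ln (2 * B) <= ln n%:R by near: n; exact: ln_large.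
have l3 : G `^ (q - 1)^-1 <= ln n%:R by near: n; exact: ln_large.
have hnk : n%:R `^ kappa = x n by [].
move: (x n) (x1 n0) (lnx n) (nr n0) (rE n) hnk => X X1 hlX hnr hr hnk.
have X0 : 0 < X by exact: lt_le_trans X1.
set l := ln n%:R in l1 l2 l3 hlX *; have l0 : 0 < l by exact: lt_le_trans l1.
have r0 : 0 < r n by rewrite powR_gt0// ltr0n.
have BX1 : 1 <= B * X by rewrite -[leLHS]mul1r ler_pM.
have BX0 : 0 < B * X by exact: lt_le_trans BX1.
have [J /andP[J1 J2]] := dyadic_scale BX1.
have yJ0 : 0 < y J by exact: lt_le_trans J1.
have j7 : 0 < (J + 7)%:R :> R by rewrite ltr0n addn_gt0 orbT.
have J3 : (J + 7)%:R <= 3 * l.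
  have h : J%:R * ln 2 <= ln (2 * B) + kappa * l.
    by rewrite -ln_y -hlX -lnM ?posrE ?mulr_gt0// ler_ln ?posrE ?mulr_gt0// -mulrA.
  have h2 : J%:R * 2^-1 <= J%:R * ln 2 :> R by rewrite ler_wpM2l.
  have h3 : kappa * l <= l by rewrite ler_piMl ?(ltW l0)// ltW.
  by rewrite natrD; move: l2 h h2 h3; set lb := ln (2 * B); set j2 := _ * ln 2; lra.
have z0 : 0 < r n * l `^ (- q) by rewrite mulr_gt0// powR_gt0.
rewrite concentrationE; apply: (@le_trans _ _ (approx_cost alpha f (r n * l `^ (- q)))); last first.
  by rewrite lerDl; exact: small_ball_cost_ge0 alpha_gt0 pc _ z0.
have hv : 2 * (r n * l `^ (- q)) <= critical_coef beta L J.
  apply: (@le_trans _ _ (L * ((2 * B) `^ (- beta) * r n) / (3 * l))); last first.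
    rewrite /critical_coef; apply: ler_pM.
    - by rewrite mulr_ge0 ?(ltW L_gt0)// mulr_ge0 ?powR_ge0// ltW.
    - by rewrite invr_ge0 mulr_ge0// ltW.
    - rewrite ler_wpM2l ?(ltW L_gt0)// hr -powRM ?mulr_ge0 ?(ltW B0) ?(ltW X0)//.
      rewrite !powRN lef_pV2 ?posrE ?powR_gt0 ?mulr_gt0//.
      by rewrite ge0_ler_powR ?nnegrE ?(ltW yJ0) ?(ltW beta_gt0) ?mulr_ge0 ?(ltW B0) ?(ltW X0)// -mulrA.
    - by rewrite lef_pV2 ?posrE ?mulr_gt0.
  have lq : G <= l `^ (q - 1).
    have p : 0 < q - 1 by rewrite subr_gt0.
    have -> : G = (G `^ (q - 1)^-1) `^ (q - 1).
      by rewrite -powRrM mulVf ?powRr1 ?(ltW G0)// gt_eqF.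
    by rewrite ge0_ler_powR ?nnegrE ?powR_ge0 ?(ltW l0) ?(ltW p).
  have e1 : l `^ (- q) = (l `^ (q - 1) * l)^-1.
    by rewrite -{3}(powRr1 (ltW l0)) -powRD ?subrK ?powRN// (gt_eqF l0) implybT.
  have p2 : 0 < (2 * B) `^ beta by rewrite powR_gt0// mulr_gt0.
  have pl : 0 < l `^ (q - 1) by rewrite powR_gt0.
  rewrite e1 powRN.
  have -> : L * ((((2 * B) `^ beta)^-1) * r n) / (3 * l) = 2 * r n / l * G^-1.
    by rewrite /G; field; rewrite !gt_eqF.
  have -> : 2 * (r n * (l `^ (q - 1) * l)^-1) = 2 * r n / l * (l `^ (q - 1))^-1.
    by field; rewrite !gt_eqF.
  by rewrite ler_wpM2l ?divr_ge0 ?mulr_ge0 ?(ltW r0) ?(ltW l0)// lef_pV2 ?posrE.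
apply: le_trans (critical_cost_lower alpha ef cf z0 hv).
have -> : 9 * (n%:R * (C * r n / l) ^+ 2) = 9 * C ^+ 2 * (X `^ ga / l ^+ 2).
  by rewrite expr_div_n exprMn -hnr; ring.
apply: (@le_trans _ _ (L ^+ 2 / 4 * (B * X `^ ga / (9 * l ^+ 2)))).
  have -> : L ^+ 2 / 4 * (B * X `^ ga / (9 * l ^+ 2)) = L ^+ 2 * B / 36 * (X `^ ga / l ^+ 2).
    by field; rewrite gt_eqF.
  rewrite ler_wpM2r ?divr_ge0 ?powR_ge0 ?sqr_ge0//.
  have -> : L ^+ 2 * B / 36 = L ^+ 2 / 36 + 9 * C ^+ 2 by rewrite /B; field; rewrite gt_eqF.
  by rewrite lerDr divr_ge0// ltW.
rewrite ler_wpM2l ?divr_ge0 ?(ltW Lsq)//; apply: ler_pM.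
- by rewrite mulr_ge0 ?powR_ge0// ltW.
- by rewrite invr_ge0 mulr_ge0// sqr_ge0.
- apply: (@le_trans _ _ ((B * X) `^ ga)); last first.
    by rewrite ge0_ler_powR ?nnegrE ?(ltW yJ0) ?(ltW BX0)//; move: ga1; lra.
  by rewrite powRM ?(ltW B0) ?(ltW X0)// ler_wpM2r ?powR_ge0// le1r_powR.
- have -> : 9 * l ^+ 2 = (3 * l) ^+ 2 by ring.
  by rewrite lef_pV2 ?posrE ?exprn_gt0 ?mulr_gt0// ler_pXn2r ?nnegrE ?(ltW j7) ?mulr_ge0 ?(ltW l0).
Unshelve. all: by end_near.
Qed.

Context d (T : measurableType d) (P : probability T R).
Variables (W : R -> {RV P >-> R}) (p : nat -> L2 R * trajectory R -> R).
Hypothesis BM : brownian_motion W.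
Hypothesis lik : forall n, (0 < n)%N -> likelihood W n (p n).

Lemma critical_posterior_concentrates (q : R) : 1 < q ->
  exists M0 : R, forall M : R, M0 <= M ->
    posterior_concentrates Pi W p f
      (fun n => annulus f (r n * ln n%:R `^ (- q)) (M * r n)).
Proof.
move=> q1; have [C C1 hC] := critical_eps; have C0 : 0 < C by exact: lt_le_trans C1.
exists (41 * C) => M hM; have M0 : 0 < M by apply: lt_le_trans hM; rewrite mulr_gt0.
apply: (@posterior_concentrates_eventually _ _ _ _ _ _ alpha_gt0 prior _ _ BM lik _ ef
  (fun n => C * r n / ln n%:R) (fun n => r n * ln n%:R `^ (- q)) (fun n => M * r n)).
near=> n.
have n0 : (0 < n)%N by near: n; exists 1%N.
have l1 : 1 <= ln n%:R :> R by near: n; exact: ln_large.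
have r0 : 0 < r n by rewrite powR_gt0// ltr0n.
have l0 : 0 < ln n%:R :> R by exact: lt_le_trans l1.
split.
- by rewrite divr_gt0// mulr_gt0.
- by rewrite mulr_gt0// powR_gt0.
- by rewrite mulr_gt0.
- by near: n.
split; first by near: n; exact: critical_zeta.
rewrite expr_div_n !exprMn.
have a0 : 0 <= C ^+ 2 * r n ^+ 2 by apply: mulr_ge0; exact: sqr_ge0.
have h1 : C ^+ 2 * r n ^+ 2 / ln n%:R ^+ 2 <= C ^+ 2 * r n ^+ 2.
  rewrite ler_pdivrMr; last exact: exprn_gt0.
  by apply: ler_peMr => //; exact: exprn_ege1.
have h2 : (41 * C) ^+ 2 * r n ^+ 2 <= M ^+ 2 * r n ^+ 2.
  apply: ler_wpM2r; first exact: sqr_ge0.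
  by rewrite ler_pXn2r ?nnegrE ?(ltW M0)//; apply: mulr_ge0; [exact: ler0n|exact: ltW].
have h3 : (41 * C) ^+ 2 * r n ^+ 2 = 1681 * (C ^+ 2 * r n ^+ 2) by ring.
by move: a0 h1 h2 h3; set u := _ / _ ^+ 2; lra.
Unshelve. all: by end_near.
Qed.

End theorem_part3.

Theorem theorem2 (R : realType) (alpha beta L : R)
    (alpha_gt0 : 0 < alpha) (beta_gt0 : 0 < beta) (L_gt0 : 0 < L) :
  [/\ (* (i) *)
      forall (Pi : probability (L2 R) R), series_prior alpha Pi ->
      forall (d : measure_display) (Omega : measurableType d)
        (P : probability Omega R) (W : R -> {RV P >-> R})
        (p : nat -> L2 R * trajectory R -> R),
      brownian_motion W ->
      (forall n, (0 < n)%N -> likelihood W n (p n)) ->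
      forall f0 : L2 R, sobolev_ball beta L f0 ->
      forall eps zeta : nat -> R,
      upper_rate alpha Pi f0 eps ->
      lower_rate alpha Pi f0 eps zeta ->
      exists M0 : R, forall M : R, M0 <= M ->
        posterior_concentrates Pi W p f0
          (fun n => annulus f0 (zeta n) (M * eps n)),
      (* (ii) *)
      exists C C' : R, [/\ 0 < C, 0 < C' &
      forall (Pi : probability (L2 R) R), series_prior alpha Pi ->
      forall f0 : L2 R, sobolev_ball beta L f0 ->
      exists eps : nat -> R,
        [/\ upper_rate alpha Pi f0 eps,
            forall n, (0 < n)%N -> eps n <= C * rate alpha beta n &
            alpha <= beta ->
            exists2 zeta : nat -> R, lower_rate alpha Pi f0 eps zeta &
              forall n, (0 < n)%N -> rate alpha beta n <= C' * zeta n]] &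
      (* (iii) *)
      beta < alpha ->
      exists2 f0 : L2 R, sobolev_ball beta L f0 &
      forall (Pi : probability (L2 R) R), series_prior alpha Pi ->
      forall (d : measure_display) (Omega : measurableType d)
        (P : probability Omega R) (W : R -> {RV P >-> R})
        (p : nat -> L2 R * trajectory R -> R),
      brownian_motion W ->
      (forall n, (0 < n)%N -> likelihood W n (p n)) ->
      forall q : R, 1 + beta / 2 < q ->
      exists M0 : R, forall M : R, M0 <= M ->
        posterior_concentrates Pi W p f0
          (fun n => annulus f0 (rate alpha beta n * ln n%:R `^ (- q))
                               (M * rate alpha beta n))].
Proof.
split.
- move=> Pi prior d Omega P W p BM lik f0 sf eps zeta ue lz.
  have [ef _] := sobolev_ball_expandable sf.
  exact: (posterior_concentrates_annulus alpha_gt0 prior BM lik ef ue lz).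
- have [ab|ba] := leP alpha beta.
    have [C [C' [C0 C'0 h]]] := rates_smooth alpha_gt0 beta_gt0 L_gt0 ab.
    exists C, C'; split=> // Pi prior f0 sf.
    have [eps [zeta [h1 h2 h3 h4]]] := h Pi prior f0 sf.
    by exists eps; split=> // _; exists zeta.
  have [C [C0 h]] := rates_rough alpha_gt0 beta_gt0 L_gt0 ba.
  (* Here alpha <= beta is false, so any positive second constant will do. *)
  exists C, 1; split=> // Pi prior f0 sf; exists (fun n => C * rate alpha beta n).
  by split=> //; exact: h.
- move=> ba; have [f [ef cf sf]] := critical_signal_exists beta_gt0 L_gt0.
  exists f => // Pi prior d Omega P W p BM lik q hq.
  apply: (critical_posterior_concentrates beta_gt0 L_gt0 ba ef cf prior BM lik).
  by apply: le_lt_trans hq; rewrite lerDl divr_ge0// ltW.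
Qed.
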